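(* Let $k$ be an algebraically closed field, let $G$ be a reductive algebraic group over $k$, $B$ a Borel subgroup of $G$, $P\ge B$ a parabolic subgroup, and $M$ and $N$ $G$-modules. Then $$\mathrm{Ext}^i_{(G,P)}(M,N)=0\quad\text{for } i>0.$$
   Context: Modules are rational modules. For a closed subgroup $H\le G$: an exact sequence of $G$-modules with differentials $d_i:M_i\to M_{i+1}$ is $(G,H)$-exact if $\mathrm{Ker}(d_i)$ is a direct $H$-module summand of $M_i$ for all $i$. A $G$-module $I$ is $(G,H)$-injective if for every $(G,H)$-exact sequence $0\to M_1\xrightarrow{d_1}M_2\to M_3\to0$ and every $G$-homomorphism $f:M_1\to I$ there is a $G$-homomorphism $h:M_2\to I$ with $f=h\circ d_1$. A $(G,H)$-injective resolution of $N$ is a $(G,H)$-exact sequence $0\to N\to I_0\to I_1\to\cdots$ with all $I_j$ being $(G,H)$-injective; these exist. $\mathrm{Ext}^i_{(G,H)}(M,N)$ is the $i$-th cohomology of $0\to\mathrm{Hom}_G(M,I_0)\to\mathrm{Hom}_G(M,I_1)\to\cdots$ (independent of the resolution). *)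

(* Defs.v *)
(* MathComp with MathComp-Analysis (classical sets and topology). *)
From HB Require Import structures.
From mathcomp Require Import all_boot all_order all_algebra.
From mathcomp Require Import boolp classical_sets functions cardinality.
From mathcomp Require Import topology.

Set Implicit Arguments.
Unset Strict Implicit.
Unset Printing Implicit Defensive.

Import GRing.Theory.
Local Open Scope classical_set_scope.
Local Open Scope ring_scope.

Section AffineVarieties.
Variables (k : closedFieldType) (X : Type).

Definition subalgebra (A : set (X -> k)) : Prop :=
  [/\ forall c : k, A (cst c),
      forall f g, A f -> A g -> A (f \+ g)
    & forall f g, A f -> A g -> A (f \* g)].

(* phi is only meaningful on A, where it is a k-algebra morphism to k. *)
Definition algebra_point (A : set (X -> k)) (phi : (X -> k) -> k) : Prop :=
  [/\ forall c : k, phi (cst c) = c,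
      forall f g, A f -> A g -> phi (f \+ g) = phi f + phi g
    & forall f g, A f -> A g -> phi (f \* g) = phi f * phi g].

(* An affine variety over the algebraically closed field k, given by its set
   of points X and its coordinate algebra A = k[X]: a finitely generated
   algebra of functions on X whose k-algebra morphisms to k are exactly the
   evaluations at the points of X, different points giving different
   morphisms. *)
Definition affine_variety (A : set (X -> k)) : Prop :=
  [/\ subalgebra A,
      exists2 S, finite_set S & A = smallest subalgebra S
    & forall phi, algebra_point A phi ->
        exists! x : X, forall f, A f -> phi f = f x].

End AffineVarieties.

(* An (affine) algebraic group over k.  Since k[G x G] is the tensor square of
   k[G], multiplication is a morphism of varieties iff (x, y) |-> f (x * y) is
   a finite sum of functions g(x) h(y), for every regular f. *)
HB.mixin Record isAlgGroup (k : closedFieldType) G of Group G := {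
  regular : set (G -> k);
  regular_variety : affine_variety regular;
  regular_mul : forall f, regular f ->
    exists (n : nat) (g h : 'I_n -> G -> k),
      (forall i, regular (g i) /\ regular (h i)) /\
      forall x y : G, f (x * y)%g = \sum_(i < n) g i x * h i y;
  regular_inv : forall f, regular f -> regular (fun x => f (x^-1)%g)
}.

#[short(type="algGroupType")]
HB.structure Definition AlgGroup (k : closedFieldType) :=
  {G of isAlgGroup k G & Group G}.

Arguments regular {k} G : rename.

(* The underlying set of G, carrying the Zariski topology. *)
Definition zariski (k : closedFieldType) (G : algGroupType k) : Type := G.

Section Zariski.
Variables (k : closedFieldType) (G : algGroupType k).

Definition zariski_open (U : set (zariski G)) : Prop :=
  exists2 S : set (G -> k), S `<=` regular G &
    U = [set x | exists2 f, S f & f x != 0].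

Let zariski_openT : zariski_open setT.
Proof.
have [[A1 _ _] _ _] := @regular_variety k G.
exists [set cst 1]; first by move=> _ ->; apply: A1.
by apply/seteqP; split => // x _; exists (cst 1) => //; apply: oner_neq0.
Qed.

Let zariski_openI (U V : set (zariski G)) :
  zariski_open U -> zariski_open V -> zariski_open (U `&` V).
Proof.
have [[_ _ AM] _ _] := @regular_variety k G.
move=> [S SA ->] [T TA ->].
exists [set h | exists f g, [/\ S f, T g & h = f \* g]].
  by move=> _ [f [g [/SA fA /TA gA ->]]]; apply: AM.
apply/seteqP; split => [x [[f Sf fx] [g Tg gx]]|x [_ [f [g [Sf Tg ->]]]]] /=.
  exists (f \* g); first by exists f, g.
  by rewrite mulf_neq0.
by rewrite mulf_eq0 negb_or => /andP[fx gx]; split; [exists f|exists g].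
Qed.

Let zariski_open_bigU (I : Type) (U : I -> set (zariski G)) :
  (forall i, zariski_open (U i)) -> zariski_open (\bigcup_i U i).
Proof.
move=> oU; exists [set f | exists2 S : set (G -> k), S `<=` regular G /\
    (exists i, U i = [set x | exists2 f, S f & f x != 0]) & S f].
  by move=> f [S [SA _] /SA].
apply/seteqP; split => [x [i _]|x [f [S [_ [i Ui]] Sf] fx]].
  have [S SA Ui] := oU i; rewrite Ui => -[f Sf fx].
  by exists f => //; exists S => //; split => //; exists i.
by exists i => //; rewrite Ui; exists f.
Qed.

HB.instance Definition _ := Choice.copy (zariski G) G.
HB.instance Definition _ := isOpenTopological.Build (zariski G)
  zariski_openT zariski_openI zariski_open_bigU.

End Zariski.

Section ReductiveGroups.
Variables (k : closedFieldType) (G : algGroupType k).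
Implicit Types H U B P : set (zariski G).

Definition subgroup (H : set G) : Prop :=
  H 1%g /\ forall x y, H x -> H y -> H (x * y^-1)%g.

Definition closed_subgroup H : Prop := subgroup H /\ closed H.

Definition normal_subgroup (H : set G) : Prop :=
  subgroup H /\ forall x y, H x -> H (x ^ y)%g.

Definition derived (H : set G) : set G :=
  smallest subgroup [set [~ x, y]%g | x in H & y in H].

Definition solvable_subgroup (H : set G) : Prop :=
  subgroup H /\ exists n, iter n derived H = [set 1%g].

(* g is unipotent iff right translation by g is a locally unipotent operator
   on k[G]. *)
Definition translation_sub1 (g : G) (f : G -> k) : G -> k :=
  fun x => f (x * g)%g - f x.

Definition unipotent (g : G) : Prop :=
  forall f, regular G f ->
    exists n, iter n (translation_sub1 g) f = cst 0.

(* Connected, with trivial unipotent radical, the latter being the largest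
   closed connected normal unipotent subgroup. *)
Definition reductive : Prop :=
  connected [set: zariski G] /\
  forall U, closed_subgroup U -> connected U -> normal_subgroup U ->
    (forall g, U g -> unipotent g) -> U = [set 1%g].

Definition closed_connected_solvable H : Prop :=
  [/\ closed_subgroup H, connected H & solvable_subgroup H].

Definition borel B : Prop :=
  closed_connected_solvable B /\
  forall H, closed_connected_solvable H -> B `<=` H -> H = B.

Definition parabolic P : Prop :=
  closed_subgroup P /\ exists2 B, borel B & B `<=` P.

End ReductiveGroups.

Arguments reductive {k} G.

(* Rational module, possibly of infinite dimension: the last axiom says that
   v |-> (g |-> g v) takes its values in V (x) k[G], i.e. that V is locally
   finite with regular matrix coefficients. *)
Record ratModule (k : closedFieldType) (G : algGroupType k) := RatModule {
  rat_sort :> lmodType k;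
  rat_act : G -> {linear rat_sort -> rat_sort};
  rat_act1 : forall v, rat_act 1%g v = v;
  rat_actM : forall g h v, rat_act (g * h)%g v = rat_act g (rat_act h v);
  rat_rational : forall v, exists (n : nat) (f : 'I_n -> G -> k)
      (w : 'I_n -> rat_sort),
    (forall i, regular G (f i)) /\
    forall g, rat_act g v = \sum_(i < n) f i g *: w i
}.

Section RelativeHomology.
Variables (k : closedFieldType) (G : algGroupType k).
Implicit Types (H : set G) (M N I : ratModule G).

Definition hom_over H M N (f : {linear M -> N}) : Prop :=
  forall g, H g -> forall m, f (rat_act M g m) = rat_act N g (f m).

Definition ghom M N (f : {linear M -> N}) : Prop := hom_over [set: G] f.

Definition kernel M N (f : {linear M -> N}) : set M := [set m | f m = 0].

Definition submodule_over H M (K : set M) : Prop :=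
  [/\ K 0, forall a u v, K u -> K v -> K (a *: u + v)
    & forall g, H g -> forall v, K v -> K (rat_act M g v)].

Definition direct_summand H M (K : set M) : Prop :=
  submodule_over H K /\
  exists2 C : set M, submodule_over H C &
    K `&` C = [set 0] /\
    forall m, exists u v, [/\ K u, C v & m = u + v].

(* (G,H)-exactness of 0 -> M1 -> M2 -> M3 -> 0.  The kernels of M1 -> M2 and
   M3 -> 0 are 0 and M3, which are always summands. *)
Definition rel_short_exact H M1 M2 M3
    (d1 : {linear M1 -> M2}) (d2 : {linear M2 -> M3}) : Prop :=
  [/\ ghom d1 /\ ghom d2,
      injective d1,
      range d1 = kernel d2,
      range d2 = setT
    & direct_summand H (kernel d2)].

Definition rel_injective H I : Prop :=
  forall M1 M2 M3 (d1 : {linear M1 -> M2}) (d2 : {linear M2 -> M3}),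
    rel_short_exact H d1 d2 ->
    forall f : {linear M1 -> I}, ghom f ->
      exists2 h : {linear M2 -> I}, ghom h & forall m, f m = h (d1 m).

(* 0 -> N -> I_0 -> I_1 -> ..., with augmentation N -> I_0 and differentials
   I_i -> I_(i+1). *)
Record rel_injective_resolution H N := RelInjectiveResolution {
  res_obj :> nat -> ratModule G;
  res_aug : {linear N -> res_obj 0%N};
  res_diff : forall i, {linear res_obj i -> res_obj i.+1};
  res_aug_ghom : ghom res_aug;
  res_diff_ghom : forall i, ghom (res_diff i);
  res_aug_inj : injective res_aug;
  res_exact0 : range res_aug = kernel (res_diff 0%N);
  res_exactS : forall i, range (res_diff i) = kernel (res_diff i.+1);
  res_summand : forall i, direct_summand H (kernel (res_diff i));
  res_injective : forall i, rel_injective H (res_obj i)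
}.

Section Cohomology.
Variables (H : set G) (M N : ratModule G).
Variable R : rel_injective_resolution H N.

Definition cocycles (i : nat) : set {linear M -> R i} :=
  [set f | ghom f /\ forall m, res_diff R i (f m) = 0].

Definition coboundaries (i : nat) : set {linear M -> R i} :=
  match i with
  | 0%N => [set f | forall m, f m = 0]
  | j.+1 => [set f | exists2 g : {linear M -> R j}, ghom g &
                       forall m, f m = res_diff R j (g m)]
  end.

End Cohomology.

Arguments cocycles {H} M {N} R i _.
Arguments coboundaries {H} M {N} R i _.

(* Ext^i_(G,H)(M, N) = 0: the i-th cohomology of Hom_G(M, I) is zero, for
   every (G,H)-injective resolution I of N. *)
Definition rel_Ext_zero H (i : nat) M N : Prop :=
  forall R : rel_injective_resolution H N,
    cocycles M R i `<=` coboundaries M R i.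

End RelativeHomology.

(* Main.v *)
(* A P-equivariant map phi between G-modules is G-equivariant: the map
   g |-> g^-1 phi (g m) has regular coefficients and is invariant under left
   translations by P, hence by B, and the regular functions on G invariant
   under B are constant. Therefore the lift of a cocycle through a P-stable
   complement of the kernel of the differential, which is P-equivariant, is a
   G-morphism.

   The constancy of the invariants replaces the completeness of G/B. It is
   proved by descent on a closed connected subgroup S containing B. If S is not
   solvable, it has a representation without stable line, and B stabilizes a
   line in a minimal closed S-stable cone Z of it (Borel). By descent, an
   invariant of B is algebraic over the homogeneous coordinates of the orbit of
   this line. If it were not constant, a place of k(S) where it has a pole would
   give a point of Z where the leading coefficient of its equation vanishes,
   which is impossible since Z is minimal. *)

Require Import Defs.
From HB Require Import structures.
From mathcomp Require Import all_boot all_order all_algebra.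
From mathcomp Require Import boolp classical_sets functions cardinality.
From mathcomp Require Import topology.
From mathcomp Require Import zify.

Set Implicit Arguments.
Unset Strict Implicit.
Unset Printing Implicit Defensive.

Import GRing.Theory.
Local Open Scope classical_set_scope.
Local Open Scope ring_scope.

(** * Subalgebras and simple extensions *)

(** Neither a quotient variety nor a projective space is constructed. A projective variety is
    replaced by a closed cone of row vectors, and completeness by places: a point of the cone with
    coordinates in k(S), once divided by a coordinate of minimal valuation, has a nonzero residue in
    the same cone. A morphism to k defined on part of a ring is represented by its graph, so that
    extensions are inclusions and maximal ones come from Zorn's lemma. The minimal cone stands for a
    closed orbit. The invariant is only shown to be algebraic over the orbit coordinates, and not
    rational in them, because the stabilizer of the line may be disconnected and the orbit map
    inseparable: what the finite index of the identity component gives is a finite number of values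
    on each fibre. *)

Section Subalgebras.
Variables (k : nzRingType) (E : comNzRingType) (c : {rmorphism k -> E}).
Implicit Types (A : set E) (x y : E) (p q : {poly E}).

(** Subalgebras are sets inside one fixed ring, so that towers of adjunctions need no change of
    type. The same notion, over the diagonal, serves for graphs of morphisms in [D * k]. *)
Definition subalg A : Prop :=
  [/\ forall a, A (c a), forall x y, A x -> A y -> A (x + y)
    & forall x y, A x -> A y -> A (x * y)].

Definition polyIn A p : Prop := forall i, A p`_i.

Definition adjoin A x : set E := [set z | exists2 p, polyIn A p & z = p.[x]].

Section Closure.
Variables (A : set E) (sA : subalg A).

Lemma subalgC a : A (c a). Proof. by case: sA. Qed.

Lemma subalgD x y : A x -> A y -> A (x + y).
Proof. by case: sA => _ + _; apply. Qed.

Lemma subalgM x y : A x -> A y -> A (x * y).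
Proof. by case: sA => _ _; apply. Qed.

Lemma subalg0 : A 0. Proof. by rewrite -(rmorph0 c); apply: subalgC. Qed.

Lemma subalg1 : A 1. Proof. by rewrite -(rmorph1 c); apply: subalgC. Qed.

Lemma subalgN x : A x -> A (- x).
Proof.
by move=> Ax; rewrite -mulN1r -(rmorphN1 c); apply: subalgM => //;
  apply: subalgC.
Qed.

Lemma subalgB x y : A x -> A y -> A (x - y).
Proof. by move=> Ax Ay; apply: subalgD => //; apply: subalgN. Qed.

Lemma subalg_sum (I : Type) (r : seq I) (P : pred I) (F : I -> E) :
  (forall i, P i -> A (F i)) -> A (\sum_(i <- r | P i) F i).
Proof. by move=> AF; elim/big_ind: _ => //;
  [apply: subalg0|apply: subalgD]. Qed.

Lemma subalgX x n : A x -> A (x ^+ n).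
Proof.
move=> Ax; elim: n => [|n IHn]; first by rewrite expr0; apply: subalg1.
by rewrite exprS; apply: subalgM.
Qed.

Lemma overC x : A x -> polyIn A x%:P.
Proof. by move=> Ax i; rewrite coefC; case: ifP => // _; apply: subalg0. Qed.

Lemma overX : polyIn A 'X.
Proof.
by move=> i; rewrite coefX; case: (i == 1)%N; [apply: subalg1|apply: subalg0].
Qed.

Lemma overXn n : polyIn A 'X^n.
Proof.
by move=> i; rewrite coefXn; case: (i == n)%N; [apply: subalg1|apply: subalg0].
Qed.

Lemma overD p q : polyIn A p -> polyIn A q -> polyIn A (p + q).
Proof. by move=> Ap Aq i; rewrite coefD; apply: subalgD. Qed.

Lemma overN p : polyIn A p -> polyIn A (- p).
Proof. by move=> Ap i; rewrite coefN; apply: subalgN. Qed.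

Lemma overB p q : polyIn A p -> polyIn A q -> polyIn A (p - q).
Proof. by move=> Ap Aq; apply: overD => //; apply: overN. Qed.

Lemma overM p q : polyIn A p -> polyIn A q -> polyIn A (p * q).
Proof. by move=> Ap Aq i; rewrite coefM; apply: subalg_sum => j _;
  apply: subalgM. Qed.

Lemma overZ x p : A x -> polyIn A p -> polyIn A (x *: p).
Proof. by move=> Ax Ap i; rewrite coefZ; apply: subalgM. Qed.

Lemma adjoin_subset x : A `<=` adjoin A x.
Proof. by move=> y Ay; exists y%:P; [apply: overC|rewrite hornerC]. Qed.

Lemma adjoin_gen x : adjoin A x x.
Proof. by exists 'X; [apply: overX|rewrite hornerX]. Qed.

Lemma adjoin_subalg x : subalg (adjoin A x).
Proof.
split=> [a|_ _ [p Ap ->] [q Aq ->]|_ _ [p Ap ->] [q Aq ->]].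
- exact/adjoin_subset/subalgC.
- by exists (p + q); [apply: overD|rewrite hornerD].
- by exists (p * q); [apply: overM|rewrite hornerM].
Qed.

(** The leading coefficient of [p] need not be invertible, whence the power in front of [q];
    quotient and remainder keep their coefficients in [A]. *)
Lemma pseudo_division p q : polyIn A p -> polyIn A q -> p != 0 ->
  exists s h r, [/\ polyIn A h, polyIn A r, (size r < size p)%N
                  & (lead_coef p) ^+ s *: q = h * p + r].
Proof.
move=> Ap + p0; have [n] := ubnP (size q); elim: n q => // n IHn q.
rewrite ltnS => leqn Aq.
have [ltqp|lepq] := ltnP (size q) (size p).
  exists 0%N, 0, q; split=> //; last by rewrite expr0 scale1r mul0r add0r.
  by move=> i; rewrite coef0; apply: subalg0.
pose a := lead_coef p; pose b := lead_coef q.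
have Aa : A a by apply: Ap.
have Ab : A b by apply: Aq.
pose m := b *: 'X^(size q - size p).
have Am : polyIn A m by apply: overZ => //; apply: overXn.
have sp : (0 < size p)%N by rewrite size_poly_gt0.
have [] := IHn (a *: q - m * p); last 1 first.
- move=> s [h [r [Ah Ar ltr E1]]].
  exists s.+1, (h + a ^+ s *: m), r; split=> //.
    by apply: overD => //; apply: overZ => //; apply: subalgX.
  by rewrite mulrDl addrAC -E1 scalerBr scalerA -exprSr -/a -(scalerAl _ m)
    subrK.
- suff : (size (a *: q - m * p)%R <= (size q).-1)%N by lia.
  apply/leq_sizeP => i lei; rewrite coefB coefZ -scalerAl coefZ coefXnM.
  case: ltnP => [|lein]; first by lia.
  have [Ei|neqi] := eqVneq i (size q).-1.
    have -> : (i - (size q - size p) = (size p).-1)%N by lia.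
    by rewrite Ei -!lead_coefE mulrC subrr.
  have lei2 : (size q <= i)%N by rewrite leqNgt; apply/negP => lti;
    case/eqP: neqi; lia.
  have lei3 : (size p <= i - (size q - size p))%N by lia.
  by rewrite !(nth_default _ lei2) !(nth_default _ lei3) !mulr0 subrr.
- by apply: overB; [apply: overZ|apply: overM].
Qed.

End Closure.

Definition adjoins A (xs : seq E) : set E := foldl adjoin A xs.

Lemma adjoins_subalg A (xs : seq E) : subalg A -> subalg ((adjoins A xs)).
Proof. by elim: xs A => [|x xs IHxs] A sA //=; apply/IHxs/adjoin_subalg. Qed.

Lemma adjoins_subset A (xs : seq E) : subalg A -> A `<=` adjoins A xs.
Proof.
elim: xs A => [|x xs IHxs] A sA //=;
  apply: subset_trans (IHxs _ (adjoin_subalg sA x)).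
exact: (adjoin_subset sA).
Qed.

Lemma adjoins_gen A (xs : seq E) x :
  subalg A -> x \in xs -> adjoins A xs x.
Proof.
elim: xs A => [|y xs IHxs] A sA //=; rewrite in_cons => /orP[/eqP->|].
  exact/(adjoins_subset _ (adjoin_subalg sA y))/(adjoin_gen sA).
by apply: IHxs; apply: adjoin_subalg.
Qed.

Lemma range_subalg : subalg (range c).
Proof.
split=> [a|_ _ [a _ <-] [b _ <-]|_ _ [a _ <-] [b _ <-]]; first by exists a.
  by exists (a + b); rewrite ?rmorphD.
by exists (a * b); rewrite ?rmorphM.
Qed.

End Subalgebras.

(** * Graphs of partial morphisms to k *)

Lemma pairM (R S : pzRingType) (a c : R) (b d : S) :
  (a, b) * (c, d) = (a * c, b * d).
Proof. by []. Qed.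

Lemma pairB (R S : zmodType) (a c : R) (b d : S) :
  (a, b) - (c, d) = (a - c, b - d).
Proof. by []. Qed.

Section HomGraphs.
Variables (k : closedFieldType) (D : comNzRingType) (c : {rmorphism k -> D}).

Definition diag (a : k) : D * k := (c a, a).

Fact diag_zmod_morphism : zmod_morphism diag.
Proof. by move=> a b; rewrite /diag rmorphB. Qed.

Fact diag_monoid_morphism : monoid_morphism diag.
Proof. by split=> [|a b]; rewrite /diag ?rmorph1 ?rmorphM. Qed.

HB.instance Definition _ :=
  GRing.isZmodMorphism.Build k (D * k)%type diag diag_zmod_morphism.
HB.instance Definition _ :=
  GRing.isMonoidMorphism.Build k (D * k)%type diag diag_monoid_morphism.

(* Gr is the graph of a k-algebra morphism to k, defined on the subalgebra of D
   formed by the first projections of Gr. *)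
Definition hom_graph (Gr : set (D * k)) : Prop := subalg diag Gr /\ ~ Gr (0, 1).

Section Theory.
Variables (Gr : set (D * k)) (hGr : hom_graph Gr).

Let sGr : subalg diag Gr := proj1 hGr.

(** Excluding the single pair [(0, 1)] is enough for single-valuedness: scaling by [k] turns any
    [(0, t)] with [t] nonzero into it. *)
Lemma hom_graph0 t : Gr (0, t) -> t = 0.
Proof.
move=> Gt; apply/eqP/negPn/negP => t0; case: hGr => _; apply.
have := subalgM sGr Gt (subalgC sGr t^-1).
by rewrite /diag pairM mul0r divff.
Qed.

Lemma hom_graph_inj x s t : Gr (x, s) -> Gr (x, t) -> s = t.
Proof.
move=> Gs Gt; apply/subr0_eq/hom_graph0.
by have := subalgB sGr Gs Gt; rewrite pairB subrr.
Qed.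

Lemma hom_graph_sum (I : Type) (r : seq I) (a : I -> D) (t : I -> k) :
  (forall i, Gr (a i, t i)) -> Gr (\sum_(i <- r) a i, \sum_(i <- r) t i).
Proof.
move=> Ga; apply: (big_rec2 (fun x s => Gr (x, s))); first exact: (subalg0 sGr).
by move=> i x s _ Gx; apply: (subalgD sGr (Ga i) Gx).
Qed.

Lemma hom_graph_adjoin e : ~ adjoin Gr e (0, 1) -> hom_graph (adjoin Gr e).
Proof. by move=> n01; split=> //; apply: adjoin_subalg. Qed.

End Theory.

Lemma horner_fst (p : {poly D * k}) x t : p.[(x, t)].1 = (map_poly fst p).[x].
Proof. by rewrite -(horner_map fst p (x, t)). Qed.

Lemma horner_snd (p : {poly D * k}) x t : p.[(x, t)].2 = (map_poly snd p).[t].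
Proof. by rewrite -(horner_map snd p (x, t)). Qed.

End HomGraphs.

(** * Extension of places *)

Section Places.
Variables (k : closedFieldType) (K : fieldType) (c : {rmorphism k -> K}).
Implicit Types (Gr : set (K * k)).

Section Maximal.
Variable Gr : set (K * k).
Hypothesis hGr : hom_graph c Gr.
Hypothesis maxGr : forall Gr', hom_graph c Gr' -> Gr `<=` Gr' -> Gr' `<=` Gr.

Let sGr : subalg (diag c) Gr := proj1 hGr.

Let adjoin_max e : ~ adjoin Gr e (0, 1) -> Gr e.
Proof.
move=> n01; apply: (maxGr (hom_graph_adjoin hGr n01));
  last exact: (adjoin_gen sGr).
exact: (adjoin_subset sGr).
Qed.

(** If the inverse pair could not be adjoined, [(0, 1)] would be a polynomial [Q] in it; multiplying
    by [(u, t) ^+ size Q] clears the inverses and puts [(0, t ^+ size Q)] in the graph. *)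
Lemma hom_graph_inv u t : Gr (u, t) -> t != 0 -> Gr (u^-1, t^-1).
Proof.
move=> Gu t0; apply: adjoin_max => -[Q GQ E01].
have u0 : u != 0.
  by apply: contra_neq t0 => u0; apply: (hom_graph0 hGr); move: Gu; rewrite u0.
have ee : (u, t) * (u^-1, t^-1) = 1 :> K * k by rewrite pairM !divff.
have : Gr ((u, t) ^+ size Q * Q.[(u^-1, t^-1)]).
  rewrite horner_coef mulr_sumr; apply: (subalg_sum sGr) => i _.
  have -> : (u, t) ^+ size Q = (u, t) ^+ (size Q - i) * (u, t) ^+ i.
    by rewrite -exprD subnK // ltnW.
  rewrite mulrCA -mulrA -exprMn ee expr1n mulr1.
  by apply: (subalgM sGr) => //; apply: (subalgX sGr).
have -> : (u, t) ^+ size Q * Q.[(u^-1, t^-1)] = (0, t ^+ size Q).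
  rewrite -E01; elim: (size Q) => [|n IHn]; first by rewrite !expr0 mul1r.
  by rewrite !exprS -mulrA IHn pairM mulr0.
by move/(hom_graph0 hGr)/eqP; rewrite expf_eq0 (negPf t0) andbF.
Qed.

(* If x has no residue then 1 is a polynomial in x, without constant term, with
   coefficients of residue 0: the residues of the relations satisfied by x form
   an ideal of k[T] without common roots. *)
Lemma no_residue_relation x : (forall xi, ~ Gr (x, xi)) ->
  exists Q, [/\ polyIn Gr Q, (map_poly fst Q).[x] = 0 & map_poly snd Q = 1].
Proof.
move=> nx.
pose I (g : {poly k}) := exists Q,
  [/\ polyIn Gr Q, (map_poly fst Q).[x] = 0 & map_poly snd Q = g].
have I1 xi : exists2 g, I g & g.[xi] = 1.
  have /contrapT[Q GQ E01] : ~ ~ adjoin Gr (x, xi) (0, 1).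
    by move/adjoin_max; apply: nx.
  exists (map_poly snd Q); last by rewrite -(horner_snd _ x) -E01.
  by exists Q; split=> //; rewrite -(horner_fst _ _ xi) -E01.
have exI : exists n, `[< exists g, [/\ I g, g != 0 & size g = n] >].
  have [g Ig g1] := I1 0; exists (size g); apply/asboolP; exists g; split=> //.
  by apply: contra_eq_neq g1 => ->; rewrite horner0 eq_sym oner_neq0.
case: (ex_minnP exI) => n /asboolP[g [Ig g0 sg]] ming.
have IM h f : I f -> I (h * f).
  case=> Q [GQ Q1 Q2]; exists (map_poly (diag c) h * Q); split.
  - apply: (overM sGr) => // i; rewrite coef_map; exact: (subalgC sGr).
  - by rewrite rmorphM hornerM Q1 mulr0.
  - rewrite rmorphM /= Q2 -map_poly_comp_id0 //; congr (_ * _).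
    by rewrite map_poly_id.
have IB f h : I f -> I h -> I (f - h).
  move=> [Q [GQ Q1 Q2]] [R [GR R1 R2]]; exists (Q - R); split.
  - exact: (overB sGr).
  - by rewrite rmorphB hornerD hornerN Q1 R1 subrr.
  - by rewrite rmorphB /= Q2 R2.
suff g1 : size g == 1%N.
  have [a a0 Ea] := size_poly1P _ g1.
  by have := IM a^-1%:P g Ig; rewrite Ea -polyCM mulVf.
apply/negPn/negP => /closed_rootP[xi /eqP gxi].
have [f If fxi] := I1 xi.
have r0 : f %% g = 0.
  apply/eqP/negPn/negP => r0.
  have Ir : I (f %% g).
    have -> : f %% g = f - f %/ g * g by rewrite {2}(divp_eq f g) addrC addKr.
    by apply: IB => //; apply: IM.
  have := ming (size (f %% g)); rewrite leqNgt -sg ltn_modp g0 => ming'.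
  by have : ~ true by apply/negP/ming'/asboolP; exists (f %% g).
move: fxi; rewrite (divp_eq f g) r0 addr0 hornerM gxi mulr0 => /esym/eqP.
by rewrite oner_eq0.
Qed.

(** Chevalley's descent on the sizes of the two relations. The reversed polynomial [V] of [R] has
    root [x], and its leading coefficient, the constant term of [R], has residue 1, hence is
    invertible in the domain of [Gr]. A multiple of [V] thus removes the leading term of [Q]; as the
    leading coefficient of [Q] has residue 0, the new relation still reduces to 1. *)
Lemma no_residue_absurd x (Q R : {poly K * k}) : x != 0 ->
  polyIn Gr Q -> (map_poly fst Q).[x] = 0 -> map_poly snd Q = 1 ->
  polyIn Gr R -> (map_poly fst R).[x^-1] = 0 -> map_poly snd R = 1 -> False.
Proof.
have [n] := ubnP (size Q + size R); elim: n => // n IHn in x Q R *.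
rewrite ltnS => leqn x0 GQ Q1 Q2 GR R1 R2.
(* Exchanging [x] and its inverse exchanges the two relations. *)
wlog leRQ : x x0 Q R leqn GQ Q1 Q2 GR R1 R2 / (size R <= size Q)%N.
  have [leRQ|ltQR] := leqP (size R) (size Q); first by move/(_ x x0 Q R); apply.
  by move/(_ x^-1 _ R Q); rewrite invr_eq0 invrK addnC; apply=> //; apply: ltnW.
have Rn0 : (0 < size R)%N.
  rewrite lt0n size_poly_eq0; apply: contra_eq_neq R2 => ->.
  by rewrite rmorph0 eq_sym oner_neq0.
have snd_coef (P : {poly K * k}) : map_poly snd P = 1 -> forall i,
    P`_i = ((P`_i).1, (i == 0)%:R).
  by move=> P2 i; rewrite [LHS]surjective_pairing -(coef_map snd) P2 coef1.
pose r0 := (R`_0).1.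
have r00 : r0 != 0.
  apply/eqP => r00; case: hGr => _; apply.
  by have := GR 0%N; rewrite (snd_coef _ R2) -/r0 r00.
pose u : K * k := (r0^-1, 1).
have Gu : Gr u.
  rewrite /u -[X in (_, X)]invr1; apply: hom_graph_inv (oner_neq0 _).
  by have := GR 0%N; rewrite (snd_coef _ R2).
have Q1n : (1 < size Q)%N.
  rewrite ltnNge; apply/negP => /size1_polyC EQ.
  case: hGr => _; apply; have := GQ 0%N; rewrite (snd_coef _ Q2) eqxx.
  by move: Q1; rewrite EQ map_polyC hornerC coefC /= => ->.
pose m := (size R).-1; pose n' := (size Q).-1.
pose V : {poly K * k} := \poly_(i < m.+1) R`_(m - i).
pose P := Q - (Q`_n' * u) *: ('X^(n' - m) * V).
have V0 : (map_poly fst V).[x] = 0.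
  have -> : map_poly fst V = \poly_(i < m.+1) (R`_(m - i)).1.
    by apply/polyP => i; rewrite coef_map !coef_poly; case: ifP.
  rewrite horner_poly (reindex_inj rev_ord_inj) /=.
  transitivity (x ^+ m * (map_poly fst R).[x^-1]); last by rewrite R1 mulr0.
  rewrite (@horner_coef_wide _ m.+1); last first.
    by rewrite prednK //; apply: size_poly.
  rewrite mulr_sumr; apply: eq_bigr => i _.
  have lei : (i <= m)%N by rewrite -ltnS.
  rewrite coef_map subSS subKn // mulrCA; congr (_ * _).
  have -> : x ^+ m = x ^+ (m - i) * x ^+ i by rewrite -exprD subnK.
  by rewrite -mulrA -exprMn divff // expr1n mulr1.
have VG : polyIn Gr V.
  by move=> i; rewrite coef_poly; case: ifP => // _; apply: (subalg0 sGr).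
apply: (IHn x P R) => //.
- apply: leq_trans leqn; rewrite ltn_add2r.
  suff : (size P <= n')%N by rewrite /n'; lia.
  apply/leq_sizeP => i lei; rewrite coefB coefZ coefXnM coef_poly.
  have mn : (m <= n')%N by rewrite /m /n'; lia.
  case: ltnP => [|leni]; first by lia.
  have [->|nein] := eqVneq i n'.
    rewrite subKn // ltnSn subnn -mulrA.
    have -> : u * R`_0 = 1 by rewrite (snd_coef _ R2) /u pairM mulVf // mulr1.
    by rewrite mulr1 subrr.
  have lti : (n' < i)%N by rewrite ltn_neqAle eq_sym nein.
  have -> : (i - (n' - m) < m.+1)%N = false.
    by apply/negbTE; rewrite -leqNgt; move: lti mn; clear; lia.
  by rewrite mulr0 subr0 nth_default // -(prednK (ltnW Q1n)).
- apply: (overB sGr) => //; apply: (overZ sGr).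
    by apply: (subalgM sGr).
  by apply: (overM sGr) => //; apply: (overXn sGr).
- rewrite rmorphB hornerD hornerN Q1 /= map_polyZ hornerZ [map_poly _ (_ *
    V)]rmorphM.
  rewrite /= hornerM V0.
  by rewrite !mulr0 subr0.
- rewrite rmorphB /= Q2 map_polyZ /= (snd_coef _ Q2).
  have -> : (n' == 0)%N = false by apply/gtn_eqF; rewrite /n' -subn1 subn_gt0.
  by rewrite /= mul0r scale0r subr0.
Qed.

(** The domain of a maximal graph is a valuation ring: it contains [x] or its inverse, and a nonzero
    residue of the inverse can be inverted. *)
Lemma maximal_residue x : (exists xi, Gr (x, xi)) \/ Gr (x^-1, 0).
Proof.
have [->|x0] := eqVneq x 0.
  by left; exists 0; apply: (subalg0 sGr).
case: (pselect (exists xi, Gr (x, xi))) => [|nx]; first by left.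
case: (pselect (exists xi, Gr (x^-1, xi))) => [[xi Gxi]|nxV]; last first.
  have [xi Gxi|Q [GQ Q1 Q2]] := @no_residue_relation x.
    by apply: nx; exists xi.
  have [xi Gxi|R [GR R1 R2]] := @no_residue_relation x^-1.
    by apply: nxV; exists xi.
  by case: (no_residue_absurd x0 GQ Q1 Q2 GR R1 R2).
have [E|xi0] := eqVneq xi 0; first by right; rewrite -E.
left; exists xi^-1; rewrite -[x]invrK; exact: hom_graph_inv.
Qed.

End Maximal.

Theorem place_extension Gr0 : hom_graph c Gr0 ->
  exists Gr, [/\ Gr0 `<=` Gr, hom_graph c Gr &
    forall x, (exists xi, Gr (x, xi)) \/ Gr (x^-1, 0)].
Proof.
move=> hGr0.
pose P (Gr : set (K * k)) := Gr = set0 \/ Gr0 `<=` Gr /\ hom_graph c Gr.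
have [F FP totF|Gr [PGr maxGr]] := @Zorn_bigcup _ P.
  case: (pselect (exists2 Gr, F Gr & Gr !=set0)) => [[Gr FGr [e0 Gre0]]|F0];
    last first.
    left; rewrite -subset0 => e [Gr FGr Gre]; apply: F0; exists Gr => //.
    by exists e.
  right.
  have FG H e : F H -> H e -> Gr0 `<=` H /\ hom_graph c H.
    by move=> /FP[->|].
  have [sub0 [sGr _]] := FG Gr e0 FGr Gre0.
  split; first by move=> e /sub0 ?; exists Gr.
  split; last by case=> H FH H01; have [_ [_]] := FG H _ FH H01; apply.
  have F2 e f : (\bigcup_(H in F) H) e -> (\bigcup_(H in F) H) f ->
      exists H, [/\ F H, H e & H f].
    move=> [H1 FH1 H1e] [H2 FH2 H2f].
    by have [le|le] := totF _ _ FH1 FH2; [exists H2|exists H1]; split=> //;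
      apply: le.
  split=> [a|e f /F2/[apply][[H [FH He Hf]]]|e f /F2/[apply][[H [FH He Hf]]]].
  - by exists Gr => //; apply: (subalgC sGr).
  - by have [_ [sH _]] := FG _ _ FH He; exists H => //; apply: (subalgD sH).
  - by have [_ [sH _]] := FG _ _ FH He; exists H => //; apply: (subalgM sH).
have G01 : Gr0 (diag c 1) by case: hGr0 => s _; apply: (subalgC s).
case: PGr => [E|[sub hGr]].
  case: (maxGr Gr0); last by right; split=> //; apply: subset_refl.
  by rewrite E; split; [apply: sub0set|move=> /(_ _ G01)].
exists Gr; split=> // x; apply: maximal_residue => // H hH le.
apply: contrapT => nle; apply: (maxGr H); last by right; split=> //;
  apply: subset_trans le.
by split.
Qed.

End Places.

(** * Extension of morphisms of algebras *)

Section Extension.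
Variables (k : closedFieldType) (D : idomainType) (c : {rmorphism k -> D}).
Implicit Types (A : set D) (Gr : set (D * k)).

Definition hom_on A Gr : Prop :=
  [/\ hom_graph c Gr, forall a t, Gr (a, t) -> A a & forall a,
    A a -> exists t, Gr (a, t)].

Lemma hom_on_lift A Gr p : hom_on A Gr -> polyIn A p ->
  exists Q, [/\ polyIn Gr Q, map_poly fst Q = p & (size Q <= size p)%N].
Proof.
move=> [[sGr _] _ tot] Ap.
have [F GF] := @choice _ _ (fun i t => Gr (p`_i, t)) (fun i => tot _ (Ap i)).
exists (\poly_(i < size p) (p`_i, F i)); split; last exact: size_poly.
  by move=> i; rewrite coef_poly; case: ifP => // _; apply: (subalg0 sGr).
apply/polyP => i; rewrite coef_map coef_poly; case: ltnP => // le.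
by rewrite nth_default.
Qed.

Section Simple.
Variables (A : set D) (x : D).
Hypothesis sA : subalg c A.

(** Euclid's algorithm on [p] and [r], the minimality of [p] doing duty for irreducibility. When [r]
    is shorter than [p] and the remainder of [p] by [r] vanishes at [x], this remainder is 0; the
    quotient would then be a relation shorter than [p], unless [r] is constant. *)
Lemma minimal_relation_inv p : polyIn A p -> p != 0 -> p.[x] = 0 ->
    (forall q, polyIn A q -> q.[x] = 0 -> (size q < size p)%N -> q = 0) ->
  forall r, polyIn A r -> r.[x] != 0 ->
    exists u a, [/\ polyIn A u, A a, a != 0 & u.[x] * r.[x] = a].
Proof.
move=> Ap p0 px minp r.
have la0 (q : {poly D}) s : q != 0 -> lead_coef q ^+ s != 0.
  by move=> q0; rewrite expf_neq0 ?lead_coef_eq0.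
have [n] := ubnP (size r); elim: n r => // n IHn r; rewrite ltnS => lern Ar rx.
have r0 : r != 0 by apply: contra_neq rx => ->; rewrite horner0.
have [ltrp|lepr] := ltnP (size r) (size p); last first.
  have [s [h [r' [Ah Ar' ltr' E]]]] := pseudo_division sA Ap Ar p0.
  have Ex : lead_coef p ^+ s * r.[x] = r'.[x].
    by rewrite -hornerZ E hornerD hornerM px mulr0 add0r.
  have r'x : r'.[x] != 0 by rewrite -Ex mulf_neq0 // la0.
  have [|u [a [Au Aa a0 Ea]]] := IHn r' _ Ar' r'x.
    by apply: leq_trans lern; apply: leq_trans lepr.
  exists (lead_coef p ^+ s *: u), a; split=> //.
    by apply: (overZ sA) => //; apply: (subalgX sA); apply: Ap.
  by rewrite hornerZ -Ea -Ex -mulrA mulrCA.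
have [s [h [r' [Ah Ar' ltr' E]]]] := pseudo_division sA Ar Ap r0.
have Ex : h.[x] * r.[x] = - r'.[x].
  have := congr1 (horner^~ x) E; rewrite hornerZ px mulr0 hornerD hornerM.
  by move/esym/eqP; rewrite addr_eq0 => /eqP.
have [r'x|r'x] := eqVneq r'.[x] 0; last first.
  have [|u [a [Au Aa a0 Ea]]] := IHn r' _ Ar' r'x.
    by apply: leq_trans lern.
  exists (- (u * h)), a; split=> //; first by apply/(overN sA)/(overM sA).
  by rewrite hornerN hornerM -mulNr -mulrA mulNr Ex mulrN opprK.
have r'0 : r' = 0 by apply: minp => //; apply: ltn_trans ltrp.
have [srE|sr1] := eqVneq (size r) 1%N.
  exists 1, r.[x]; rewrite hornerC mul1r; split=> //.
    by rewrite -[1]/(1%:P); apply: (overC sA); apply: (subalg1 sA).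
  have /eqP/size_poly1P[a _ Er] := srE.
  by have := Ar 0%N; rewrite Er coefC hornerC.
have hx : h.[x] = 0.
  move: Ex; rewrite r'x oppr0 => /eqP; rewrite mulf_eq0 (negPf rx) orbF.
  by move/eqP.
move: E; rewrite r'0 addr0 => E.
have h0 : h != 0.
  by apply: contra_eq_neq E => ->; rewrite mul0r scale_poly_eq0 negb_or la0.
case/eqP: (h0); apply: minp => //.
have := congr1 (size \o @polyseq _) E; rewrite /= size_scale ?la0 // => ->.
have : (1 < size r)%N by rewrite ltn_neqAle eq_sym sr1 size_poly_gt0.
rewrite size_mul //; case: (size r) => [|[|m]] // _.
by rewrite !addnS /= ltnS leq_addr.
Qed.

Lemma hom_on_adjoin Gr xi : hom_on A Gr -> ~ adjoin Gr (x, xi) (0, 1) ->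
  hom_on (adjoin A x) (adjoin Gr (x, xi)).
Proof.
move=> hA n01; have [hGr GA _] := hA; split.
- exact: hom_graph_adjoin.
- move=> a t [Q GQ E]; exists (map_poly fst Q).
    2: by rewrite -(horner_fst _ _ xi) -E.
  by move=> i; rewrite coef_map; apply: (GA _ (Q`_i).2);
    rewrite -surjective_pairing.
- move=> _ [p Ap ->]; have [Q [GQ <- _]] := hom_on_lift hA Ap.
  exists (map_poly snd Q).[xi]; exists Q => //.
  by rewrite -(horner_snd _ x) -(horner_fst _ _ xi) -surjective_pairing.
Qed.

Lemma hom_on_polyIn0 Gr Q : hom_on A Gr -> polyIn Gr Q -> map_poly fst Q = 0 ->
  Q = 0.
Proof.
move=> [hGr _ _] GQ Q1; apply/polyP => i; have := GQ i.
rewrite [Q`_i]surjective_pairing -(coef_map fst) Q1 !coef0.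
by move=> /(hom_graph0 hGr) ->.
Qed.

(** If [x] satisfies no relation over [A], then [a] is the leading coefficient of [r], and [xi] is
    any non-root of the residue of [r]. Otherwise [a] is a product of two factors: the leading
    coefficient of a minimal relation [p], whose nonvanishing preserves the degree of [p] and so
    provides a root [xi], and a nonzero multiple of [b] lying in [A], which forces the image of [b]
    to be nonzero. *)
Lemma simple_extension b : adjoin A x b -> b != 0 -> exists a, [/\ A a, a != 0 &
  forall Gr t, hom_on A Gr -> Gr (a, t) -> t != 0 -> exists Gr' t',
    [/\ hom_on (adjoin A x) Gr', Gr `<=` Gr', Gr' (b, t') & t' != 0]].
Proof.
move=> [r Ar ->] rx.
pose P n := `[< exists p, [/\ polyIn A p, p != 0, p.[x] = 0 & size p = n] >].
case: (pselect (exists n, P n)) => [exP|nP]; last first.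
  have inj q : polyIn A q -> q.[x] = 0 -> q = 0.
    move=> Aq qx; apply/eqP/negPn/negP => q0; apply: nP.
    by exists (size q); apply/asboolP; exists q.
  have r0 : r != 0 by apply: contra_neq rx => ->; rewrite horner0.
  exists (lead_coef r); split; [exact: Ar|by rewrite lead_coef_eq0|].
  move=> Gr t hA Gt t0; have [hGr GA _] := hA; have [sGr _] := hGr.
  have [R [GR ER _]] := hom_on_lift hA Ar.
  have R20 : map_poly snd R != 0.
    apply: contra_neq t0 => R2; apply: (hom_graph_inj hGr Gt).
    have := GR (size r).-1; rewrite [R`_ _]surjective_pairing.
    by rewrite -(coef_map fst) -(coef_map snd) ER R2 coef0.
  have /closed_nonrootP[xi Rxi] := R20.
  exists (adjoin Gr (x, xi)), (map_poly snd R).[xi]; split=> //.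
  - apply: hom_on_adjoin => // -[Q GQ E].
    have Q0 : Q = 0.
      apply: (hom_on_polyIn0 hA GQ); apply: inj.
        move=> i; rewrite coef_map; apply: (GA _ (Q`_i).2).
        by rewrite -surjective_pairing.
      by rewrite -(horner_fst _ _ xi) -E.
    by move: E => /(congr1 snd)/eqP; rewrite Q0 horner0 /= oner_eq0.
  - exact: (adjoin_subset sGr).
  - exists R => //; rewrite -ER.
    by rewrite -(horner_snd _ x) -(horner_fst _ _ xi) -surjective_pairing.
case: (ex_minnP exP) => n /asboolP[p [Ap p0 px sp]] minn.
have minp q : polyIn A q -> q.[x] = 0 -> (size q < size p)%N -> q = 0.
  move=> Aq qx ltq; apply/eqP/negPn/negP => q0.
  have : (n <= size q)%N by apply: minn; apply/asboolP; exists q.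
  by rewrite -sp leqNgt ltq.
have [u [a [Au Aa a0 Eua]]] := minimal_relation_inv Ap p0 px minp Ar rx.
exists (lead_coef p * a); split.
- by apply: (subalgM sA) => //; apply: Ap.
- by rewrite mulf_neq0 // lead_coef_eq0.
move=> Gr t hA Gt t0; have [hGr GA tot] := hA; have [sGr _] := hGr.
have [al Gal] := tot _ Aa.
have [P' [GP EP sP]] := hom_on_lift hA Ap.
pose l := (P'`_(size p).-1).2.
have Gl : Gr (lead_coef p, l).
  have := GP (size p).-1; rewrite [P'`_ _]surjective_pairing.
  by rewrite -(coef_map fst) EP.
have Et : t = l * al.
  by apply: (hom_graph_inj hGr Gt); have := subalgM sGr Gl Gal; rewrite pairM.
have /andP[l0 al0] : (l != 0) && (al != 0) by rewrite -negb_or -mulf_eq0 -Et.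
have sp1 : (1 < size p)%N.
  rewrite ltnNge; apply/negP => /size1_polyC Ep; move: p0 px.
  by rewrite Ep hornerC => /eqP p0 px; apply: p0; rewrite px.
have sP' : size P' = size p.
  apply/eqP; rewrite eqn_leq sP /= -(prednK (ltnW sp1)) ltnNge.
  by apply/negP => /(nth_default 0); move: l0; rewrite /l => /eqP l0 E;
    apply: l0; rewrite E.
have lP' : lead_coef P' = (lead_coef p, l).
  by rewrite lead_coefE sP' [LHS]surjective_pairing -(coef_map fst) EP.
have P'0 : P' != 0 by rewrite -size_poly_gt0 sP' ltnW.
have : size (map_poly snd P') != 1%N.
  have : (size p).-1 \in [pred i | (i < size (map_poly snd P'))%N].
    rewrite inE ltnNge; apply/negP => /(nth_default 0).
    by rewrite coef_map; apply/eqP.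
  by rewrite inE; apply: contraL => /eqP ->;
    rewrite -leqNgt -ltnS prednK // ltnW.
case/closed_rootP => xi /eqP P'xi.
have E0 : P'.[(x, xi)] = 0.
  by rewrite [LHS]surjective_pairing horner_fst horner_snd EP px P'xi.
(* Pseudo-division by [P'] replaces a polynomial [Q] of value [(0, 1)] by its remainder, which is 0
   by minimality of [p]; comparing second components gives [l ^+ s = 0]. *)
have hA' : hom_on (adjoin A x) (adjoin Gr (x, xi)).
  apply: hom_on_adjoin => // -[Q GQ E].
  have [s [h [R [Gh GR ltR EQ]]]] := pseudo_division sGr GP GQ P'0.
  have Rx : (lead_coef P' ^+ s) * (0, 1) = R.[(x, xi)].
    by rewrite E -hornerZ EQ hornerD hornerM E0 mulr0 add0r.
  have R0 : R = 0.
    apply: (hom_on_polyIn0 hA GR); apply: minp.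
    - move=> i; rewrite coef_map; apply: (GA _ (R`_i).2).
      by rewrite -surjective_pairing.
    - by rewrite -(horner_fst _ _ xi) -Rx; exact: (mulr0 (lead_coef P' ^+ s).1).
    - by apply: leq_ltn_trans (size_poly _ _) _; rewrite -sP'.
  have : (lead_coef P' ^+ s * (0, 1)).2 = l ^+ s.
    rewrite lP'; elim: s {EQ Rx} => [|s IHs]; first by rewrite !expr0 mul1r.
    by rewrite !exprS -mulrA -IHs.
  rewrite Rx R0 horner0 => /esym/eqP; rewrite expf_eq0 (negPf l0) andbF.
  by [].
have [R [GR ER _]] := hom_on_lift hA Ar.
have [U [GU EU _]] := hom_on_lift hA Au.
exists (adjoin Gr (x, xi)), (map_poly snd R).[xi]; split=> //.
- exact: (adjoin_subset sGr).
- exists R => //; rewrite -ER.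
  by rewrite -(horner_snd _ x) -(horner_fst _ _ xi) -surjective_pairing.
have [hG' _ _] := hA'.
have : adjoin Gr (x, xi) (a, (map_poly snd U).[xi] * (map_poly snd R).[xi]).
  exists (U * R); first exact: (overM sGr).
  rewrite hornerM [U.[_]]surjective_pairing [R.[_]]surjective_pairing pairM.
  by rewrite !horner_fst !horner_snd EU ER Eua.
have /(adjoin_subset sGr (x, xi)) Gal' := Gal.
move/(hom_graph_inj hG' Gal') => E.
by apply: contra_neq al0; rewrite E => ->; rewrite mulr0.
Qed.

End Simple.

(** This is the algebraic form of the fact that the image of a dominant morphism contains a nonempty
    open set, here the locus where [a] does not vanish. *)
Theorem finite_extension (xs : seq D) A b :
  subalg c A -> adjoins A xs b -> b != 0 -> exists a, [/\ A a, a != 0 &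
  forall Gr t, hom_on A Gr -> Gr (a, t) -> t != 0 -> exists Gr',
    hom_on (adjoins A xs) Gr' /\ Gr `<=` Gr' /\ exists2 t', Gr' (b,
      t') & t' != 0].
Proof.
elim: xs A b => [|x xs IHxs] A b sA Ab b0.
  by exists b; split=> // Gr t hA Gt t0; exists Gr; do 2?split=> //; exists t.
have [a' [Aa' a'0 ext']] := IHxs _ b (adjoin_subalg sA x) Ab b0.
have [a [Aa a0 ext]] := simple_extension sA Aa' a'0.
exists a; split=> // Gr t hA Gt t0.
have [Gr1 [t1 [hA1 sub1 G1 t10]]] := ext Gr t hA Gt t0.
have [Gr2 [hA2 [sub2 ex2]]] := ext' Gr1 t1 hA1 G1 t10.
by exists Gr2; do 2?split=> //; apply: subset_trans sub2.
Qed.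

End Extension.

(** * Noetherian algebras *)

Section Noetherian.
Variables (k : fieldType) (E : comNzRingType) (c : {rmorphism k -> E}).
Implicit Types (A : set E).

Definition lincomb A (f : nat -> E) n y : Prop :=
  exists2 d : nat -> E, forall i, A (d i) & y = \sum_(i < n) d i * f i.

(** Equivalent, for a subalgebra, to the ascending chain condition on ideals, and directly
    applicable to a sequence of functions read off a descending chain of closed sets. *)
Definition noetherian A : Prop :=
  forall f : nat -> E, (forall n, A (f n)) -> exists n, lincomb A f n (f n).

Section Lincomb.
Variables (A : set E) (sA : subalg c A) (f : nat -> E).

Lemma lincomb_wide m n y : (m <= n)%N -> lincomb A f m y -> lincomb A f n y.
Proof.
move=> lemn [d Ad ->]; exists (fun i => if (i < m)%N then d i else 0).
  by move=> i; case: ifP => // _; apply: (subalg0 sA).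
rewrite (big_ord_widen _ (fun i => d i * f i) lemn) big_mkcond.
by apply: eq_bigr => i _; case: ifP; rewrite ?mul0r.
Qed.

Lemma lincombD n y z : lincomb A f n y -> lincomb A f n z -> lincomb A f n (y +
  z).
Proof.
move=> [d Ad ->] [e Ae ->]; exists (fun i => d i + e i).
  by move=> i; apply: (subalgD sA).
by rewrite -big_split; apply: eq_bigr => i _; rewrite mulrDl.
Qed.

Lemma lincombM n a y : A a -> lincomb A f n y -> lincomb A f n (a * y).
Proof.
move=> Aa [d Ad ->]; exists (fun i => a * d i).
  by move=> i; apply: (subalgM sA).
by rewrite mulr_sumr; apply: eq_bigr => i _; rewrite mulrA.
Qed.

Lemma lincomb_sum n m (F : 'I_m -> E) :
  (forall i, lincomb A f n (F i)) -> lincomb A f n (\sum_(i < m) F i).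
Proof.
move=> lF; elim/big_ind: _ => //; last exact: lincombD.
exists (fun=> 0) => [i|]; first exact: (subalg0 sA).
by rewrite big1 // => i _; rewrite mul0r.
Qed.

Lemma lincomb_gen i n : (i < n)%N -> lincomb A f n (f i).
Proof.
move=> ltin; exists (fun j => if j == i then 1 else 0).
  by move=> j; case: ifP => // _; [apply: (subalg1 sA)|apply: (subalg0 sA)].
rewrite (bigD1 (Ordinal ltin)) //= eqxx mul1r big1 ?addr0 // => j.
by rewrite -val_eqE /= => /negPf->; rewrite mul0r.
Qed.

End Lincomb.

Lemma noetherian_field : noetherian (range c).
Proof.
move=> f cf; have [t0 _ E0] := cf 0%N; have [t1 _ E1] := cf 1%N.
have [z|nz] := eqVneq t0 0.
  exists 0%N, (fun=> 0); first by move=> _; exists 0 => //; rewrite rmorph0.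
  by rewrite big_ord0 -E0 z rmorph0.
exists 1%N, (fun=> c (t1 / t0)); first by move=> _; exists (t1 / t0).
by rewrite big_ord_recl big_ord0 addr0 -E0 -E1 -rmorphM divfK.
Qed.

(* Hilbert's basis theorem: among the polynomials whose value is in the ideal
   but not in the ideal of the previous ones, take one of minimal size. *)
Theorem noetherian_adjoin A x :
  subalg c A -> noetherian A -> noetherian (adjoin A x).
Proof.
move=> sA nA f Bf; apply: contrapT => /forallNP nf.
set B := adjoin A x in Bf nf; have sB : subalg c B := adjoin_subalg sA x.
pose ev (s : seq {poly E}) i := (s`_i).[x].
pose good q := polyIn A q /\ exists n, lincomb B f n q.[x].
pose bad s q := lincomb B (ev s) (size s) q.[x].
pose next s q := [/\ good q, ~ bad s q &
  forall q', good q' -> ~ bad s q' -> (size q <= size q')%N].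
have ex_next s : (forall i, (i < size s)%N -> good s`_i) -> exists q, next s q.
  move=> gs.
  have [M IM] : exists M, forall i, (i < size s)%N -> lincomb B f M (ev s i).
    elim: s gs => [|q s IHs] gs; first by exists 0%N.
    have [i lti|M IM] := IHs; first exact: (gs i.+1).
    have [_ [n In]] := gs 0%N isT; exists (maxn n M) => -[|i] lti.
      by apply: (lincomb_wide sB) In; apply: leq_maxl.
    by apply: (lincomb_wide sB) (IM i lti); apply: leq_maxr.
  pose P n := `[< exists q, [/\ good q, ~ bad s q & size q = n] >].
  have exP : exists n, P n.
    have [p Ap Ep] := Bf M; exists (size p); apply/asboolP; exists p;
      split=> //.
      by split=> //; exists M.+1; rewrite -Ep; apply: (lincomb_gen sB).
    rewrite /bad -Ep => -[d Bd Ed]; apply: (nf M); rewrite Ed.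
    apply: (lincomb_sum sB) => i; apply: (lincombM sB) => //.
    exact: IM.
  case: (ex_minnP exP) => n /asboolP[q [gq bq <-]] minn.
  exists q; split=> // q' gq' bq'; apply: minn; apply/asboolP; by exists q'.
have [F FP] : exists F, forall s, (forall i,
  (i < size s)%N -> good s`_i) -> next s (F s).
  have [s|F FP] := @choice _ _ (fun s q =>
      (forall i, (i < size s)%N -> good s`_i) -> next s q); last by exists F.
  by have [/ex_next[q]|] := pselect (forall i, (i < size s)%N -> good s`_i);
    [exists q|exists 0].
pose L n := iter n (fun s => rcons s (F s)) [::].
pose q n := F (L n).
have sL n : size (L n) = n by elim: n => //= n IHn; rewrite size_rcons IHn.
have nL n i : (i < n)%N -> (L n)`_i = q i.
  elim: n => // n IHn;
    rewrite ltnS leq_eqVlt /= nth_rcons sL => /orP[/eqP->|lt].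
    by rewrite ltnn eqxx.
  by rewrite lt IHn.
have qP n : next (L n) (q n).
  have [m] := ubnP n; elim: m n => // m IHm n; rewrite ltnS => lenm.
  apply: FP => i; rewrite sL => lti; rewrite nL //.
  by have [] := IHm i (leq_trans lti lenm).
have badE n y : bad (L n) y <-> lincomb B (fun i => (q i).[x]) n y.[x].
  rewrite /bad sL; split=> -[d Bd Ed]; exists d => //; rewrite Ed;
  by apply: eq_bigr => i _; rewrite /ev nL.
have smono i n : (i <= n)%N -> (size (q i) <= size (q n))%N.
  move=> lein; have [_ _ mini] := qP i; have [gn bn _] := qP n.
  apply: mini => // /badE li; apply: bn; apply/badE.
  exact: (lincomb_wide sB) li.
(* Some leading coefficient depends on the previous ones. As the sizes increase, the same
   combination, shifted by powers of ['X], cancels the leading term of [q n]; the shorter [q'] is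
   then in the ideal of the previous values by minimality, and so is [q n]. *)
have [n [d Ad Ed]] : exists n,
  lincomb A (fun i => lead_coef (q i)) n (lead_coef (q n)).
  by apply: nA => n; have [[Aq _] _ _] := qP n; apply: Aq.
have [[Aq [N Iq]] bq minq] := qP n.
pose t i := d i *: 'X^(size (q n) - size (q i)) * q i.
pose q' := q n - \sum_(i < n) t i.
have sq0 m : (0 < size (q m))%N.
  rewrite size_poly_gt0; have [_ bm _] := qP m.
  apply/eqP => q0; apply: bm; apply/badE; exists (fun=> 0).
    by move=> _; apply: (subalg0 sB).
  by rewrite q0 horner0 big1 // => i _; rewrite mul0r.
have lt_size : (size q' < size (q n))%N.
  rewrite -(prednK (sq0 n)) ltnS; apply/leq_sizeP => j lej.
  rewrite coefB coef_sum.
  have Et i : (i < n)%N -> (t i)`_j = if j == (size (q n)).-1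
      then d i * lead_coef (q i) else 0.
    move=> lti; have := smono _ _ (ltnW lti) => les.
    have lesj : (size (q n) - size (q i) <= j)%N.
      by apply: leq_trans lej; rewrite -subn1 leq_sub2l.
    rewrite /t -scalerAl coefZ coefXnM ltnNge lesj /=.
    case: eqP => [->|/eqP nj].
      rewrite lead_coefE; congr (_ * _`_ _).
      by rewrite -!subn1 -subnDA addnC subnDA subKn.
    rewrite [X in _ * X]nth_default ?mulr0 //.
    have ltj : (size (q n) <= j)%N by rewrite -(prednK (sq0 n)) ltn_neqAle
      eq_sym nj.
    by move: les ltj; clear; move: (size _) (size _); lia.
  rewrite (eq_bigr (fun i : 'I_n => if j == (size (q n)).-1
      then d i * lead_coef (q i) else 0)); last by move=> i _; apply: Et.
  case: eqP => [->|nj]; first by rewrite -lead_coefE Ed subrr.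
  by rewrite big1 // subr0 nth_default // -(prednK (sq0 n)) ltn_neqAle lej
    eq_sym; move/eqP: nj => ->.
have Bt i : B (d i * x ^+ (size (q n) - size (q i))).
  apply: (subalgM sB); first exact: (adjoin_subset sA).
  by apply: (subalgX sB); apply: (adjoin_gen sA).
have tx i : (t i).[x] = d i * x ^+ (size (q n) - size (q i)) * (q i).[x].
  by rewrite hornerM hornerZ hornerXn.
suff : (size (q n) <= size q')%N by rewrite leqNgt lt_size.
apply: minq.
  split.
    apply: (overB sA) => //; rewrite /polyIn => j; rewrite coef_sum.
    apply: (subalg_sum sA) => i _; have [[Aqi _] _ _] := qP i.
    by apply: (overM sA) => //; apply: (overZ sA) => //; apply: (overXn sA).
  have [M [NM IM]] : exists M, (N <= M)%N /\
      forall i, (i < n)%N -> lincomb B f M (q i).[x].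
    elim: (n) => [|m [M [NM IM]]]; first by exists N.
    have [[_ [M' IM']] _ _] := qP m; exists (maxn M M'); split.
      exact: leq_trans NM (leq_maxl _ _).
    move=> i; rewrite ltnS leq_eqVlt => /orP[/eqP->|lt].
      by apply: (lincomb_wide sB) IM'; apply: leq_maxr.
    by apply: (lincomb_wide sB) (IM i lt); apply: leq_maxl.
  exists M; rewrite /q' hornerD hornerN horner_sum -mulN1r.
  apply: (lincombD sB); first exact: (lincomb_wide sB) Iq.
  apply: (lincombM sB); first by apply/(subalgN sB)/(subalg1 sB).
  apply: (lincomb_sum sB) => i; rewrite tx; apply: (lincombM sB) => //.
  exact: IM.
move/badE => lq'; apply: bq; apply/badE.
have -> : (q n).[x] = q'.[x] + \sum_(i < n) (t i).[x].
  by rewrite /q' hornerD hornerN horner_sum subrK.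
apply: (lincombD sB) => //;
  exists (fun i => d i * x ^+ (size (q n) - size (q i))) => //.
by apply: eq_bigr => i _; rewrite tx.
Qed.

Lemma noetherian_adjoins A (xs : seq E) :
  subalg c A -> noetherian A -> noetherian (adjoins A xs).
Proof.
elim: xs A => [|x xs IHxs] A sA //= nA; apply: IHxs;
  first exact: (adjoin_subalg sA).
exact: noetherian_adjoin.
Qed.

End Noetherian.

(** * Closed and irreducible sets *)

Section ConstantFunctions.
Variables (k : comNzRingType) (X : pointedType).

(** The base point of [X] makes the ring of functions nonzero. *)
Definition const_fun (a : k) : X -> k := cst a.

Fact const_fun_zmod_morphism : zmod_morphism const_fun.
Proof. by []. Qed.

Fact const_fun_monoid_morphism : monoid_morphism const_fun.
Proof. by []. Qed.

HB.instance Definition _ :=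
  GRing.isZmodMorphism.Build k (X -> k) const_fun const_fun_zmod_morphism.
HB.instance Definition _ :=
  GRing.isMonoidMorphism.Build k (X -> k) const_fun const_fun_monoid_morphism.

End ConstantFunctions.

Section ZeroSets.
Variables (k : closedFieldType) (X : Type).
Implicit Types (A : set (X -> k)) (Z : set X).

Definition zclosed A Z : Prop :=
  forall x, (forall f, A f -> (forall z, Z z -> f z = 0) -> f x = 0) -> Z x.

(* The empty set is irreducible. *)
Definition irreducible A Z : Prop := forall f g, A f -> A g ->
  (forall z, Z z -> f z * g z = 0) ->
  (forall z, Z z -> f z = 0) \/ (forall z, Z z -> g z = 0).

Definition finitely_generated A : Prop := exists2 xs : seq (X -> k),
  forall f, f \in xs -> A f & forall B, subalgebra B -> (forall f,
    f \in xs -> B f) -> A `<=` B.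

Lemma zclosedI A Z W : zclosed A Z -> zclosed A W -> zclosed A (Z `&` W).
Proof.
move=> cZ cW x xP; split; [apply: cZ|apply: cW] => f Af Zf.
  by apply: xP => // z [/Zf].
by apply: xP => // z [_ /Zf].
Qed.

Lemma zclosed_zeros A (S : set (X -> k)) : S `<=` A ->
  zclosed A [set x | forall f, S f -> f x = 0].
Proof. by move=> SA x xP f Sf; apply: xP; [apply: SA|move=> z; apply]. Qed.

Lemma zclosed_zero A f : A f -> zclosed A [set x | f x = 0].
Proof. by move=> Af x xP; apply: xP. Qed.

Lemma not_zclosed A Z x : zclosed A Z -> ~ Z x ->
  exists f, [/\ A f, forall z, Z z -> f z = 0 & f x != 0].
Proof.
move=> cZ nZx; apply: contrapT => nf; apply: nZx; apply: cZ => f Af Zf.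
by apply: contrapT => fx; apply: nf; exists f; split=> //; apply/eqP.
Qed.

End ZeroSets.

(** A strictly decreasing sequence of closed sets gives functions [f n] vanishing on the next set
    but not on the current one. When [f n] is a combination of its predecessors, which all vanish on
    the current set, this is a contradiction. *)
Theorem zclosed_minimal (k : closedFieldType) (X : choiceType) (x0 : X)
    (A : set (X -> k)) (F : set (set X)) :
  finitely_generated A -> (forall Z, F Z -> zclosed A Z) -> F !=set0 ->
  exists2 Z, F Z & forall W, F W -> W `<=` Z -> Z `<=` W.
Proof.
move=> [xs _ fg] cF [Z0 FZ0].
pose pX : pointedType := HB.pack X (isPointed.Build X x0).
pose c : {rmorphism k -> (pX -> k)} := @const_fun k pX.
have nB := @noetherian_adjoins _ _ c _ xs (range_subalg c) (@noetherian_field _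
  _ c).
have sB := @adjoins_subalg _ _ c _ xs (range_subalg c).
set B := adjoins _ _ in nB sB.
have AB : A `<=` B.
  apply: fg; last by move=> f;
    apply: (@adjoins_gen _ _ c _ xs f (range_subalg c)).
  by case: sB.
apply: contrapT => nmin.
have smaller Z : exists W, F Z -> [/\ F W, W `<=` Z & ~ Z `<=` W].
  have [FZ|] := pselect (F Z); last by exists Z.
  apply: contrapT => nW; apply: nmin; exists Z => // W FW WZ.
  by apply: contrapT => nZW; apply: nW; exists W.
have [N NP] := choice smaller.
pose Zs n := iter n N Z0.
have FZ n : F (Zs n) by elim: n => // n /NP[].
have Zmono m n : (m <= n)%N -> Zs n `<=` Zs m.
  elim: n => [|n IHn]; first by rewrite leqn0 => /eqP->.
  rewrite leq_eqVlt => /orP[/eqP-> //|/IHn].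
  by apply: subset_trans; have [] := NP _ (FZ n).
have ex_f n : exists f, [/\ A f, forall z, Zs n.+1 z -> f z = 0 &
    exists2 z, Zs n z & f z != 0].
  have [_ _ /existsNP[z /not_implyP[Zz nZz]]] := NP _ (FZ n).
  have [f [Af Zf fz]] := not_zclosed (cF _ (FZ n.+1)) nZz.
  by exists f; split=> //; exists z.
have [f fP] := choice ex_f.
have [n [d _ /= Ed]] : exists n, lincomb B f n (f n).
  by apply: nB => n; have [Af _ _] := fP n; apply: AB.
have [_ _ [z Zz]] := fP n; rewrite Ed fct_sumE big1 ?eqxx // => i _.
have [_ Zf _] := fP i.
have fz : f i z = 0 by apply: Zf; apply: Zmono Zz.
by transitivity (d i z * f i z) => //; rewrite fz mulr0.
Qed.

(** Noetherian induction: a minimal closed set without decomposition is reducible, hence a union of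
    two smaller closed sets, each of which has one. The pieces may be redundant. *)
Theorem irreducible_components (k : closedFieldType) (X : choiceType) (x0 : X)
    (A : set (X -> k)) (Z : set X) :
  finitely_generated A -> zclosed A Z -> exists (n : nat) (C : 'I_n -> set X),
    (forall i, zclosed A (C i) /\ irreducible A (C i)) /\ Z = \bigcup_i C i.
Proof.
move=> fgA cZ.
pose decomp W := exists (n : nat) (C : 'I_n -> set X),
  (forall i, zclosed A (C i) /\ irreducible A (C i)) /\ W = \bigcup_i C i.
apply: contrapT => nZ.
pose F := [set W | zclosed A W /\ ~ decomp W].
have [||W [cW nW] minW] := zclosed_minimal (F := F) x0 fgA;
  first by move=> W [].
  by exists Z.
have small V : zclosed A V -> V `<=` W -> ~ W `<=` V -> decomp V.
  move=> cV VW nWV; apply: contrapT => nV; apply: nWV; apply: minW => //.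
apply: nW.
have [irrW|] := pselect (irreducible A W).
  exists 1%N, (fun=> W); split=> //.
  by apply/seteqP; split=> [w Ww|w []//]; exists ord0.
move=> /existsNP[f /existsNP[g /not_implyP[Af /not_implyP[Ag
  /not_implyP[fg]]]]].
move=> /not_orP[/existsNP[u /not_implyP[Wu fu]] /existsNP[v /not_implyP[Wv
  gv]]].
have [|||n1 [C1 [C1P E1]]] := small (W `&` [set x | f x = 0]).
- by apply: zclosedI => //; apply: zclosed_zero.
- by move=> x [].
- by move=> /(_ _ Wu)[].
have [|||n2 [C2 [C2P E2]]] := small (W `&` [set x | g x = 0]).
- by apply: zclosedI => //; apply: zclosed_zero.
- by move=> x [].
- by move=> /(_ _ Wv)[].
exists (n1 + n2)%N,
  (fun i => match fintype.split i with inl j => C1 j | inr j => C2 j end).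
split; first by move=> i; case: (fintype.split i).
apply/seteqP; split=> x.
  move=> Wx; have /eqP := fg _ Wx; rewrite mulf_eq0 => /orP[] /eqP fx.
    have : (W `&` [set x | f x = 0]) x by [].
    rewrite E1 => -[i _ Ci]; exists (lshift n2 i) => //.
    by rewrite (unsplitK (inl i)).
  have : (W `&` [set x | g x = 0]) x by [].
  rewrite E2 => -[i _ Ci]; exists (rshift n1 i) => //.
  by rewrite (unsplitK (inr i)).
move=> [i _]; case: (fintype.split i) => j Cj.
  have : (W `&` [set x | f x = 0]) x by rewrite E1; exists j.
  by case.
have : (W `&` [set x | g x = 0]) x by rewrite E2; exists j.
by case.
Qed.

(** Otherwise choose, for each [i], a function vanishing on [C i] but not on [S]: by irreducibility
    the product does not vanish on [S], although it vanishes on the union. *)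
Lemma irreducible_sub_bigcup (k : closedFieldType) (X : Type)
    (A : set (X -> k)) (S : set X) n (C : 'I_n -> set X) :
  irreducible A S -> S !=set0 -> subalgebra A -> (forall i, zclosed A (C i)) ->
  S `<=` \bigcup_i C i -> exists i, S `<=` C i.
Proof.
move=> irrS [s Ss] sA cC SC; have [_ _ AM] := sA;
  apply: contrapT => /forallNP nSC.
have ex_f i : exists f, [/\ A f, forall z, C i z -> f z = 0 &
    exists2 z, S z & f z != 0].
  have /existsNP[z /not_implyP[Sz nCz]] := nSC i.
  by have [f [Af Cf fz]] := not_zclosed (cC i) nCz; exists f; split=> //;
    exists z.
have [f fP] := choice ex_f.
have prodP (r : seq 'I_n) (a : X -> k) : A a -> (exists2 z, S z & a z != 0) ->
    exists2 z, S z & a z * \prod_(i <- r) f i z != 0.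
  elim: r a => [|i r IHr] a Aa [z Sz az].
    by exists z => //; rewrite big_nil mulr1.
  have [Af _ [z' Sz' fz']] := fP i.
  have [||z2 Sz2] := IHr (a \* f i); first exact: AM.
    apply: contrapT => naf;
      have [w Sw|/(_ _ Sz)/eqP|/(_ _ Sz')/eqP] := irrS a (f i) Aa Af.
    - by apply: contrapT => /eqP nz; apply: naf; exists w.
    - by rewrite (negPf az).
    - by rewrite (negPf fz').
  by exists z2 => //; rewrite big_cons mulrA.
have [||z Sz] := prodP (index_enum 'I_n) (cst 1); first by case: sA.
  by exists s; rewrite ?oner_neq0.
have [i _ Cz] := SC z Sz.
by have [_ Cf _] := fP i; rewrite (bigD1 i) //= Cf // mul0r mulr0 eqxx.
Qed.

(** * Polynomial functions *)

(** Polynomials in [n] variables as syntax: the same expression is evaluated in k, in a coordinate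
    ring and in its field of fractions, and evaluation commutes with morphisms by induction. Only
    values matter, so no normal form is imposed. *)
Inductive pexp (k : Type) (n : nat) : Type :=
  | PConst of k
  | PVar of 'I_n
  | PAdd of pexp k n & pexp k n
  | PMul of pexp k n & pexp k n.

Arguments PConst {k n}.
Arguments PVar {k n}.

Section Evaluation.
Variables (k : closedFieldType) (n : nat).
Implicit Types (e : pexp k n).

Fixpoint peval (E : comNzRingType) (c : k -> E) (x : 'I_n -> E) e : E :=
  match e with
  | PConst a => c a
  | PVar i => x i
  | PAdd e1 e2 => peval c x e1 + peval c x e2
  | PMul e1 e2 => peval c x e1 * peval c x e2
  end.

Lemma eq_peval (E : comNzRingType) (c : k -> E) (x y : 'I_n -> E) e :
  x =1 y -> peval c x e = peval c y e.
Proof. by move=> xy; elim: e => //= e1 -> e2 ->. Qed.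

Lemma peval_rmorph (E F : comNzRingType) (f : {rmorphism E -> F})
    (c : k -> E) (x : 'I_n -> E) e :
  f (peval c x e) = peval (f \o c) (f \o x) e.
Proof. by elim: e => //= e1 IH1 e2 IH2; rewrite ?rmorphD ?rmorphM IH1 IH2. Qed.

Definition pevals (E : comNzRingType) (c : k -> E) (x : 'I_n -> E) : set E :=
  range (peval c x).

Lemma pevals_subalg (E : comNzRingType) (c : {rmorphism k -> E}) x :
  subalg c (pevals c x).
Proof.
split=> [a|_ _ [d _ <-] [e _ <-]|_ _ [d _ <-] [e _ <-]].
- by exists (PConst a).
- by exists (PAdd d e).
- by exists (PMul d e).
Qed.

Lemma hom_graph_peval (D : comNzRingType) (c : {rmorphism k -> D}) Gr
    (x : 'I_n -> D) (t : 'I_n -> k) e :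
  hom_graph c Gr -> (forall i, Gr (x i, t i)) ->
  Gr (peval c x e, peval id t e).
Proof.
move=> [sGr _] Gx; elim: e => //= [a|e1 IH1 e2 IH2|e1 IH1 e2 IH2].
- exact: (subalgC sGr).
- exact: (subalgD sGr IH1 IH2).
- exact: (subalgM sGr IH1 IH2).
Qed.

Definition psum (s : seq (pexp k n)) : pexp k n := foldr (@PAdd k n) (PConst 0)
  s.

Lemma peval_psum (E : comNzRingType) (c : {rmorphism k -> E}) x s :
  peval c x (psum s) = \sum_(e <- s) peval c x e.
Proof. by elim: s => [|e s IHs] /=;
  rewrite ?big_nil ?rmorph0 // big_cons IHs. Qed.

End Evaluation.

Fixpoint psubst (k : closedFieldType) (m n : nat) (y : 'I_m -> pexp k n)
    (e : pexp k m) : pexp k n :=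
  match e with
  | PConst a => PConst a
  | PVar i => y i
  | PAdd e1 e2 => PAdd (psubst y e1) (psubst y e2)
  | PMul e1 e2 => PMul (psubst y e1) (psubst y e2)
  end.

Lemma peval_psubst (k : closedFieldType) (m n : nat) (y : 'I_m -> pexp k n) e
    (E : comNzRingType) (c : k -> E) (x : 'I_n -> E) :
  peval c x (psubst y e) = peval c (fun i => peval c x (y i)) e.
Proof. by elim: e => //= e1 -> e2 ->. Qed.

Section PolynomialFunctions.
Variables (k : closedFieldType) (n : nat).

Definition polyfun : set ('rV[k]_n -> k) :=
  [set f | exists e, forall v : 'rV[k]_n, f v = peval id (v 0) e].

Lemma polyfun_finitely_generated : finitely_generated polyfun.
Proof.
exists [seq (fun v : 'rV[k]_n => v 0 i) | i <- enum 'I_n].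
  by move=> _ /mapP[i _ ->]; exists (PVar i).
move=> B [Bc Bd Bm] Bx f [e fe].
have -> : f = fun v : 'rV_n => peval id (v 0) e by apply/funext.
elim: e {f fe} => [a|i|e1 IH1 e2 IH2|e1 IH1 e2 IH2] /=.
- exact: (Bc a).
- by apply: Bx; apply: map_f; rewrite mem_enum.
- exact: (Bd _ _ IH1 IH2).
- exact: (Bm _ _ IH1 IH2).
Qed.

End PolynomialFunctions.

Lemma polyfun_mulmx (k : closedFieldType) (m n : nat) (M : 'M[k]_(m, n)) f :
  polyfun f -> polyfun (fun v : 'rV_m => f (v *m M)).
Proof.
move=> [e fe].
pose y (j : 'I_n) : pexp k m :=
  psum [seq PMul (PVar i) (PConst (M i j)) | i <- index_enum 'I_m].
exists (psubst y e) => v; rewrite fe peval_psubst; apply: eq_peval => j.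
by rewrite mxE (peval_psum (idfun : {rmorphism k -> k})) big_map.
Qed.

(** * Regular functions and closed subgroups *)

Section RegularFunctions.
Variables (k : closedFieldType) (G : algGroupType k).
Implicit Types (f g : G -> k) (H S T X : set G) (x y : G).

Lemma regular_subalgebra : subalgebra (regular G).
Proof. by have [] := @regular_variety k G. Qed.

Lemma regular_cst (a : k) : regular G (cst a).
Proof. by have [+ _ _] := regular_subalgebra; apply. Qed.

Lemma regularD f g : regular G f -> regular G g -> regular G (fun x => f x + g
  x).
Proof. by have [_ + _] := regular_subalgebra; apply. Qed.

Lemma regularM f g : regular G f -> regular G g -> regular G (fun x => f x * g
  x).
Proof. by have [_ _] := regular_subalgebra; apply. Qed.

Lemma eq_regular f g : f =1 g -> regular G f -> regular G g.
Proof. by move=> /funext->. Qed.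

Lemma regularN f : regular G f -> regular G (fun x => - f x).
Proof.
move=> rf; apply: (@eq_regular (fun x => cst (-1) x * f x)).
  by move=> x; rewrite mulN1r.
by apply: regularM => //; apply: regular_cst.
Qed.

Lemma regular_sum (I : Type) (r : seq I) (P : pred I) (F : I -> G -> k) :
  (forall i, P i -> regular G (F i)) ->
  regular G (fun x => \sum_(i <- r | P i) F i x).
Proof.
move=> rF; elim: r => [|i r IHr].
  by apply: (eq_regular _ (regular_cst 0)) => x; rewrite big_nil.
case Pi: (P i); last by apply: (eq_regular _ IHr) => x; rewrite big_cons Pi.
apply: (eq_regular _ (regularD (rF i Pi) IHr)) => x.
by rewrite big_cons Pi.
Qed.

Lemma regular_finitely_generated : finitely_generated (regular G).
Proof.
have [_ [S /finite_seqP[xs ES] ->] _] := @regular_variety k G.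
exists xs => [f fxs|B sB Bxs]; first by apply: sub_gen_smallest; rewrite ES.
apply: smallest_sub => //.
by rewrite ES => f; apply: Bxs.
Qed.

Definition regmap (mu : G -> G) : Prop :=
  forall f, regular G f -> regular G (fun x => f (mu x)).

Lemma regmap_id : regmap id. Proof. by []. Qed.

Lemma regmap_cst x : regmap (fun=> x).
Proof. by move=> f _; apply: (regular_cst (f x)). Qed.

Lemma regmapM mu nu : regmap mu -> regmap nu -> regmap (fun x => mu x * nu x)%g.
Proof.
move=> rmu rnu f /regular_mul[n [a [b [rab E]]]].
apply: (@eq_regular (fun x => \sum_(i < n) a i (mu x) * b i (nu x))).
  by move=> x; rewrite E.
apply: regular_sum => i _; have [ra rb] := rab i.
by apply: regularM; [apply: rmu|apply: rnu].
Qed.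

Lemma regmapV mu : regmap mu -> regmap (fun x => (mu x)^-1)%g.
Proof. by move=> rmu f /regular_inv/rmu. Qed.

Lemma subalgebra_point (phi : (G -> k) -> k) : algebra_point (regular G) phi ->
  exists x : G, forall f, regular G f -> phi f = f x.
Proof.
have [_ _ pts] := @regular_variety k G.
by move=> /pts[x [xP _]]; exists x.
Qed.

Notation irr := (irreducible (regular G)).
Notation zcl := (zclosed (regular G)).

Lemma irreducible_nonzero S f g : irr S -> regular G f -> regular G g ->
  (exists2 x, S x & f x != 0) -> (exists2 x, S x & g x != 0) ->
  exists x, [/\ S x, f x != 0 & g x != 0].
Proof.
move=> irrS rf rg [x Sx fx] [y Sy gy]; apply: contrapT => nz.
have [z Sz|/(_ _ Sx)/eqP|/(_ _ Sy)/eqP] := irrS f g rf rg.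
- apply: contrapT => /eqP; rewrite mulf_eq0 negb_or => /andP[fz gz].
  by apply: nz; exists z.
- by rewrite (negPf fx).
- by rewrite (negPf gy).
Qed.

(** Replaces the irreducibility of a product variety: a [t] good for the slices through [s0] and
    [s1] is chosen first, then an [s] good for that [t]. Regularity in each variable separately
    suffices. *)
Lemma irreducible_image2 S T (mu : G -> G -> G) : irr S -> irr T ->
  (forall t, regmap (mu ^~ t)) -> (forall s, regmap (mu s)) ->
  irr [set z | exists s t, [/\ S s, T t & z = mu s t]].
Proof.
move=> irrS irrT rS rT f g rf rg fg; apply: contrapT.
move=> /not_orP[/existsNP[u /not_implyP[[s0 [t0 [Ss0 Tt0 ->]]] /eqP f0]]].
move=> /existsNP[v /not_implyP[[s1 [t1 [Ss1 Tt1 ->]]] /eqP g1]].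
have [||t [Tt ft gt]] := irreducible_nonzero irrT (rT s0 _ rf) (rT s1 _ rg).
- by exists t0.
- by exists t1.
have [||s [Ss fs gs]] := irreducible_nonzero irrS (rS t _ rf) (rS t _ rg).
- by exists s0.
- by exists s1.
have : (f (mu s t) * g (mu s t) != 0) by rewrite mulf_neq0.
by rewrite fg ?eqxx //; exists s, t.
Qed.

Lemma irreducible_image S mu : irr S -> regmap mu -> irr [set mu x | x in S].
Proof.
move=> irrS rmu f g rf rg fg;
  have [z Sz|f0|g0] := irrS _ _ (rmu _ rf) (rmu _ rg).
- by apply: fg; exists z.
- by left=> _ [z Sz <-]; apply: f0.
- by right=> _ [z Sz <-]; apply: g0.
Qed.

(** The product of the [f - a] vanishes on [S], so one factor does. Connectedness enters the
    Lie-Kolchin theorem through this rigidity. *)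
Lemma irreducible_finite_values S f (r : seq k) : irr S -> regular G f ->
  (forall x, S x -> f x \in r) -> forall x y, S x -> S y -> f x = f y.
Proof.
move=> irrS rf fr x y Sx Sy; apply: contrapT => /eqP fxy.
have reg_sub a : regular G (fun x => f x - a).
  by apply: regularD => //; apply: (regular_cst (- a)).
have [z Sz] : exists2 z, S z & \prod_(a <- r) (f z - a) != 0.
  have reg_prod (s : seq k) : regular G (fun x => \prod_(a <- s) (f x - a)).
    elim: s => [|a s IHs].
      by apply: (eq_regular _ (regular_cst 1)) => z; rewrite big_nil.
    by apply: (eq_regular _ (regularM (reg_sub a) IHs)) => z; rewrite big_cons.
  elim: r {fr} => [|a r [z Sz IHz]].
    by exists x; rewrite ?big_nil ?oner_neq0.
  have [||w [Sw aw rw]] := irreducible_nonzero irrS (reg_sub a) (reg_prod r).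
  - have [fxa|] := eqVneq (f x) a; last by exists x; rewrite ?subr_eq0.
    by exists y; rewrite // subr_eq0 -fxa eq_sym.
  - by exists z.
  by exists w; rewrite // big_cons mulf_neq0.
by rewrite (big_rem _ (fr z Sz)) /= subrr mul0r eqxx.
Qed.

Lemma subgroupV H x : subgroup H -> H x -> H (x^-1)%g.
Proof. by move=> [H1 HM] Hx; rewrite -[(x^-1)%g]mul1g; apply: HM. Qed.

Lemma subgroupM H x y : subgroup H -> H x -> H y -> H (x * y)%g.
Proof.
by move=> sH Hx Hy; rewrite -[y]invgK; case: (sH) => _; apply=> //;
  apply: subgroupV.
Qed.

Lemma subgroupR H x y : subgroup H -> H x -> H y -> H [~ x, y]%g.
Proof.
move=> sH Hx Hy; rewrite /commg /conjg.
by do ?[exact: Hx | exact: Hy | exact: subgroupV | apply: (subgroupM sH)].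
Qed.

Lemma derived_subgroup H : subgroup (derived H).
Proof.
split=> [|x y Dx Dy] K [sK KH]; first by case: sK.
by case: (sK) => _; apply; [apply: Dx|apply: Dy].
Qed.

Lemma derived_min H K : subgroup K -> (forall x y, H x -> H y -> K [~ x,
  y]%g) ->
  derived H `<=` K.
Proof. by move=> sK HK; apply: smallest_sub => // _ [x Hx [y Hy <-]];
  apply: HK. Qed.

Lemma derived_sub H : subgroup H -> derived H `<=` H.
Proof. by move=> sH; apply: derived_min => // x y; apply: subgroupR. Qed.

Lemma derivedR H x y : H x -> H y -> derived H [~ x, y]%g.
Proof. by move=> Hx Hy; apply: sub_gen_smallest; exists x => //; exists y. Qed.

Lemma derivedJ H x y : subgroup H -> derived H x -> H y -> derived H (y * x *
  y^-1)%g.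
Proof.
move=> sH Dx Hy; have Hx := derived_sub sH Dx.
have -> : (y * x * y^-1 = [~ y^-1, x^-1] * x)%g.
  by rewrite /commg /conjg !invgK !mulgA mulgVK.
apply: (subgroupM (derived_subgroup H)) => //.
by apply: derivedR; apply: (subgroupV sH).
Qed.

Lemma iter_derived_subgroup H n : subgroup H -> subgroup (iter n (@derived k G)
  H).
Proof. by case: n => // n _; apply: derived_subgroup. Qed.

Lemma iter_derived_sub H n : subgroup H -> iter n (@derived k G) H `<=` H.
Proof.
move=> sH; elim: n => // n IHn /=; apply: subset_trans IHn.
by apply: derived_sub; apply: iter_derived_subgroup.
Qed.

(* The products of m commutators form an increasing sequence of irreducible
   sets. *)
Lemma derived_irreducible H : subgroup H -> irr H -> irr (derived H).
Proof.
move=> sH irrH.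
pose comm := [set z | exists s t, [/\ H s, H t & z = [~ s, t]%g]].
have irr_comm : irr comm.
  apply: irreducible_image2 => // t; rewrite /commg /conjg;
  by repeat first [exact: regmap_id|exact: regmap_cst|apply: regmapV|apply:
    regmapM].
pose C n := iter n (fun S => [set z | exists s t, [/\ S s,
  comm t & z = (s * t)%g]]) [set 1%g].
have irrC n : irr (C n).
  elim: n => [|n IHn] /=.
    move=> f g _ _ /(_ 1%g erefl)/eqP; rewrite mulf_eq0.
    by move=> /orP[]/eqP z; [left|right] => _ ->.
  by apply: irreducible_image2 => // t; apply: regmapM;
    first [exact: regmap_id|exact: regmap_cst].
have comm1 : comm 1%g by exists 1%g, 1%g; split;
  [case: sH|case: sH|rewrite commg1].
have Cmono m n : (m <= n)%N -> C m `<=` C n.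
  elim: n => [|n IHn]; first by rewrite leqn0 => /eqP->.
  rewrite leq_eqVlt => /orP[/eqP->//|/IHn le x /le Cx].
  by exists x, 1%g; rewrite mulg1.
have CM m n x y : C m x -> C n y -> C (n + m)%N (x * y)%g.
  move=> Cx; elim: n y => [|n IHn] y; first by move=> ->; rewrite mulg1.
  by move=> [s [t [Cs ct ->]]]; exists (x * s)%g, t; rewrite mulgA;
    split=> //; apply: IHn.
have commV t : comm t -> comm (t^-1)%g.
  by move=> [x [y [Hx Hy ->]]]; exists y, x;
    rewrite /commg /conjg !invgM !invgK !mulgA.
have CV n x : C n x -> exists m, C m (x^-1)%g.
  elim: n x => [|n IHn] x; first by move=> ->; exists 0%N; rewrite invg1.
  move=> [s [t [/IHn[m Cs] /commV ct ->]]]; rewrite invgM; exists (m + 1)%N.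
  by apply: CM => //; exists 1%g, (t^-1)%g; rewrite mul1g.
have DC : derived H `<=` [set x | exists n, C n x].
  apply: derived_min => [|x y Hx Hy]; last first.
    by exists 1%N, 1%g, [~ x, y]%g; rewrite mul1g; split=> //; exists x, y.
  split=> [|x y [m Cx] [n /CV[l Cy]]]; first by exists 0%N.
  by exists (l + m)%N; apply: CM.
have CD n : C n `<=` derived H.
  have [D1 _] := derived_subgroup H.
  elim: n => [_ ->//|n IHn _ [s [t [/IHn Ds [x [y [Hx Hy ->]]] ->]]]].
  by apply: (subgroupM (derived_subgroup H)) => //; apply: derivedR.
move=> f g rf rg fg; apply: contrapT.
move=> /not_orP[/existsNP[u /not_implyP[/DC[m Cu] /eqP fu]]].
move=> /existsNP[v /not_implyP[/DC[n Cv] /eqP gv]].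
have [||x [Cx fx gx]] := irreducible_nonzero (irrC (maxn m n)) rf rg.
- by exists u => //; apply: Cmono Cu; apply: leq_maxl.
- by exists v => //; apply: Cmono Cv; apply: leq_maxr.
have : f x * g x != 0 by rewrite mulf_neq0.
by rewrite fg ?eqxx //; apply: CD Cx.
Qed.

(* The components containing 1 multiply into a single one, which is the
   identity component. *)
Theorem identity_component X : subgroup X -> zcl X -> exists H,
  [/\ subgroup H, zcl H, irr H, H `<=` X &
  (forall S, irr S -> S 1%g -> S `<=` X -> S `<=` H) /\
  exists (n : nat) (c : 'I_n -> G), forall x, X x -> exists i,
    H (x * (c i)^-1)%g].
Proof.
move=> sX cX; have [X1 _] := sX.
have [n [C [CP EX]]] := irreducible_components 1%g regular_finitely_generated
  cX.
have subC S : irr S -> S !=set0 -> S `<=` X -> exists i, S `<=` C i.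
  move=> irrS S0; rewrite EX.
  apply: (irreducible_sub_bigcup irrS S0 regular_subalgebra) => i.
  by have [] := CP i.
have CX i : C i `<=` X by rewrite EX => x Cx; exists i.
have [S [irrS SX S1 CS]] : exists S, [/\ irr S, S `<=` X, S 1%g &
    forall i, C i 1%g -> C i `<=` S].
  suff [S [irrS SX S1 CS]] : exists S, [/\ irr S, S `<=` X, S 1%g &
      forall i, i \in enum 'I_n -> C i 1%g -> C i `<=` S].
    by exists S; split=> // i; apply: CS; rewrite mem_enum.
  elim: (enum _) => [|i r [S [irrS SX S1 CS]]].
    exists [set 1%g]; split=> // [|_ ->//].
    move=> f g _ _ /(_ 1%g erefl)/eqP; rewrite mulf_eq0.
    by move=> /orP[]/eqP z; [left|right] => _ ->.
  have [Ci1|nCi1] := pselect (C i 1%g); last first.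
    by exists S; split=> // j; rewrite in_cons => /orP[/eqP-> //|]; apply: CS.
  exists [set z | exists s t, [/\ S s, C i t & z = (s * t)%g]]; split.
  - have [_ irrC] := CP i; apply: irreducible_image2 => // t; apply: regmapM;
    by first [exact: regmap_id|exact: regmap_cst].
  - by move=> _ [s [t [/SX Xs /CX Xt ->]]]; apply: (subgroupM sX).
  - by exists 1%g, 1%g; rewrite mulg1.
  - move=> j; rewrite in_cons => /orP[/eqP->|rj] Cj1 x Cx.
      by exists 1%g, x; rewrite mul1g.
    by exists x, 1%g; rewrite mulg1; split=> //; apply: CS Cx.
have [j SCj] := subC S irrS (ex_intro _ _ S1) SX.
have [cCj irrCj] := CP j.
have maxC T : irr T -> T 1%g -> T `<=` X -> T `<=` C j.
  move=> irrT T1 TX; have [i TC] := subC T irrT (ex_intro _ _ T1) TX.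
  by apply: subset_trans SCj; apply: subset_trans (CS i (TC _ T1)).
have Cj1 : C j 1%g by apply: SCj.
(* A component moved by the inverse of one of its points passes through 1, so it falls into [C j];
   this gives both the group law and the finite index. *)
have transl i y x : C i y -> C i x -> C j (x * y^-1)%g.
  move=> Cy Cx; have [_ irrC] := CP i.
  apply: (maxC [set (z * y^-1)%g | z in C i]); last by exists x.
  - by apply: irreducible_image => //; apply: regmapM;
      [apply: regmap_id|apply: regmap_cst].
  - by exists y => //; rewrite mulgV.
  - move=> _ [z Cz <-]; apply: (subgroupM sX); first exact: CX Cz.
    by apply: (subgroupV sX); apply: CX Cy.
exists (C j); split=> //.
  by split=> // x y Cx Cy; apply: (transl j).
split; first exact: maxC.
exists n.
have pick i : exists y, C i !=set0 -> C i y.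
  by have [[y Cy]|nC] := pselect (C i !=set0); [exists y|exists 1%g].
have [y yP] := choice pick; exists y => x; rewrite EX => -[i _ Cx].
by exists i; apply: (transl i) => //; apply: yP; exists x.
Qed.

End RegularFunctions.

(** * Representations and the Lie-Kolchin theorem *)

(** A finite family of points of maximal rank already spans, so the span of an orbit is the row
    space of a matrix. *)
Lemma span_points (k : fieldType) (T : Type) (H : set T) (n : nat)
    (a : T -> 'rV[k]_n) : exists (m : nat) (p : 'I_m -> T),
  (forall i, H (p i)) /\ forall y, H y -> (a y <= \matrix_(i < m) a (p i))%MS.
Proof.
pose P r := `[< exists (m : nat) (p : 'I_m -> T), (forall i, H (p i)) /\
  \rank (\matrix_(i < m) a (p i)) = r >].
have exP : exists r, P r.
  have p0 (i : 'I_0) : T by case: i.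
  by exists (\rank (\matrix_(i < 0) a (p0 i))); apply/asboolP; exists 0%N, p0;
    split=> // -[].
have leP r : P r -> (r <= n)%N by move=> /asboolP[m [p [_ <-]]];
  apply: rank_leq_col.
case: (ex_maxnP exP leP) => r /asboolP[m [p [Hp rp]]] maxr.
exists m, p; split=> // y Hy; set U := \matrix_i _; apply: contraT => nyU.
pose p' (i : 'I_(m + 1)) := match fintype.split i with inl j => p j | inr _ =>
  y end.
have EU : \matrix_(i < m + 1) a (p' i) = col_mx U (a y).
  apply/row_matrixP => i; rewrite rowK /p'; case: (fintype.splitP i) => j Ei.
    have -> : i = lshift 1 j by apply: val_inj.
    by rewrite rowKu rowK.
  have -> : i = rshift m j by apply: val_inj.
  by rewrite rowKd row_id.
have : (\rank (col_mx U (a y)) <= r)%N.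
  apply: maxr; apply/asboolP; exists (m + 1)%N, p'; rewrite EU; split=> // i.
  by rewrite /p'; case: (fintype.split i).
rewrite -addsmxE -rp leqNgt => /negP[].
by apply: rank_ltmx; rewrite ltmxE addsmxSl /= addsmx_sub negb_and submx_refl.
Qed.

Section Representations.
Variables (k : closedFieldType) (G : algGroupType k).
Implicit Types (f : G -> k) (H N : set G) (x y g h : G).

Notation irr := (irreducible (regular G)).
Notation zcl := (zclosed (regular G)).

(* The action is on row vectors, hence on the right. *)
Definition is_rep H n (rho : G -> 'M[k]_n) : Prop :=
  [/\ forall i j, regular G (fun g => rho g i j), rho 1%g = 1%:M
    & forall x y, H x -> H y -> rho (x * y)%g = rho x *m rho y].

Definition fixes_line H n (rho : G -> 'M[k]_n) (v : 'rV[k]_n) : Prop :=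
  forall h, H h -> exists c : k, v *m rho h = c *: v.

Lemma regular_mulmx m n p (a : G -> 'M[k]_(m, n)) (b : G -> 'M[k]_(n, p)) i j :
  (forall i j, regular G (fun g => a g i j)) ->
  (forall i j, regular G (fun g => b g i j)) ->
  regular G (fun g => (a g *m b g) i j).
Proof.
move=> ra rb; apply: (@eq_regular _ _ (fun g => \sum_l a g i l * b g l j)).
  by move=> g; rewrite mxE.
by apply: regular_sum => l _; apply: regularM.
Qed.

Lemma regular_const_mx m n (M : 'M[k]_(m, n)) i j : regular G (fun=> M i j).
Proof. exact: (regular_cst G (M i j)). Qed.

Lemma is_repS H N n (rho : G -> 'M[k]_n) : N `<=` H -> is_rep H rho -> is_rep N
  rho.
Proof. by move=> NH [r1 r2 r3]; split=> // x y /NH Hx /NH Hy; apply: r3. Qed.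

Section Rep.
Variables (H : set G) (sH : subgroup H) (n : nat) (rho : G -> 'M[k]_n).
Hypothesis rrho : is_rep H rho.

Lemma rep_mulVg h : H h -> rho (h^-1)%g *m rho h = 1%:M.
Proof.
move=> Hh; have [_ r1 rM] := rrho.
by rewrite -rM ?mulVg //; apply: (subgroupV sH).
Qed.

Lemma rep_mulgV h : H h -> rho h *m rho (h^-1)%g = 1%:M.
Proof.
move=> Hh; have [_ r1 rM] := rrho.
by rewrite -rM ?mulgV //; apply: (subgroupV sH).
Qed.

Lemma rep_vec_neq0 (v : 'rV_n) h : H h -> v != 0 -> v *m rho h != 0.
Proof.
move=> Hh; apply: contra_neq => v0.
by rewrite -[v]mulmx1 -(rep_mulgV Hh) mulmxA v0 mul0mx.
Qed.

Lemma rep_commutator x y : H x -> H y ->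
  rho [~ x, y]%g = rho ((y * x)^-1)%g *m rho (x * y)%g.
Proof.
move=> Hx Hy; have [_ _ rM] := rrho; rewrite -rM //.
- by congr (rho _); rewrite /commg /conjg invgM !mulgA.
- by apply: (subgroupV sH); apply: (subgroupM sH).
- exact: (subgroupM sH).
Qed.

(** A stable line of the dual is a stable hyperplane of [rho], which allows induction on the
    dimension. *)
Lemma dual_rep : is_rep H (fun g => (rho (g^-1)%g)^T).
Proof.
have [rr r1 rM] := rrho; split=> [i j||x y Hx Hy].
- apply: (@eq_regular _ _ (fun g => rho (g^-1)%g j i)).
    by move=> g; rewrite mxE.
  exact: (regmapV (@regmap_id _ G) (rr j i)).
- by rewrite invg1 r1 trmx1.
- by rewrite invgM rM ?trmx_mul //; apply: (subgroupV sH).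
Qed.

Lemma restrict_rep r (U : 'M[k]_(r, n)) : row_free U ->
  (forall h, H h -> (U *m rho h <= U)%MS) ->
  exists alpha : G -> 'M[k]_r, is_rep H alpha /\
    forall h, H h -> alpha h *m U = U *m rho h.
Proof.
move=> fU stU; have [rr r1 rM] := rrho.
have E h : H h -> U *m rho h *m pinvmx U *m U = U *m rho h.
  by move=> Hh; rewrite mulmxKpV // stU.
exists (fun h => U *m rho h *m pinvmx U); split=> //.
split=> [i j||x y Hx Hy].
- apply: regular_mulmx; last by move=> *; apply: regular_const_mx.
  by move=> *; apply: regular_mulmx => // *; apply: regular_const_mx.
- by rewrite r1 mulmx1 mulmxVp.
- apply: (row_free_inj fU); rewrite E; last exact: (subgroupM sH).
  by rewrite -[RHS]mulmxA E // mulmxA E // -mulmxA rM.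
Qed.

(* Irreducibility is stated dually: only 0 kills the span of an orbit. *)
Lemma irreducible_subrep : (0 < n)%N ->
  exists (r : nat) (alpha : G -> 'M[k]_r) (U : 'M[k]_(r, n)),
  [/\ (0 < r)%N, is_rep H alpha, row_free U,
      forall h, H h -> alpha h *m U = U *m rho h &
      forall (u : 'rV_r) (M : 'M_r), u != 0 ->
        (forall h, H h -> u *m alpha h *m M = 0) -> M = 0].
Proof.
move=> n0; have [rr r1 rM] := rrho; have [H1 _] := sH.
pose P r := (0 < r)%N && `[< exists U : 'M[k]_(r, n),
  row_free U /\ forall h, H h -> (U *m rho h <= U)%MS >].
have exP : exists r, P r.
  exists n; rewrite /P n0; apply/asboolP; exists 1%:M.
  by split=> [|h _]; rewrite ?row_free_unit ?unitmx1 ?submx1.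
case: (ex_minnP exP) => r /andP[r0 /asboolP[U [fU stU]]] minr.
have [alpha [ralpha aU]] := restrict_rep fU stU.
exists r, alpha, U; split=> // u M u0 uM.
have [m [p [Hp pS]]] := span_points H (fun h => u *m alpha h).
set S := \matrix_i _ in pS.
have stS h : H h -> (S *m alpha h <= S)%MS.
  move=> Hh; apply/row_subP => i; rewrite row_mul rowK -mulmxA.
  have [_ _ aM] := ralpha; rewrite -aM //; apply: pS; exact: (subgroupM sH).
have S0 : (0 < \rank S)%N.
  rewrite lt0n mxrank_eq0; apply/eqP => S0.
  have := pS _ H1; have [_ -> _] := ralpha; rewrite mulmx1 S0.
  by move=> /submx0null/eqP; rewrite (negPf u0).
have : (r <= \rank S)%N.
  apply: minr; rewrite /P S0; apply/asboolP; exists (row_base S *m U); split.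
    by rewrite /row_free mxrankMfree // eq_row_base.
  move=> h Hh; rewrite -mulmxA -aU // mulmxA; apply: submxMr.
  by rewrite eq_row_base (eqmxMr _ (eq_row_base S)) stS.
move=> leS; have fS : row_full S by rewrite /row_full eqn_leq rank_leq_col.
apply: (row_full_inj fS); rewrite mulmx0; apply/row_matrixP => i.
by rewrite row_mul rowK row0 uM.
Qed.

End Rep.

Lemma closed_eigenvalue n (A : 'M[k]_n) : (0 < n)%N -> exists a, eigenvalue A a.
Proof.
move=> n0; have /closed_rootP[a ra] : size (char_poly A) != 1%N.
  by rewrite size_char_poly eqSS -lt0n.
by exists a; rewrite eigenvalue_root_char.
Qed.

(** In an irreducible subrepresentation, an eigenvector of the derived group has a character [chi]
    whose conjugates at a given [g] are eigenvalues of one matrix, hence finitely many. So [chi] is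
    invariant under [H], and the derived group acts by scalars. These have determinant 1, hence are
    roots of unity, and are trivial because the derived group is irreducible as a set. The operators
    of [H] then commute, and each is a scalar. *)
Theorem lie_kolchin H n (rho : G -> 'M[k]_n) : subgroup H -> irr H ->
  (exists m, iter m (@derived k G) H = [set 1%g]) -> is_rep H rho -> (0 < n)%N
    ->
  exists2 v : 'rV_n, v != 0 & fixes_line H rho v.
Proof.
move=> sH irrH [m]; elim: m H sH irrH n rho => [|m IHm] H sH irrH n rho.
  move=> /= -> [_ r1 _] n0; exists (const_mx 1).
    apply/eqP => /matrixP/(_ 0 (Ordinal n0)); rewrite !mxE.
    by apply/eqP/oner_neq0.
  by move=> _ ->; exists 1; rewrite r1 mulmx1 scale1r.
rewrite iterSr => solH rrho n0.
have [r [alpha [U [r0 ralpha fU aU simple]]]] := irreducible_subrep sH rrho n0.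
suff [v v0 vH] : exists2 v : 'rV_r, v != 0 & fixes_line H alpha v.
  exists (v *m U).
    apply: contra_neq v0 => vU; apply: (row_free_inj fU).
    by rewrite vU mul0mx.
  by move=> h Hh; have [c vc] := vH h Hh; exists c;
    rewrite -mulmxA -aU // mulmxA vc scalemxAl.
have sD := derived_subgroup H; have DH := derived_sub sH.
have [v v0 vD] := IHm _ sD (derived_irreducible sH irrH) _ _ solH (is_repS DH
  ralpha) r0.
have [ra a1 aM] := ralpha.
have /rV0Pn[j vj] := v0.
pose chi g := (v *m alpha g) 0 j / v 0 j.
have chiE g : derived H g -> v *m alpha g = chi g *: v.
  by move=> /vD[c vc]; rewrite vc /chi vc mxE mulfK.
have rchi : regular G chi.
  apply: regularM; last exact: (regular_cst G (v 0 j)^-1).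
  by apply: regular_mulmx => // *; apply: regular_const_mx.
have chiJ g h : derived H g -> H h -> chi (h * g * h^-1)%g = chi g.
  move=> Dg Hh; have [H1 _] := sH.
  have [rs Ers] := closed_field_poly_normal (char_poly (alpha g)).
  have -> : chi g = chi (1 * g * 1^-1)%g by rewrite mul1g invg1 mulg1.
  have rc : regular G (fun h => chi (h * g * h^-1)%g).
    apply: (_ : regmap (fun h => h * g * h^-1)%g) => //.
    by repeat first [exact: regmap_id|exact: regmap_cst|apply: regmapV|apply:
      regmapM].
  apply: (irreducible_finite_values (r := rs) irrH rc) => // x Hx.
  have DJ := derivedJ sH Dg Hx.
  suff : root (char_poly (alpha g)) (chi (x * g * x^-1)%g).
    by rewrite Ers rootZ ?root_prod_XsubC // lead_coef_eq0 monic_neq0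
      ?char_poly_monic.
  rewrite -eigenvalue_root_char; apply/eigenvalueP; exists (v *m alpha x).
    rewrite -mulmxA -aM //; last exact: DH.
    by rewrite scalemxAl -chiE // -mulmxA -aM ?mulgVK //; apply: DH.
  exact: (rep_vec_neq0 sH ralpha Hx v0).
have scalD g : derived H g -> alpha g = (chi g)%:M.
  move=> Dg; apply/eqP; rewrite -subr_eq0; apply/eqP.
  apply: (simple v) => // h Hh; rewrite mulmxBr mul_mx_scalar -mulmxA -aM //;
    last exact: DH.
  have -> : (h * g = (h * g * h^-1) * h)%g by rewrite mulgVK.
  have DJ := derivedJ sH Dg Hh; rewrite aM //; last exact: DH.
  by rewrite mulmxA (chiE _ DJ) -scalemxAl chiJ // subrr.
have detD g : derived H g -> \det (alpha g) = 1.
  have sK : subgroup [set g | H g /\ \det (alpha g) = 1].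
    split; first by split; [case: sH|rewrite a1 det1].
    move=> x y [Hx dx] [Hy dy]; have HVy := subgroupV sH Hy; split.
      exact: (subgroupM sH).
    rewrite aM // det_mulmx dx mul1r -[LHS]mul1r -dy -det_mulmx.
    by rewrite (rep_mulgV sH ralpha) // det1.
  have DK := @derived_min _ _ H _ sK; move/DK => [] // x y Hx Hy.
  split; first exact: (subgroupR sH).
  have Hyx := subgroupM sH Hy Hx.
  rewrite (rep_commutator sH ralpha) // det_mulmx [in X in _ * X]aM //
    det_mulmx mulrC.
  rewrite [X in X * _]mulrC -det_mulmx -aM // -det_mulmx.
  by rewrite (rep_mulgV sH ralpha) // det1.
have trivD g : derived H g -> alpha g = 1%:M.
  move=> Dg; have D1 : derived H 1%g by case: sD.
  have [rs Ers] := closed_field_poly_normal ('X^r - 1 : {poly k}).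
  have Xr0 : 'X^r - 1 != 0 :> {poly k} by rewrite -size_poly_eq0 size_XnsubC.
  rewrite (scalD _ Dg); congr (_%:M).
  have <- : chi 1%g = 1 by rewrite /chi a1 mulmx1 divff.
  apply: (irreducible_finite_values (r := rs) (derived_irreducible sH irrH)
    rchi) => // x Dx.
  suff : root ('X^r - 1) (chi x) by rewrite Ers rootZ ?root_prod_XsubC //
    lead_coef_eq0.
  by rewrite rootE !hornerE -det_scalar -scalD // detD // subrr.
have comm x y : H x -> H y -> alpha x *m alpha y = alpha y *m alpha x.
  move=> Hx Hy; have := trivD _ (derivedR Hx Hy).
  rewrite (rep_commutator sH ralpha) // => E.
  have Hyx := subgroupM sH Hy Hx.
  rewrite -!aM // -[LHS]mul1mx -(rep_mulgV sH ralpha Hyx) -mulmxA E.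
  by rewrite mulmx1.
exists v => // h Hh;
  have [a /eigenvalueP[u ua u0]] := closed_eigenvalue (alpha h) r0.
exists a; rewrite -mul_mx_scalar; congr (_ *m _); apply/eqP;
  rewrite -subr_eq0; apply/eqP.
apply: (simple u) => // h' Hh'.
rewrite mulmxBr -mulmxA comm // mulmxA ua mul_mx_scalar -scalemxAl subrr.
by [].
Qed.

End Representations.

(** * Local finiteness of regular functions and a criterion of solvability *)

Section LocalFiniteness.
Variables (k : closedFieldType) (G : algGroupType k).
Implicit Types (f : G -> k) (H N : set G) (x y g h : G).

(* In f (g * x) = \sum_i a_i(g) b_i(x), a decomposition with a minimal number of
   terms is unique up to a linear change of basis, so a is equivariant. *)
Theorem local_finiteness H f : subgroup H -> regular G f ->
  exists (n : nat) (w : G -> 'rV[k]_n) (sigma : G -> 'M[k]_n),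
  [/\ forall i, regular G (fun g => w g 0 i), is_rep H sigma,
      forall g x, H g -> H x -> w (g * x)%g = w g *m sigma x,
      exists v : 'cV_n, forall g, H g -> f g = (w g *m v) 0 0 &
      exists (m : nat) (p : 'I_m -> G) (C : 'M_(m, n)), (forall j, H (p j)) /\
        forall g, H g -> w g = (\row_j f (g * p j)%g) *m C].
Proof.
move=> sH rf; have [H1 _] := sH.
pose decomp n (a : G -> 'rV[k]_n) (b : G -> 'rV[k]_n) :=
  [/\ forall i, regular G (fun g => a g 0 i), forall i,
    regular G (fun g => b g 0 i) &
      forall g x, H g -> H x -> f (g * x)%g = (a g *m (b x)^T) 0 0].
pose P n := `[< exists a b, @decomp n a b >].
have exP : exists n, P n.
  have /regular_mul[n [a [b [rab Ef]]]] := rf.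
  exists n; apply/asboolP;
    exists (fun g => \row_i a i g), (fun g => \row_i b i g).
  split=> [i|i|g x _ _].
  - by have [ra _] := rab i; apply: (eq_regular _ ra) => g; rewrite mxE.
  - by have [_ rb] := rab i; apply: (eq_regular _ rb) => g; rewrite mxE.
  - by rewrite Ef mxE; apply: eq_bigr => i _; rewrite !mxE.
case: (ex_minnP exP) => n /asboolP[a [b [ra rb Ef]]] minn.
have [m [p [Hp bp]]] := span_points H b; set B := \matrix_i b (p i) in bp.
have [m' [q [Hq aq]]] := span_points H a; set A := \matrix_i a (q i) in aq.
have regM l l' (c : G -> 'rV[k]_l) (M : 'M_(l, l')) i :
    (forall j, regular G (fun g => c g 0 j)) -> regular G (fun g => (c g *m M)
      0 i).
  move=> rc; apply: (@regular_mulmx _ _ _ _ _ c (fun=> M)) => [s j|s j].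
    by rewrite ord1.
  exact: regular_const_mx.
have fB : row_full B.
  rewrite /row_full eqn_leq rank_leq_col; apply: minn; apply/asboolP.
  exists (fun g => a g *m (row_base B)^T),
    (fun x => b x *m pinvmx (row_base B)).
  split=> [i|i|g x Hg Hx]; [exact: regM|exact: regM|].
  by rewrite -mulmxA -trmx_mul mulmxKpV ?eq_row_base ?bp // Ef.
have fA : row_full A.
  rewrite /row_full eqn_leq rank_leq_col; apply: minn; apply/asboolP.
  exists (fun g => a g *m pinvmx (row_base A)),
    (fun x => b x *m (row_base A)^T).
  split=> [i|i|g x Hg Hx]; [exact: regM|exact: regM|].
  by rewrite trmx_mul trmxK mulmxA mulmxKpV ?eq_row_base ?aq // Ef.
(* As [B] has full rank, [a] is a combination of finitely many right translates of [f]; it therefore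
   inherits the left invariances of these translates. *)
pose C := (pinvmx B)^T.
have aC g : H g -> a g = (\row_j f (g * p j)%g) *m C.
  move=> Hg; have -> : \row_j f (g * p j)%g = a g *m B^T.
    apply/rowP => j; rewrite mxE Ef // !mxE; apply: eq_bigr => i _.
    by rewrite !mxE.
  by rewrite -mulmxA -trmx_mul mulVpmx // trmx1 mulmx1.
pose sigma x := (\matrix_(i, j) b (x * p j)%g 0 i) *m C.
have aM g x : H g -> H x -> a (g * x)%g = a g *m sigma x.
  move=> Hg Hx; rewrite aC; last exact: (subgroupM sH).
  rewrite mulmxA; congr (_ *m _); apply/rowP => j.
  rewrite mxE -mulgA Ef //; last exact: (subgroupM sH).
  by rewrite !mxE; apply: eq_bigr => i _; rewrite !mxE.
have sM x M : H x -> (forall g,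
  H g -> a g *m sigma x = a g *m M) -> sigma x = M.
  move=> Hx aM'; apply: (row_full_inj fA); apply/row_matrixP => i.
  by rewrite !row_mul !rowK aM'.
exists n, a, sigma; split=> //.
- split=> [i j||x y Hx Hy].
  + apply: regular_mulmx; last by move=> *; apply: regular_const_mx.
    move=> i' j'; apply: (@eq_regular _ _ (fun x => b (x * p j')%g 0 i')).
      by move=> x; rewrite mxE.
    by apply: (regmapM (@regmap_id _ G) (regmap_cst (p j')) (rb i')).
  + by apply: sM => // g Hg; rewrite -aM // mulg1 mulmx1.
  + apply: sM => [|g Hg]; first exact: (subgroupM sH).
    rewrite -aM //; last exact: (subgroupM sH).
    by rewrite mulgA !aM ?mulmxA //; apply: (subgroupM sH).
- by exists (b 1%g)^T => g Hg; rewrite -Ef // mulg1.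
- by exists m, p, C.
Qed.

(** Induction through the stable hyperplane [U], the kernel of [L]. Once a derived subgroup [N] is
    trivial on [U], its own derived subgroup also fixes [L], because multipliers cancel in
    commutators. There the operators [rho g - 1] map into [U] and kill [U], so their products vanish
    and the operators commute: these two further steps account for [m.+2]. *)
Lemma triangular_derived H : subgroup H ->
  (forall n (rho : G -> 'M[k]_n), is_rep H rho -> (0 < n)%N ->
    exists2 v, v != 0 & fixes_line H rho v) ->
  forall n (rho : G -> 'M[k]_n), is_rep H rho ->
    exists m, forall g, iter m (@derived k G) H g -> rho g = 1%:M.
Proof.
move=> sH lines n; have [l] := ubnP n; elim: l n => // l IHl n;
  rewrite ltnS => lenl rho rrho.
have [n0|n0] := posnP n.
  by subst n; exists 0%N => g _; apply/matrixP => -[].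
have [v v0 vH] := lines _ _ (dual_rep sH rrho) n0.
have [r1 rI rM] := rrho.
pose L := v^T; have L0 : L != 0 by rewrite -[0]trmx0 (inj_eq trmx_inj).
have LH g : H g -> exists c, rho g *m L = c *: L.
  move=> Hg; have [c Ec] := vH _ (subgroupV sH Hg); exists c.
  by move: Ec => /(congr1 trmx); rewrite trmx_mul invgK trmxK linearZ.
pose U := row_base (kermx L).
have UL : U *m L = 0 by apply/eqP; rewrite -sub_kermx eq_row_base.
have rU : (\rank (kermx L) < n)%N.
  by rewrite mxrank_ker ltn_subrL n0 andbT lt0n mxrank_eq0.
have stU g : H g -> (U *m rho g <= U)%MS.
  move=> Hg; rewrite eq_row_base sub_kermx -mulmxA; have [c ->] := LH g Hg.
  by rewrite -scalemxAr UL scaler0.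
have [alpha [ralpha aU]] := restrict_rep sH rrho (row_base_free _) stU.
have [m Em] := IHl _ (leq_trans rU lenl) _ ralpha.
set N := iter m _ H in Em.
have sN : subgroup N by apply: iter_derived_subgroup.
have NH : N `<=` H by apply: iter_derived_sub.
have NU g : N g -> U *m rho g = U.
  by move=> Ng; rewrite -aU ?Em ?mul1mx //; apply: NH.
have DL g : derived N g -> rho g *m L = L.
  have sK : subgroup [set g | H g /\ rho g *m L = L].
    split; first by split; [case: sH|rewrite rI mul1mx].
    move=> x y [Hx Lx] [Hy Ly]; have HVy := subgroupV sH Hy; split.
      exact: (subgroupM sH).
    have EV : rho (y^-1)%g *m L = L.
      by rewrite -{1}Ly mulmxA (rep_mulVg sH rrho) // mul1mx.
    by rewrite rM // -mulmxA EV.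
  have DK := @derived_min _ _ N _ sK; move/DK => [] // x y /NH Hx /NH Hy.
  split; first exact: (subgroupR sH).
  have [cx Ex] := LH x Hx; have [cy Ey] := LH y Hy.
  have -> : rho [~ x, y]%g *m L = rho ((y * x)^-1)%g *m (rho (y * x)%g *m L).
    rewrite (rep_commutator sH rrho) // -mulmxA; congr (_ *m _).
    rewrite !rM // -!mulmxA Ey Ex -!scalemxAr Ex Ey !scalerA mulrC.
    by [].
  by rewrite mulmxA (rep_mulVg sH rrho) ?mul1mx //; apply: (subgroupM sH).
exists m.+2 => g; rewrite !iterS -/N.
have sN1 := derived_subgroup N.
have N1N := derived_sub sN.
have sK : subgroup [set g | H g /\ rho g = 1%:M].
  split; first by split; [case: sH|rewrite rI].
  move=> x y [Hx Ex] [Hy Ey]; have HVy := subgroupV sH Hy; split.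
    exact: (subgroupM sH).
  by rewrite rM // Ex mul1mx -[LHS]mulmx1 -Ey (rep_mulVg sH rrho).
have DK := @derived_min _ _ (derived N) _ sK; move/DK => [] // x y Dx Dy.
have Hx := NH _ (N1N _ Dx); have Hy := NH _ (N1N _ Dy).
split; first exact: (subgroupR sH).
have nil u v' : derived N u -> derived N v' -> (rho u - 1%:M) *m (rho v' -
  1%:M) = 0.
  move=> Du Dv.
  have /submxP[X ->] : (rho u - 1%:M <= U)%MS.
    by rewrite eq_row_base sub_kermx mulmxBl mul1mx DL // subrr.
  by rewrite -mulmxA mulmxBr mulmx1 NU ?subrr ?mulmx0 //; apply: N1N.
have : rho x *m rho y = rho y *m rho x.
  have E A B : A *m B = (A - 1%:M) *m (B - 1%:M) + A + B - 1%:M :> 'M[k]_n.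
    rewrite mulmxBl !mulmxBr !mul1mx !mulmx1 opprB.
    by rewrite [_ + A]addrAC subrK -[_ + B]addrA subrK addrK.
  by rewrite E [RHS]E !nil // !add0r [rho x + _]addrC.
move=> E; rewrite (rep_commutator sH rrho) // rM // E -rM //.
by rewrite (rep_mulVg sH rrho) //; apply: (subgroupM sH).
Qed.

(** On [H], each generator of the algebra of regular functions is a coefficient of a
    finite-dimensional representation. One iterated derived subgroup is trivial in all of these, so
    every regular function takes there its value at 1; regular functions separate the points of
    [G]. *)
Theorem lines_solvable H : subgroup H ->
  (forall n (rho : G -> 'M[k]_n), is_rep H rho -> (0 < n)%N ->
    exists2 v, v != 0 & fixes_line H rho v) ->
  solvable_subgroup H.
Proof.
move=> sH lines; split=> //; have [xs rxs fg] := regular_finitely_generated G.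
have iterD m l : iter (l + m) (@derived k G) H `<=` iter m (@derived k G) H.
  by rewrite iterD; apply: iter_derived_sub; apply: iter_derived_subgroup.
have [M EM] : exists M, forall f, f \in xs ->
    forall g, iter M (@derived k G) H g -> f g = f 1%g.
  elim: xs rxs {fg} => [|f r IHr] rr; first by exists 0%N.
  have [M EM] := IHr (fun f' fr => rr f' (mem_behead (s := f :: r) fr)).
  have [n [w [sigma [_ rs wM [v Ef] _]]]] := local_finiteness sH (rr f
    (mem_head _ _)).
  have [m Em] := triangular_derived sH lines rs.
  exists (M + m)%N => f'; rewrite in_cons => /orP[/eqP->|fr] g Dg; last first.
    by apply: EM => //; apply: (iterD M m); rewrite addnC.
  have Dm := iterD _ _ _ Dg; have [H1 _] := sH.
  have Hg : H g by apply: (iter_derived_sub sH) Dg.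
  by rewrite !Ef // -[g]mul1g wM // Em // mulmx1.
exists M; apply/seteqP; split=> [g Dg|_ ->]; last first.
  by have [] := iter_derived_subgroup M sH.
have [_ _ pts] := @regular_variety k G.
have E f : regular G f -> f g = f 1%g.
  apply: (fg [set f | f g = f 1%g]); last by move=> f' /EM; apply.
  by split=> [|f1 f2 E1 E2|f1 f2 E1 E2] //=; rewrite /= E1 E2.
have [//|x [_ xU]] := pts (fun f => f 1%g).
by rewrite /= -(xU g) ?(xU 1%g) // => f /E.
Qed.

End LocalFiniteness.

(** * Coordinate rings and specialisation *)

Section CoordinateRing.
Variables (k : closedFieldType) (G : algGroupType k) (S : set G).
Variables (x0 : G) (Sx0 : S x0).
Hypothesis irrS : irreducible (regular G) S.

Let T : pointedType := HB.pack {x : G | `[< S x >]}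
  (isPointed.Build {x : G | `[< S x >]} (exist _ x0 (introT (asboolP _) Sx0))).

Definition is_restriction (f : T -> k) : bool :=
  `[< exists2 f0, regular G f0 & forall x : T, f x = f0 (val x) >].

Fact is_restriction_subring : subring_closed is_restriction.
Proof.
split=> [|f g /asboolP[f0 rf E] /asboolP[g0 rg E']|f g /asboolP[f0 rf E]
  /asboolP[g0 rg E']];
  apply/asboolP.
- by exists (cst 1); [apply: regular_cst|].
- exists (fun x => f0 x - g0 x); first exact: (regularD rf (regularN rg)).
  by move=> x; rewrite -E -E'.
- exists (fun x => f0 x * g0 x); first exact: (regularM rf rg).
  by move=> x; rewrite -E -E'.
Qed.

HB.instance Definition _ := GRing.isSubringClosed.Build (T -> k) is_restriction
  is_restriction_subring.

Definition coord_ring : Type := {f : T -> k | is_restriction f}.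

HB.instance Definition _ := SubType.on coord_ring.
HB.instance Definition _ := [Choice of coord_ring by <:].
HB.instance Definition _ := [SubChoice_isSubComNzRing of coord_ring by <:].

(** The structure of integral domain carries a partial inverse, here chosen classically. *)
Definition coord_unit (r : coord_ring) : bool := `[< exists s, s * r = 1 >].

Definition coord_inv (r : coord_ring) : coord_ring :=
  if pselect (exists s, s * r = 1) is left e then projT1 (cid e) else r.

Fact coord_mulVr : {in coord_unit, left_inverse 1 coord_inv *%R}.
Proof.
move=> r /asboolP ex; rewrite /coord_inv; case: pselect => // e.
by case: (cid e).
Qed.

Fact coord_unitPl r s : s * r = 1 -> coord_unit r.
Proof. by move=> E; apply/asboolP; exists s. Qed.

Fact coord_inv_out : {in [predC coord_unit], coord_inv =1 id}.
Proof.
by move=> r /asboolPn nex; rewrite /coord_inv; case: pselect.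
Qed.

HB.instance Definition _ := GRing.ComNzRing_hasMulInverse.Build coord_ring
  coord_mulVr coord_unitPl coord_inv_out.

Lemma coord_ringE (r : coord_ring) :
  exists2 f, regular G f & forall x : T, val r x = f (val x).
Proof. by apply/asboolP; apply: (valP r). Qed.

Fact coord_integral : GRing.integral_domain_axiom coord_ring.
Proof.
move=> r s rs0; have [f rf Ef] := coord_ringE r;
  have [g rg Eg] := coord_ringE s.
have fg z : S z -> f z * g z = 0.
  move=> Sz; pose z' : T := exist _ z (introT (asboolP _) Sz).
  by rewrite -(Ef z') -(Eg z') -[LHS]/(val (r * s) z') rs0.
have zeroP (t : coord_ring) h : (forall x : T, val t x = h (val x)) ->
    (forall z, S z -> h z = 0) -> t == 0.
  move=> Et h0; apply/eqP/val_inj/funext => x; rewrite Et h0 //.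
  by apply/asboolP; apply: (valP x).
by have [f0|g0] := irrS rf rg fg;
  [rewrite (zeroP r f)|rewrite (zeroP s g) ?orbT].
Qed.

Definition restriction (f : G -> k) : coord_ring :=
  insubd 0 (fun x : T => f (val x)).

Lemma restrictionE f : regular G f -> forall x : T,
  val (restriction f) x = f (val x).
Proof. by move=> rf x; rewrite insubdK //; apply/asboolP; exists f. Qed.

End CoordinateRing.

(** [res] is the restriction k[G] -> k[S], a surjective morphism whose kernel is the ideal of [S].
    It is a plain function specified only on regular functions, since these form a set and not a
    ring type. *)
Definition is_coord_ring (k : closedFieldType) (G : algGroupType k) (S : set G)
    (R : idomainType) (c : {rmorphism k -> R}) (res : (G -> k) -> R) : Prop :=
  [/\ forall a, res (cst a) = c a,
      forall f g, regular G f -> regular G g -> res (fun x => f x + g x) = res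
        f + res g,
      forall f g, regular G f -> regular G g -> res (fun x => f x * g x) = res
        f * res g,
      forall f, regular G f -> res f = 0 <-> forall x, S x -> f x = 0 &
      forall r, exists2 f, regular G f & r = res f].

Theorem coord_ring_exists (k : closedFieldType) (G : algGroupType k) (S : set G)
    (x0 : G) : S x0 -> irreducible (regular G) S ->
  exists (R : idomainType) (c : {rmorphism k -> R}) (res : (G -> k) -> R),
    is_coord_ring S c res.
Proof.
move=> Sx0 irrS; pose R : idomainType := HB.pack (coord_ring Sx0)
  (GRing.ComUnitRing_isIntegral.Build (coord_ring Sx0) (coord_integral irrS)).
pose res : (G -> k) -> R := @restriction k G S x0 Sx0.
have ext (r s : R) : (forall x, val r x = val s x) -> r = s.
  by move=> E; apply/val_inj/funext.
have resE f : regular G f -> forall x, val (res f) x = f (val x).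
  exact: restrictionE.
have resD f g : regular G f -> regular G g -> res (fun x => f x + g x) = res f
  + res g.
  move=> rf rg; apply: ext => x; rewrite resE; last exact: regularD.
  by rewrite -[RHS]/(val (res f) x + val (res g) x) !resE.
have resM f g : regular G f -> regular G g -> res (fun x => f x * g x) = res f
  * res g.
  move=> rf rg; apply: ext => x; rewrite resE; last exact: regularM.
  by rewrite -[RHS]/(val (res f) x * val (res g) x) !resE.
have c_zmod : zmod_morphism (fun a => res (cst a)).
  move=> a b; apply: ext => x; rewrite resE; last exact: regular_cst.
  by rewrite -[RHS]/(val (res (cst a)) x - val (res (cst b)) x) !resE //;
    apply: regular_cst.
have c_monoid : monoid_morphism (fun a => res (cst a)).
  split=> [|a b]; apply: ext => x; rewrite resE; do ?exact: regular_cst.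
    by [].
  by rewrite -[RHS]/(val (res (cst a)) x * val (res (cst b)) x) !resE //;
    apply: regular_cst.
pose c : {rmorphism k -> R} := HB.pack (fun a => res (cst a))
  (GRing.isZmodMorphism.Build k R _ c_zmod) (GRing.isMonoidMorphism.Build k R _
    c_monoid).
exists R, c, res; split=> // [f rf|r].
  split=> [f0 x Sx|f0].
    by rewrite -(resE f rf (exist _ x (introT (asboolP _) Sx))) f0.
  apply: ext => x; rewrite resE // f0 //.
  by apply/asboolP; apply: (valP x).
by have [f rf Ef] := coord_ringE r; exists f => //; apply: ext => x;
  rewrite resE.
Qed.

(** * Places of a field containing k *)

Section FieldOfFunctions.
Variables (k : closedFieldType) (K : fieldType) (c : {rmorphism k -> K}).

Lemma uniq_scalars n : exists2 s : seq k, uniq s & size s = n.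
Proof.
elim: n => [|n [s us ss]]; first by exists [::].
have /closed_nonrootP[a] : \prod_(z <- s) ('X - z%:P) != 0 by rewrite
  monic_neq0 ?monic_prod_XsubC.
by rewrite root_prod_XsubC => sa; exists (a :: s); rewrite /= ?sa ?us ?ss.
Qed.

Lemma many_roots (Q : {poly K}) : (forall a, Q.[c a] = 0) -> Q = 0.
Proof.
move=> Qa; apply/eqP/negPn/negP => Q0; have [s us ss] := uniq_scalars (size Q).
have aQ : all (root Q) (map c s) by apply/allP => _ /mapP[a _ ->]; apply/rootP.
have := max_poly_roots Q0 aQ; rewrite size_map ss ltnn map_inj_uniq //.
  by move/(_ us).
exact: fmorph_inj.
Qed.

Lemma algebraic_constant (p : {poly k}) u :
  p != 0 -> (map_poly c p).[u] = 0 -> exists a, u = c a.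
Proof.
move=> p0 pu; have [r Er] := closed_field_poly_normal p.
move: pu; rewrite Er map_polyZ rmorph_prod /= hornerZ => /eqP.
rewrite mulf_eq0 fmorph_eq0 lead_coef_eq0 (negPf p0) /=.
elim: r {Er} => [|a r IHr]; first by rewrite big_nil hornerC oner_eq0.
rewrite big_cons hornerM mulf_eq0 => /orP[|//].
by rewrite map_polyXsubC hornerXsubC subr_eq0 => /eqP; exists a.
Qed.

(** A nonconstant [u] is transcendental over the algebraically closed field [k]; so its inverse may
    be sent to 0 on the algebra it generates, and this morphism extends to a place where [u] has a
    pole. *)
Lemma place_at_infinity u : (forall a, u <> c a) ->
  exists Gr, [/\ hom_graph c Gr, Gr (u^-1, 0) &
    forall x, (exists xi, Gr (x, xi)) \/ Gr (x^-1, 0)].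
Proof.
move=> ntriv; pose Gr0 := adjoin (range (diag c)) (u^-1, 0).
have sr : subalg (diag c) (range (diag c)) := range_subalg (diag c).
have [|Gr [sub hGr place]] := @place_extension _ _ c Gr0.
  split; first exact: (adjoin_subalg sr).
  move=> [Q cQ E]; pose p := map_poly snd Q.
  have Ep : map_poly fst Q = map_poly c p.
    by apply/polyP => i; rewrite !coef_map; have [a _ <-] := cQ i.
  have p0 : p != 0.
    apply/eqP => p0; have := horner_snd Q u^-1 0.
    by rewrite -E -/p p0 horner0 => /eqP; rewrite oner_eq0.
  have [|a Ea] := @algebraic_constant p u^-1 p0.
    by rewrite -Ep -(horner_fst _ _ 0) -E.
  by apply: (ntriv a^-1); rewrite fmorphV -Ea invrK.
by exists Gr; split=> //; apply: sub; apply: (adjoin_gen sr).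
Qed.

Variable Gr : set (K * k).
Hypothesis hGr : hom_graph c Gr.
Hypothesis place : forall x, (exists xi, Gr (x, xi)) \/ Gr (x^-1, 0).

Let sGr : subalg (diag c) Gr := proj1 hGr.

(* Dividing by a coordinate of minimal valuation. *)
Lemma place_scale n (x : 'I_n -> K) : (exists i, x i != 0) ->
  exists (j : 'I_n) (t : 'I_n -> k),
    [/\ x j != 0, t j = 1 & forall i, Gr (x i / x j, t i)].
Proof.
move=> [i0 xi0].
have : exists2 j, x j != 0 & forall i, i \in enum 'I_n -> exists xi,
  Gr (x i / x j, xi).
  have : has (fun i => x i != 0) (enum 'I_n).
    by apply/hasP; exists i0; rewrite ?mem_enum.
  elim: (enum _) => // i r IHr /=.
  have [r0|r0] := boolP (has (fun i => x i != 0) r).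
    move=> _; have [j xj jP] := IHr r0.
    have [[xi Gxi]|Gi] := place (x i / x j).
      exists j => // l; rewrite in_cons => /orP[/eqP->|/jP//].
      by exists xi.
    have [xi0'|xi0'] := eqVneq (x i) 0.
      exists j => // l; rewrite in_cons => /orP[/eqP->|/jP//].
      by exists 0; rewrite xi0' mul0r; apply: (subalg0 sGr).
    exists i => // l; rewrite in_cons => /orP[/eqP->|/jP[xi Gl]].
      by exists 1; rewrite divff //; apply: (subalg1 sGr).
    exists (xi * 0); have := subalgM sGr Gl Gi.
    by rewrite pairM invf_div mulrA divfK.
  rewrite orbF => xi; move: r0; rewrite -all_predC => /allP r0.
  exists i => // l; rewrite in_cons => /orP[/eqP->|lr].
    by exists 1; rewrite divff //; apply: (subalg1 sGr).
  have /negPn/eqP-> := r0 l lr.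
  by exists 0; rewrite mul0r; apply: (subalg0 sGr).
move=> [j xj jP].
have [t tP] := choice (fun i => jP i (mem_enum _ i)).
exists j, t; split=> //; apply: (hom_graph_inj hGr (tP j)).
by rewrite divff //; apply: (subalg1 sGr).
Qed.

(* The relation is a polynomial in the scalar, with infinitely many roots. *)
Lemma scalar_extension n (x : 'I_n -> K) d (e : 'I_d -> pexp k n) (z : 'I_d ->
  K) :
  (forall a, \sum_(m < d) peval c (fun i => c a * x i) (e m) * z m = 0) ->
  forall b, \sum_(m < d) peval c (fun i => b * x i) (e m) * z m = 0.
Proof.
move=> F0 b.
pose Q := \sum_(m < d) peval (polyC \o c) (fun i => 'X * (x i)%:P) (e m) * (z
  m)%:P.
have QE u : Q.[u] = \sum_(m < d) peval c (fun i => u * x i) (e m) * z m.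
  rewrite horner_sum; apply: eq_bigr => m _; rewrite hornerM hornerC;
    congr (_ * _).
  rewrite -[LHS]/(horner_eval u (peval _ _ _)) (peval_rmorph (horner_eval u)).
  rewrite (_ : horner_eval u \o (polyC \o c) = c); last first.
    by apply/funext => a; rewrite /= /horner_eval hornerC.
  by apply: eq_peval => i; rewrite /= /horner_eval hornerM hornerX hornerC.
have Q0 : Q = 0 by apply: many_roots => a; rewrite QE.
by rewrite -QE Q0 horner0.
Qed.

(** Vanishing on all multiples allows the scalar [c a] to be replaced by [c a / x j], after which
    all coordinates have residues and the relation can be reduced. *)
Lemma place_cone n (x : 'I_n -> K) (t : 'I_n -> k) (j : 'I_n) (F : pexp k n) :
  x j != 0 -> (forall i, Gr (x i / x j, t i)) ->
  (forall a, peval c (fun i => c a * x i) F = 0) ->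
  forall a, peval id (fun i => a * t i) F = 0.
Proof.
move=> xj Gt F0 a; apply: (hom_graph0 hGr).
have := @scalar_extension _ x 1 (fun=> F) (fun=> 1) _ (c a / x j).
rewrite big_ord1 mulr1 => E; rewrite -[X in Gr (X, _)]E => [|b]; last first.
  by rewrite big_ord1 mulr1.
rewrite (eq_peval c (y := fun i => c a * (x i / x j))); last first.
  by move=> i; rewrite mulrA mulrAC.
apply: hom_graph_peval => // i.
exact: (subalgM sGr (subalgC sGr a) (Gt i)).
Qed.

(* Only the leading term survives in the residue of the relation, since
   w / eta is finite and eta is infinite. *)
Lemma place_relation n (x : 'I_n -> K) (s : 'I_n -> k) (w xi eta : K) (t : k) d
    (e : 'I_d.+1 -> pexp k n) :
  eta != 0 -> (forall i, Gr (x i / xi, s i)) -> Gr (w / eta, t) -> Gr (eta^-1,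
    0) ->
  (forall a, \sum_(m < d.+1) peval c (fun i => c a * x i) (e m) * w ^+ m = 0) ->
  forall a, peval id (fun i => a * s i) (e ord_max) * t ^+ d = 0.
Proof.
move=> eta0 Gx Gw Geta rel a.
have := scalar_extension rel (c a / xi).
move/(congr1 (fun z => z * (eta^-1) ^+ d)); rewrite mul0r mulr_suml => E.
have GX (u : K) v m : Gr (u, v) -> Gr (u ^+ m, v ^+ m).
  move=> Guv; elim: m => [|m IHm]; first by rewrite !expr0;
    apply: (subalg1 sGr).
  by rewrite !exprS; apply: (subalgM sGr Guv IHm).
have Gterm (m : 'I_d.+1) :
    Gr (peval c (fun i => c a / xi * x i) (e m) * w ^+ m * eta^-1 ^+ d,
        peval id (fun i => a * s i) (e m) * t ^+ m * 0 ^+ (d - m)).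
  have lem : (m <= d)%N by rewrite -ltnS.
  have -> : eta^-1 ^+ d = eta^-1 ^+ m * eta^-1 ^+ (d - m) by rewrite -exprD
    subnKC.
  rewrite mulrA -[_ * w ^+ m * _]mulrA -exprMn.
  apply: (subalgM sGr (x := (_, _)) (y := (_, _))); last exact: GX.
  apply: (subalgM sGr (x := (_, _)) (y := (_, _))); last exact: GX.
  rewrite (eq_peval c (y := fun i => c a * (x i / xi))); last first.
    by move=> i; rewrite mulrA mulrAC.
  apply: hom_graph_peval => // i.
  exact: (subalgM sGr (subalgC sGr a) (Gx i)).
have := hom_graph_sum hGr (index_enum _) Gterm; rewrite E => /(hom_graph0 hGr).
rewrite big_ord_recr /= subnn expr0 mulr1 big1 ?add0r // => i _.
by rewrite expr0n subn_eq0 leqNgt ltn_ord mulr0.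
Qed.

End FieldOfFunctions.

(** * The generic point of S and its residues *)

Section GenericPoint.
Variables (k : closedFieldType) (G : algGroupType k) (S : set G).
Variables (R : idomainType) (c : {rmorphism k -> R}) (res : (G -> k) -> R).
Hypothesis cR : is_coord_ring S c res.

Lemma res_inj f g : regular G f -> regular G g -> res f = res g ->
  forall x, S x -> f x = g x.
Proof.
have [_ rD _ r0 _] := cR.
move=> rf rg fg x Sx; have rh := regularD rf (regularN rg).
suff : res (fun x => f x - g x) = 0.
  by move/(proj1 (r0 _ rh)) => /(_ x Sx)/eqP; rewrite subr_eq0 => /eqP.
apply: (@addIr _ (res g)); rewrite add0r -[RHS]fg -rD //; congr res.
by apply/funext => z; rewrite subrK.
Qed.

Lemma res_ext f g : regular G f -> regular G g -> (forall x,
  S x -> f x = g x) ->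
  res f = res g.
Proof.
have [_ rD _ r0 _] := cR.
move=> rf rg fg; have rh := regularD rf (regularN rg).
have h0 : res (fun x => f x - g x) = 0.
  by apply/r0 => // x /fg ->; rewrite subrr.
rewrite -[RHS]add0r -h0 -rD //; congr res.
by apply/funext => z; rewrite subrK.
Qed.

Lemma res_sum (I : Type) (r : seq I) (F : I -> G -> k) :
  (forall i, regular G (F i)) ->
  res (fun x => \sum_(i <- r) F i x) = \sum_(i <- r) res (F i).
Proof.
have [rC rD _ _ _] := cR.
move=> rF; elim: r => [|i r IHr].
  rewrite big_nil -(rmorph0 c) -rC; congr res.
  by apply/funext => x; rewrite big_nil.
rewrite big_cons -IHr -rD //; last exact: regular_sum.
by congr res; apply/funext => x; rewrite big_cons.
Qed.

Lemma regular_peval n (y : 'I_n -> G -> k) e : (forall i, regular G (y i)) ->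
  regular G (fun g => peval id (y^~ g) e) /\
  res (fun g => peval id (y^~ g) e) = peval c (fun i => res (y i)) e.
Proof.
have [rC rD rM _ _] := cR.
move=> ry; elim: e => [a|i|e1 [r1 E1] e2 [r2 E2]|e1 [r1 E1] e2 [r2 E2]] /=.
- by split; [apply: regular_cst|apply: rC].
- by split.
- by split; [apply: regularD|rewrite rD // E1 E2].
- by split; [apply: regularM|rewrite rM // E1 E2].
Qed.

Let K : fieldType := {fraction R}.
Let iota : {rmorphism R -> K} := @tofrac R.
Let cK : {rmorphism k -> K} := iota \o c.

Lemma cone_relation n (y : 'I_n -> G -> k) F : (forall i, regular G (y i)) ->
  (forall a g, S g -> peval id (fun i => a * y i g) F = 0) ->
  forall a, peval cK (fun i => cK a * iota (res (y i))) F = 0.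
Proof.
have [rC _ rM r0 _] := cR.
move=> ry F0 a; pose y' i g := cst a g * y i g.
have ry' i : regular G (y' i) by apply: regularM => //; apply: regular_cst.
have [rF EF] := regular_peval F ry'.
have : res (fun g => peval id (y'^~ g) F) = 0 by apply/r0 => // g; apply: F0.
rewrite EF => /(congr1 iota); rewrite rmorph0 peval_rmorph => <-.
apply: eq_peval => i /=; rewrite -rmorphM -rC -rM //; exact: regular_cst.
Qed.

(** The normalisation at [j] keeps the residue away from 0; the equations of the closed cone hold at
    the generic point, hence at its residue. *)
Lemma generic_specialisation n (y : 'I_n -> G -> k) (Z : set 'rV[k]_n) Gr :
  hom_graph cK Gr -> (forall x, (exists xi, Gr (x, xi)) \/ Gr (x^-1, 0)) ->
  (forall i, regular G (y i)) -> (exists2 g, S g & exists i, y i g != 0) ->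
  zclosed (@polyfun k n) Z -> (forall a g, S g -> Z (a *: \row_i y i g)) ->
  exists (j : 'I_n) (t : 'rV[k]_n),
    [/\ iota (res (y j)) != 0, t 0 j = 1, Z t &
        forall i, Gr (iota (res (y i)) / iota (res (y j)), t 0 i)].
Proof.
have [_ _ _ r0 _] := cR.
move=> hGr place ry [g Sg [i yi]] cZ Zy.
have xi : iota (res (y i)) != 0.
  by rewrite tofrac_eq0; apply: contra_neq yi => /r0; apply.
have [|j [t [xj tj Gt]]] := place_scale hGr place (x := fun i => iota (res (y
  i))).
  by exists i.
exists j, (\row_i t i); split=> //; [by rewrite mxE| |by move=> l; rewrite mxE].
apply: cZ => f [e fe] Zf; rewrite fe.
have := place_cone hGr xj Gt (F := e) _ 1.
rewrite (eq_peval _ (y := (\row_i t i) 0)); last by move=> l; rewrite mxE mul1r.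
apply; apply: cone_relation => // a h Sh.
have := Zf _ (Zy a h Sh); rewrite fe => <-.
by apply: eq_peval => l; rewrite !mxE.
Qed.

Lemma linear_residue n (y : 'I_n -> G -> k) (a : 'I_n -> k) (h : G -> k) Gr
    (xi : K) (t : 'I_n -> k) :
  hom_graph cK Gr -> (forall i, regular G (y i)) -> regular G h ->
  (forall g, S g -> h g = \sum_i y i g * a i) ->
  (forall i, Gr (iota (res (y i)) / xi, t i)) ->
  Gr (iota (res h) / xi, \sum_i t i * a i).
Proof.
have [rC _ rM _ _] := cR.
move=> hGr ry rh hE Gt; have [sGr _] := hGr.
have ra i : regular G (fun g => y i g * cst (a i) g).
  by apply: regularM => //; apply: regular_cst.
have -> : res h = \sum_i res (y i) * c (a i).
  rewrite (res_ext rh (regular_sum _ (fun i _ => ra i)) hE) res_sum //.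
  by apply: eq_bigr => i _; rewrite rM ?rC //; apply: regular_cst.
rewrite rmorph_sum mulr_suml; apply: (hom_graph_sum hGr) => i.
by rewrite rmorphM mulrAC; exact: (subalgM sGr (Gt i) (subalgC sGr (a i))).
Qed.

End GenericPoint.

(** * Borel's fixed point theorem *)

Section FixedPoint.
Variables (k : closedFieldType) (G : algGroupType k).
Implicit Types (H : set G) (x y g h : G).

Definition stable_cone H n (rho : G -> 'M[k]_n) (Z : set 'rV[k]_n) : Prop :=
  [/\ zclosed (@polyfun k n) Z, forall a z, Z z -> Z (a *: z)
    & forall h z, H h -> Z z -> Z (z *m rho h)].

(* If Z does not meet the stable hyperplane L = 0
   away from 0, then the coordinates of z h divided by L (z h) have no poles,
   so they are constant. *)
Theorem fixed_point H n (rho : G -> 'M[k]_n) (Z : set 'rV[k]_n) :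
  solvable_subgroup H -> irreducible (regular G) H -> is_rep H rho ->
  stable_cone H rho Z -> (exists2 z, Z z & z != 0) ->
  exists z, [/\ Z z, z != 0 & fixes_line H rho z].
Proof.
move=> [sH solH] irrH; have [l] := ubnP n; elim: l n rho Z => // l IHl n rho Z.
rewrite ltnS => lenl rrho [cZ Zscale Zstab] [z0 Zz0 z00].
have n0 : (0 < n)%N.
  by rewrite lt0n; apply: contra_neq z00 => n0; subst n; apply/rowP => -[].
have [v v0 vH] := lie_kolchin sH irrH solH (dual_rep sH rrho) n0.
have [r1 rI rM] := rrho; have [H1 _] := sH.
pose L := v^T; have L0 : L != 0 by rewrite -[0]trmx0 (inj_eq trmx_inj).
have LH g : H g -> exists c, rho g *m L = c *: L.
  move=> Hg; have [c Ec] := vH _ (subgroupV sH Hg); exists c.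
  by move: Ec => /(congr1 trmx); rewrite trmx_mul invgK trmxK linearZ.
(* If [Z] meets the hyperplane away from 0, the dimension drops; otherwise every nonzero point of
   [Z] spans a stable line. *)
have [[z [Zz nz zL]]|nker] := pselect (exists z, [/\ Z z, z != 0 & z *m L = 0]).
  pose U := row_base (kermx L).
  have UL : U *m L = 0 by apply/eqP; rewrite -sub_kermx eq_row_base.
  have rU : (\rank (kermx L) < n)%N.
    by rewrite mxrank_ker ltn_subrL n0 andbT lt0n mxrank_eq0.
  have stU g : H g -> (U *m rho g <= U)%MS.
    move=> Hg; rewrite eq_row_base sub_kermx -mulmxA; have [c ->] := LH g Hg.
    by rewrite -scalemxAr UL scaler0.
  have [alpha [ralpha aU]] := restrict_rep sH rrho (row_base_free _) stU.
  have /submxP[u Eu] : (z <= U)%MS by rewrite eq_row_base sub_kermx zL.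
  have [||z' [Zz' nz' fz']] := IHl _ alpha [set u | Z (u *m U)] (leq_trans rU
    lenl) ralpha.
  - split=> [u' u'P|a u' Zu|h u' Hh Zu] /=.
    + apply: cZ => f pf Zf; apply: (u'P _ (polyfun_mulmx U pf)) => w.
      exact: Zf.
    + by rewrite -scalemxAl; apply: Zscale.
    + by rewrite -mulmxA aU // mulmxA; apply: Zstab.
  - by exists u; [rewrite /= -Eu|apply: contra_neq nz => u0;
      rewrite Eu u0 mul0mx].
  exists (z' *m U); split=> //.
    apply: contra_neq nz' => z'U;
      apply: (row_free_inj (row_base_free (kermx L))).
    by rewrite z'U mul0mx.
  by move=> h Hh; have [c Ec] := fz' h Hh; exists c;
    rewrite -mulmxA -aU // mulmxA Ec scalemxAl.
exists z0; split=> //.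
have [R [c [res cR]]] := coord_ring_exists H1 irrH;
  have [rC rD rMul rz _] := cR.
pose y i g := (z0 *m rho g) 0 i.
have ry i : regular G (y i).
  by apply: regular_mulmx => // *; apply: regular_const_mx.
pose lam g := (z0 *m rho g *m L) 0 0.
have rlam : regular G lam.
  apply: (@regular_mulmx _ _ _ _ _ (fun g => z0 *m rho g) (fun=> L)).
    by move=> s j; rewrite ord1; apply: ry.
  by move=> *; apply: regular_const_mx.
have lamN0 g : H g -> lam g != 0.
  move=> Hg; apply/eqP => lg; apply: nker; exists (z0 *m rho g); split.
  - exact: Zstab.
  - exact: (rep_vec_neq0 sH rrho).
  - by apply/matrixP => s j; rewrite !ord1 [LHS]lg mxE.
have [const|nconst] := pselect (forall i, exists a, forall g,
  H g -> y i g = a * lam g).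
  have [a aE] := choice const; move=> h Hh; exists (lam h / lam 1%g).
  apply/rowP => i; rewrite [RHS]mxE -[LHS]/(y i h) aE //.
  have -> : z0 0 i = a i * lam 1%g by rewrite -aE // /y rI mulmx1.
  by rewrite mulrCA divfK ?mulrA 1?mulrC // lamN0.
have [i ni] : exists i, forall a, ~ forall g, H g -> y i g = a * lam g.
  apply: contrapT => ni; apply: nconst => i; apply: contrapT => ni'.
  by apply: ni; exists i => a aE; apply: ni'; exists a.
pose K : fieldType := {fraction R}; pose iota : {rmorphism R -> K} := @tofrac R.
pose cK : {rmorphism k -> K} := iota \o c.
pose xi j := iota (res (y j)); pose xlam := iota (res lam).
have xlam0 : xlam != 0.
  rewrite tofrac_eq0; apply/eqP => /rz lam0.
  by have := lamN0 _ H1; rewrite lam0 ?eqxx.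
(* A nonconstant ratio [xi i / xlam] has a pole at some place; there [L] vanishes at the residue [t]
   of the orbit of [z0], a nonzero point of [Z], against [nker]. *)
have [a Ea|Gr [hGr Gw place]] := @place_at_infinity k K cK (xi i / xlam).
  have E : xi i = cK a * xlam by rewrite -Ea divfK.
  apply: (ni a); apply: (res_inj cR (ry i) (regularM (regular_cst G a) rlam)).
  have : xi i = iota (c a * res lam) by rewrite rmorphM.
  by move/eqP; rewrite tofrac_eq => /eqP->; rewrite -rC -rMul //;
    apply: regular_cst.
have [j [t [xj tj Zt Gt]]] : exists (j : 'I_n) (t : 'rV[k]_n),
    [/\ xi j != 0, t 0 j = 1, Z t & forall i, Gr (xi i / xi j, t 0 i)].
  apply: (generic_specialisation cR) => //.
  - exists 1%g => //; have /rV0Pn[j zj] := z00; exists j.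
    by rewrite /y rI mulmx1.
  - move=> a g Hg; apply: Zscale; rewrite (_ : \row_i0 _ = z0 *m rho g).
      exact: Zstab.
    by apply/rowP => j; rewrite mxE.
case: nker; exists t; split=> //.
  by apply/eqP => /rowP/(_ j); rewrite tj mxE => /eqP; rewrite oner_eq0.
apply/matrixP => s s'; rewrite !ord1 !mxE.
have [sGr _] := hGr.
have G1 : Gr (xlam / xi j, \sum_d t 0 d * L d 0).
  by apply: (linear_residue cR hGr ry rlam) => // g _; rewrite /lam mxE.
have xi0 : xi i != 0.
  rewrite tofrac_eq0; apply/eqP => /rz yi0; apply: (ni 0) => g Hg.
  by rewrite mul0r yi0.
have G2 : Gr (xlam / xi j, 0).
  have := subalgM sGr Gw (Gt i); rewrite pairM mul0r invf_div mulrA divfK //.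
exact: (hom_graph_inj hGr G1 G2).
Qed.

End FixedPoint.

(** * Functions with finitely many values on fibres *)

Section FiniteFibres.
Variables (k : closedFieldType) (G : algGroupType k) (S : set G).
Variables (R : idomainType) (c : {rmorphism k -> R}) (res : (G -> k) -> R).
Hypothesis cR : is_coord_ring S c res.

Lemma evaluation g : S g ->
  exists ev : {rmorphism R -> k}, forall f, regular G f -> ev (res f) = f g.
Proof.
move=> Sg; have [rC rD rM _ surj] := cR.
have [r|F FP] := @choice _ _ (fun r f => regular G f /\ r = res f).
  by have [f rf Er] := surj r; exists f.
pose e r := F r g.
have eE f : regular G f -> e (res f) = f g.
  by move=> rf; have [rF EF] := FP (res f); apply: (res_inj cR rF rf _ Sg).
have eC a : e (c a) = a by rewrite -rC eE //; apply: regular_cst.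
have eD r s : e (r + s) = e r + e s.
  have [r1 E1] := FP r; have [r2 E2] := FP s.
  by rewrite {1}E1 {1}E2 -rD // eE //; apply: regularD.
have e_zmod : zmod_morphism e.
  by move=> r s; apply: (@addIr _ (e s)); rewrite -eD !subrK.
have e_monoid : monoid_morphism e.
  split=> [|r s]; first by rewrite -[1 in LHS](rmorph1 c) eC.
  have [r1 E1] := FP r; have [r2 E2] := FP s.
  by rewrite {1}E1 {1}E2 -rM // eE //; apply: regularM.
pose ev : {rmorphism R -> k} := HB.pack e
  (GRing.isZmodMorphism.Build R k _ e_zmod) (GRing.isMonoidMorphism.Build R k _
    e_monoid).
by exists ev.
Qed.

Lemma coord_ring_eq0 (p : R) : (forall g (ev : {rmorphism R -> k}), S g ->
  (forall f, regular G f -> ev (res f) = f g) -> ev p = 0) -> p = 0.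
Proof.
have [_ _ _ r0 surj] := cR; have [f rf ->] := surj p; move=> p0.
apply/r0 => // g Sg; have [ev evE] := evaluation Sg.
by rewrite -evE //; apply: (p0 g).
Qed.

Hypothesis closedS : zclosed (regular G) S.

Let D : idomainType := {poly R}.
Let cD : {rmorphism k -> D} := (@polyC R : {rmorphism R -> D}) \o c.

Lemma evaluation_poly g s : S g -> exists ev : {rmorphism D -> k},
  [/\ forall a, ev (cD a) = a, ev 'X = s &
      forall f, regular G f -> ev (res f)%:P = f g].
Proof.
move=> Sg; have [ev evE] := evaluation Sg; have [rC _ _ _ _] := cR.
exists (horner_eval s \o map_poly ev : {rmorphism D -> k}).
split=> [a||f rf] /=; rewrite /horner_eval ?map_polyX ?hornerX //.
  by rewrite map_polyC hornerC /= -rC evE //; apply: regular_cst.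
by rewrite map_polyC hornerC /= evE.
Qed.

Lemma evaluation_poly_neq0 (p : D) : p != 0 ->
  exists g s (ev : {rmorphism D -> k}), [/\ S g, forall a, ev (cD a) = a,
    ev 'X = s,
      forall f, regular G f -> ev (res f)%:P = f g & ev p != 0].
Proof.
move=> p0; have [rC _ _ r0 surj] := cR.
have [f rf Ef] := surj (lead_coef p).
have /existsNP[g /not_implyP[Sg fg]] : ~ forall x, S x -> f x = 0.
  by move/(proj2 (r0 _ rf)); rewrite -Ef => /eqP;
    rewrite lead_coef_eq0 (negPf p0).
have [ev evE] := evaluation Sg.
have /closed_nonrootP[s sP] : map_poly ev p != 0.
  apply/eqP => /(congr1 (fun q : {poly k} => q`_(size p).-1)).
  by rewrite coef_map -lead_coefE Ef /= evE // coef0.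
exists g, s, (horner_eval s \o map_poly ev : {rmorphism D -> k}).
split=> // [a||h rh] /=; rewrite /horner_eval ?map_polyX ?hornerX //.
  by rewrite map_polyC hornerC /= -rC evE //; apply: regular_cst.
by rewrite map_polyC hornerC /= evE.
Qed.

(** The morphisms from k[G] to k are the evaluations; the point obtained satisfies the equations of
    the closed set [S], hence belongs to it. *)
Lemma graph_point A Gr : hom_on cD A Gr ->
  (forall f, regular G f -> A (res f)%:P) ->
  exists2 g, S g & forall f, regular G f -> Gr ((res f)%:P, f g).
Proof.
have [rC rD rM r0 _] := cR.
move=> [hGr _ tot] AR; have [sGr _] := hGr.
have [f|phi phiP] := @choice _ _ (fun f t => regular G f -> Gr ((res f)%:P, t)).
  have [rf|] := pselect (regular G f); last by exists 0.
  by have [t Gt] := tot _ (AR f rf); exists t.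
have [|g gP] := @subalgebra_point _ G phi.
  split=> [a|f h rf rh|f h rf rh].
  - apply: (hom_graph_inj hGr (phiP _ (regular_cst G a))); rewrite rC.
    exact: (subalgC sGr a).
  - apply: (hom_graph_inj hGr (phiP _ (regularD rf rh))).
    by rewrite rD // rmorphD; apply: (subalgD sGr (phiP f rf) (phiP h rh)).
  - apply: (hom_graph_inj hGr (phiP _ (regularM rf rh))).
    by rewrite rM // rmorphM; apply: (subalgM sGr (phiP f rf) (phiP h rh)).
exists g; last by move=> f rf; rewrite -gP //; apply: phiP.
apply: closedS => f rf /(r0 _ rf) f0; rewrite -gP //.
by apply: (hom_graph0 hGr); have := phiP f rf; rewrite f0 polyC0.
Qed.

(* The variable 'X scales the homogeneous coordinates y, so that the subalgebra
   of the 'X * y i is graded. *)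
Theorem finite_fibres_algebraic n (y : 'I_n -> G -> k) (w : G -> k) (i0 : 'I_n)
  :
  (forall i, regular G (y i)) -> regular G w -> (exists2 g,
    S g & y i0 g != 0) ->
  (forall g1, S g1 -> exists r : seq k, forall g b, S g -> b != 0 ->
     (forall i, y i g = b * y i g1) -> w g \in r) ->
  exists Q : {poly D}, [/\ polyIn (pevals cD (fun i => 'X * (res (y i))%:P)) Q,
    Q != 0 & Q.[(res w)%:P] = 0].
Proof.
have [rC rD rM r0 surj] := cR.
move=> ry rw [g0 Sg0 yg0] fin.
pose u i : D := 'X * (res (y i))%:P; pose W : D := (res w)%:P.
set A0 := pevals _ _; have sA0 : subalg cD A0 := pevals_subalg cD u.
apply: contrapT => nalg.
have trans Q : polyIn A0 Q -> Q.[W] = 0 -> Q = 0.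
  by move=> AQ QW; apply: contrapT => /eqP Q0; apply: nalg; exists Q.
have [xs rxs fg] := regular_finitely_generated G.
pose Xs : seq D := 'X :: [seq (res f)%:P | f <- xs].
have sA1 := adjoin_subalg sA0 W.
have sA2 := adjoins_subalg Xs sA1.
have A2R f : regular G f -> adjoins (adjoin A0 W) Xs (res f)%:P.
  move=> rf; suff : (regular G f /\ adjoins (adjoin A0 W) Xs (res f)%:P) by
    case.
  apply: (fg [set f | regular G f /\ adjoins (adjoin A0 W) Xs (res f)%:P]) =>
    //.
    split=> [a|f1 f2 [r1 A1] [r2 A2]|f1 f2 [r1 A1] [r2 A2]] /=.
    - by split; [apply: regular_cst|rewrite rC; apply: (subalgC sA2)].
    - by split; [apply: regularD|rewrite rD // rmorphD; apply: (subalgD sA2)].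
    - by split; [apply: regularM|rewrite rM // rmorphM; apply: (subalgM sA2)].
  move=> h hxs /=; split; first exact: rxs.
  apply: (@adjoins_gen k D cD _ Xs _ sA1).
  by rewrite in_cons; apply/orP; right; apply/mapP; exists h.
have A0u i : A0 (u i) by exists (PVar i).
pose b := u i0.
have b0 : b != 0.
  rewrite mulf_neq0 ?polyX_eq0 // polyC_eq0; apply: contra_neq yg0.
  by move/(proj1 (r0 _ (ry i0))); apply.
have A2b : adjoins (adjoin A0 W) Xs b.
  by apply: (adjoins_subset Xs sA1); apply: (adjoin_subset sA0); apply: A0u.
have [a [[r Ar Ea] a0 ext]] := finite_extension sA1 A2b b0.
have rn0 : r != 0 by apply: contra_neq a0 => r_0; rewrite Ea r_0 horner0.
have lb0 : lead_coef r * b != 0 by rewrite mulf_neq0 ?lead_coef_eq0.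
have [g1 [s1 [evD [Sg1 evDc evDX evDf evb]]]] := evaluation_poly_neq0 lb0.
move: evb; rewrite rmorphM mulf_eq0 negb_or => /andP[evr evDb].
have evDu i : evD (u i) = s1 * y i g1 by rewrite rmorphM evDX evDf.
have [s10 y0] : s1 != 0 /\ y i0 g1 != 0.
  by move: evDb; rewrite evDu mulf_eq0 negb_or => /andP[].
(* Evaluation at [g1] and [s1], kept only on [A0]: the products of ['X] with the coordinates are
   prescribed, so an extension may still move the point and the scale. *)
pose Gr0 : set (D * k) := [set e | A0 e.1 /\ e.2 = evD e.1].
have hA0 : hom_on cD A0 Gr0.
  split; last first.
  - by move=> p Ap; exists (evD p).
  - by move=> p t [].
  split; last by case=> _ E; have /eqP := E : 1 = evD 0;
    rewrite rmorph0 oner_eq0.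
  split=> [a1|[p s] [q t] [/= Ap ->] [/= Aq ->]|[p s] [q t] [/= Ap ->] [/= Aq
    ->]].
  - by split; [apply: (subalgC sA0)|apply/esym/evDc].
  - by split; [apply: (subalgD sA0)|apply/esym/(rmorphD evD)].
  - by split; [apply: (subalgM sA0)|apply/esym/(rmorphM evD)].
have [rs rsP] := fin g1 Sg1.
pose rbar := map_poly evD r.
have rbar0 : rbar != 0.
  apply/eqP => /(congr1 (fun p : {poly k} => p`_(size r).-1)).
  by rewrite coef_map -lead_coefE coef0; apply/eqP.
(* As [W] is transcendental over [A0], its image [t] is free. It is chosen off the roots of [rbar],
   so that the morphism extends to an algebra containing k[S], and outside the finite list of values
   allowed on the fibre through [g1]. *)
have : rbar * \prod_(z <- rs) ('X - z%:P) != 0.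
  by rewrite mulf_neq0 // monic_neq0 ?monic_prod_XsubC.
move=> /closed_nonrootP[t];
  rewrite rootM negb_or root_prod_XsubC => /andP[rt trs].
have [hGr0 Gr0A tot0] := hA0; have [sGr0 _] := hGr0.
have hA1 : hom_on cD (adjoin A0 W) (adjoin Gr0 (W, t)).
  apply: hom_on_adjoin => // -[Q GQ E].
  have Q0 : Q = 0.
    apply: (hom_on_polyIn0 hA0 GQ); apply: trans.
      by move=> i; rewrite coef_map; have [] := GQ i.
    by rewrite -(horner_fst _ _ t) -E.
  by move: E => /(congr1 snd)/eqP; rewrite Q0 horner0 /= oner_eq0.
have [P [GP EP sP]] := hom_on_lift hA0 Ar.
have Gra : adjoin Gr0 (W, t) (a, rbar.[t]).
  exists P => //; rewrite [RHS]surjective_pairing horner_fst horner_snd EP Ea.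
  congr (_, _.[_]); apply/polyP => i; rewrite !coef_map.
  by have [_ /= ->] := GP i; rewrite -EP coef_map.
have [Gr [hA2 [sub _]]] := ext _ _ hA1 Gra rt.
have [hGr _ tot2] := hA2; have [sGr _] := hGr.
have [g Sg gP] := graph_point hA2 A2R.
have sub0 : Gr0 `<=` Gr by apply: subset_trans sub; apply: (adjoin_subset sGr0).
have [s' Gs'] := tot2 'X (adjoins_gen sA1 (mem_head _ _)).
have ys i : s' * y i g = s1 * y i g1.
  apply: (hom_graph_inj hGr (x := u i)).
    exact: (subalgM sGr Gs' (gP _ (ry i))).
  by apply: sub0; split; [apply: A0u|apply/esym/evDu].
have s'0 : s' != 0.
  apply/eqP => s'0; have /esym/eqP := ys i0; rewrite s'0 mul0r mulf_eq0.
  by rewrite (negPf s10) (negPf y0).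
have Et : w g = t.
  apply: (hom_graph_inj hGr (gP _ rw)); apply: sub.
  exact: (adjoin_gen sGr0 (W, t)).
case/negP: trs; rewrite -Et; apply: (rsP g (s1 / s')) => //.
  by rewrite mulf_neq0 ?invr_eq0.
by move=> i; rewrite mulrAC -ys mulrAC mulfV ?mul1r.
Qed.

End FiniteFibres.

(** * The Zariski topology *)

Section ZariskiTopology.
Variables (k : closedFieldType) (G : algGroupType k).
Implicit Types (H : set G) (Z : set (zariski G)).

Notation irr := (irreducible (regular G)).
Notation zcl := (zclosed (regular G)).

Lemma closed_zariski Z : closed Z <-> zcl Z.
Proof.
rewrite -openC; split=> [[S SG E]|cZ].
  rewrite -[Z]setCK E; rewrite (_ : ~` _ = [set x | forall f, S f -> f x = 0]).
    exact: zclosed_zeros.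
  apply/seteqP; split=> x /= xP.
    by move=> f Sf; apply: contrapT => /eqP fx; apply: xP; exists f.
  by move=> [f /xP ->]; rewrite eqxx.
exists [set f | regular G f /\ forall z, Z z -> f z = 0]; first by move=> f [].
apply/seteqP; split=> x /=.
  by move=> /(not_zclosed cZ)[f [rf Zf fx]]; exists f.
by move=> [f [rf Zf] fx] /Zf fx0; rewrite fx0 eqxx in fx.
Qed.

Lemma irreducible_connected Z : irr Z -> connected Z.
Proof.
move=> irrZ A [b Ab] [O oO AO] [C cC AC]; apply/seteqP; split;
  first by rewrite AO => x [].
move=> x Zx; apply: contrapT => nAx.
have nCx : ~ C x by move=> Cx; apply: nAx; rewrite AC.
have [f [rf Cf fx]] := not_zclosed (proj1 (closed_zariski C) cC) nCx.
have [Zb Ob] : (Z `&` O) b by rewrite -AO.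
have cO : zcl (~` O) by apply/closed_zariski; apply: open_closedC.
have [g [rg Og gb]] := not_zclosed cO (fun nOb => nOb Ob).
have [z [Zz fz gz]] := irreducible_nonzero irrZ rf rg (ex_intro2 _ _ x Zx fx)
  (ex_intro2 _ _ b Zb gb).
have [Oz|nOz] := pselect (O z); last by rewrite Og ?eqxx in gz.
have : A z by rewrite AO.
by rewrite AC => -[_ /Cf fz0]; rewrite fz0 eqxx in fz.
Qed.

Lemma zclosed_bigcup n (C : 'I_n -> set G) :
  (forall i, zcl (C i)) -> zcl (\bigcup_i C i).
Proof.
move=> cC x xP; apply: contrapT => nCx.
have ex_f i : exists f, [/\ regular G f, forall z, C i z -> f z = 0 & f x != 0].
  by apply: not_zclosed => // Cx; apply: nCx; exists i.
have [f fP] := choice ex_f.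
have rprod (r : seq 'I_n) : regular G (fun z => \prod_(i <- r) f i z).
  elim: r => [|i r IHr].
    by apply: (eq_regular _ (regular_cst G 1)) => z; rewrite big_nil.
  have [rf _ _] := fP i.
  by apply: (eq_regular _ (regularM rf IHr)) => z; rewrite big_cons.
have E : \prod_i f i x = 0.
  apply: (xP _ (rprod (index_enum 'I_n))) => z [i _ Cz]; have [_ Cf _] := fP i.
  by rewrite (bigD1 i) //= Cf // mul0r.
have : \prod_i f i x != 0 by apply/prodf_neq0 => i _; have [_ _] := fP i.
by rewrite E eqxx.
Qed.

(** The identity component has finite index, so its complement in [H] is covered by finitely many
    closed cosets, and it is open as well as closed in [H]. *)
Lemma connected_irreducible H : subgroup H -> zcl H ->
  connected (H : set (zariski G)) -> irr H.
Proof.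
move=> sH cH conH; have [H1 _] := sH.
have [N [sN cN irrN NH [_ [n [c cP]]]]] := identity_component sH cH.
suff <- : N = H by [].
have [N1 _] := sN.
apply: conH; first by exists 1%g.
  (* The coset of [c i] is kept only if it contains a point of [H] outside [N]; otherwise [C i] is
     empty. *)
  pose C i := [set x | (exists x', [/\ H x', ~ N x' & N (x' * (c i)^-1)%g]) /\
    N (x * (c i)^-1)%g].
  have cC i : zcl (C i).
    have [ex|nex] := pselect (exists x', [/\ H x',
      ~ N x' & N (x' * (c i)^-1)%g]).
      move=> x xP; split=> //; apply: cN => f rf Nf.
      have rmul : regmap (fun x => x * (c i)^-1)%g.
        by apply: regmapM; [apply: regmap_id|apply: regmap_cst].
      by apply: (xP _ (rmul f rf)) => z [_ /Nf].
    move=> x xP; have /eqP : cst 1 x = 0 :> k.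
      by apply: (xP _ (regular_cst G 1)) => z [/nex].
    by rewrite oner_eq0.
  exists (~` \bigcup_i C i).
    by rewrite openC; apply/closed_zariski; apply: zclosed_bigcup.
  apply/seteqP; split=> x.
    move=> Nx; split; first exact: NH.
    move=> [i _ [[x' [Hx' nNx' Nx'c]] Nxc]]; apply: nNx'.
    have -> : (x' = x' * (c i)^-1 * (x * (c i)^-1)^-1 * x)%g.
      by rewrite invgM invgK !mulgA !mulgVK.
    apply: (subgroupM sN) => //; apply: (subgroupM sN) => //.
    exact: (subgroupV sN).
  move=> [Hx nC]; apply: contrapT => nNx; apply: nC.
  by have [i Nxc] := cP x Hx; exists i => //; split=> //; exists x.
exists N; first exact/closed_zariski.
by apply/seteqP; split=> [x Nx|x []//]; split=> //; apply: NH.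
Qed.

End ZariskiTopology.

(** * Functions invariant under a Borel subgroup *)

Section Invariants.
Variables (k : closedFieldType) (G : algGroupType k).
Implicit Types (H S : set G) (x y g : G).

Notation irr := (irreducible (regular G)).
Notation zcl := (zclosed (regular G)).

Lemma stabilizer_closed_subgroup S n (rho : G -> 'M[k]_n) (v : 'rV[k]_n) :
  subgroup S -> zcl S -> is_rep S rho -> v != 0 ->
  let T := [set g | S g /\ exists a : k, v *m rho g = a *: v] in
  subgroup T /\ zcl T.
Proof.
move=> sS cS rrho v0 T; have [r1 rI rM] := rrho; split.
  split; first by split; [case: sS|exists 1; rewrite rI mulmx1 scale1r].
  move=> x y [Sx [a Ea]] [Sy [b Eb]]; have SVy := subgroupV sS Sy.
  split; first exact: (subgroupM sS).
  have b0 : b != 0.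
    apply: contra_neq (rep_vec_neq0 sS rrho Sy v0) => b0.
    by rewrite Eb b0 scale0r.
  exists (a / b); rewrite rM // mulmxA Ea -scalemxAl -scalerA; congr (_ *: _).
  apply: (scalerI b0); rewrite scalerA divff // scale1r scalemxAl -Eb.
  by rewrite -mulmxA (rep_mulgV sS rrho) // mulmx1.
have /rV0Pn[j vj] := v0.
(* Proportionality to [v] is the vanishing of the minors against a coordinate [j] where [v] is
   nonzero. *)
pose minor i g := (v *m rho g) 0 i * cst (v 0 j) g - (v *m rho g) 0 j * cst (v
  0 i) g.
have rv i : regular G (fun g => (v *m rho g) 0 i).
  by apply: regular_mulmx => // *; apply: regular_const_mx.
have rminor i : regular G (minor i).
  by apply: regularD; [|apply: regularN]; apply: regularM => //;
    apply: regular_cst.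
rewrite (_ : T = S `&` [set g | forall f, range minor f -> f g = 0]).
  by apply: zclosedI => //; apply: zclosed_zeros => _ [i _ <-].
apply/seteqP; split=> g [Sg].
  move=> [a Ea]; split=> // _ [i _ <-].
  by rewrite /minor Ea !mxE /cst mulrAC subrr.
move=> m0; split=> //; exists ((v *m rho g) 0 j / v 0 j).
apply/rowP => i; have /eqP := m0 _ (ex_intro2 _ _ i I erefl).
rewrite subr_eq0 /cst => /eqP E; rewrite [RHS]mxE mulrAC -E.
by rewrite mulfK.
Qed.

Section Contradiction.
Variables (S B : set G) (f : G -> k).
Hypotheses (sS : subgroup S) (cS : zcl S) (irrS : irr S) (BS : B `<=` S).
Hypotheses (sB : solvable_subgroup B) (irrB : irr B) (nsolS : ~
  solvable_subgroup S).
Hypothesis IH : forall H, subgroup H -> zcl H -> irr H -> B `<=` H ->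
  H `<=` S -> ~ S `<=` H -> forall h, regular G h ->
  (forall b x, B b -> H x -> h (b * x)%g = h x) -> forall x, H x -> h x = h 1%g.
Hypothesis rf : regular G f.
Hypothesis fB : forall b x, B b -> S x -> f (b * x)%g = f x.

Let S1 : S 1%g. Proof. by case: sS. Qed.

Lemma minimal_cone n (rho : G -> 'M[k]_n) : (0 < n)%N -> is_rep S rho ->
  exists Z, [/\ stable_cone S rho Z, exists2 z, Z z & z != 0 &
    forall W, stable_cone S rho W -> W `<=` Z -> (exists2 z,
      W z & z != 0) -> Z `<=` W].
Proof.
move=> n0 rrho.
pose F := [set Z | stable_cone S rho Z /\ exists2 z, Z z & z != 0].
have [||Z [stZ nZ] minZ] := zclosed_minimal (F := F) (0 : 'rV[k]_n)
  (polyfun_finitely_generated k n).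
- by move=> Z [[]].
- exists setT; split; first by split.
  exists (const_mx 1) => //; apply/eqP => /rowP/(_ (Ordinal n0)).
  by rewrite !mxE => /eqP; rewrite oner_eq0.
by exists Z; split=> // W stW WZ nW; apply: minZ.
Qed.

(* The contradiction comes from a place of k(S) where some left translate of f
   has a pole. The homogeneous coordinates y of the orbit of a point z of a
   minimal cone Z, fixed by B, have a residue s, again in Z. The stabilizer of z
   has finite index over a subgroup leaving f invariant, so f is algebraic over
   the field of the ratios of the y i. The leading coefficient of an equation
   of f then vanishes at s, hence on the whole of Z by minimality. *)
Theorem invariant_constant : forall x, S x -> f x = f 1%g.
Proof.
apply: contrapT => /existsNP[x1 /not_implyP[Sx1 fx1]].
have [n [rho [n0 rrho nline]]] : exists n (rho : G -> 'M[k]_n),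
    [/\ (0 < n)%N, is_rep S rho & forall v, v != 0 -> ~ fixes_line S rho v].
  apply: contrapT => nex; apply: nsolS;
    apply: lines_solvable => // n rho rrho n0.
  apply: contrapT => nv; apply: nex; exists n, rho; split=> // v v0 vS.
  by apply: nv; exists v.
have [r1 rI rM] := rrho.
have [Z [stZ nZ minZ]] := minimal_cone n0 rrho; have [cZ Zscale Zstab] := stZ.
have stZB : stable_cone B rho Z by split=> // h z /BS Sh; apply: Zstab.
have [z [Zz z0 zB]] := fixed_point sB irrB (is_repS BS rrho) stZB nZ.
have [] := stabilizer_closed_subgroup sS cS rrho z0.
set T := [set g | _] => sT cT.
have [H [sH cH irrH HT [maxH [N [d dP]]]]] := identity_component sT cT.
have TS : T `<=` S by move=> g [].
have HS : H `<=` S := subset_trans HT TS.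
have BH : B `<=` H.
  by apply: maxH => //; [case: sB => -[]|move=> b Bb; split;
    [apply: BS|apply: zB]].
have nSH : ~ S `<=` H.
  by move=> SH; apply: (nline z z0) => g /SH/HT[].
(* Right translates of [f] keep the left invariance under [B], and [H] is smaller than [S]: the
   induction hypothesis makes them constant on [H]. *)
have fH h x : H h -> S x -> f (h * x)%g = f x.
  move=> Hh Sx; pose f' g := f (g * x)%g.
  have rf' : regular G f'.
    by apply: (regmapM (@regmap_id _ G) (regmap_cst x)).
  rewrite -[RHS](_ : f' 1%g = _); last by rewrite /f' mul1g.
  apply: (IH sH cH irrH BH HS nSH rf') => // b y Bb Hy.
  rewrite /f' -mulgA; apply: fB => //.
  by apply: (subgroupM sS) => //; apply: HS.
have [m [w [sigma [rw rsigma wM [v fv] [l [p [C [Sp wC]]]]]]]] :=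
  local_finiteness sS rf.
have wH h g : H h -> S g -> w (h * g)%g = w g.
  move=> Hh Sg; have Shg : S (h * g)%g by apply: (subgroupM sS) => //;
    apply: HS.
  rewrite !wC //; congr (_ *m _); apply/rowP => i; rewrite !mxE -mulgA;
    apply: fH => //.
  exact: (subgroupM sS).
have [R [c [res cR]]] := coord_ring_exists S1 irrS;
  have [rC rD rMul rz surj] := cR.
pose K : fieldType := {fraction R}; pose iota : {rmorphism R -> K} := @tofrac R.
pose cK : {rmorphism k -> K} := iota \o c.
pose wi i g := w g 0 i; pose om i : K := iota (res (wi i)).
have [i0 om_i0] : exists i, forall a, om i <> cK a.
  apply: contrapT => nex.
  have /choice[a aE] i : exists a, om i = cK a.
    by apply: contrapT => na; apply: nex; exists i => a Ea; apply: na; exists a.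
  apply: fx1; rewrite !fv //; congr ((_ *m _) 0 0); apply/rowP => i.
  have E g : S g -> wi i g = a i.
    move=> Sg; apply: (res_inj cR (rw i) (regular_cst G (a i))) => //.
    by apply/eqP; rewrite rC -tofrac_eq; apply/eqP/aE.
  by rewrite -[LHS]/(wi i x1) E // -(E 1%g).
have [Gr [hGr Gpole place]] := place_at_infinity om_i0.
have [sGr _] := hGr.
have om0 : om i0 != 0 by apply/eqP => om0; apply: (om_i0 0); rewrite rmorph0.
(* [om j] is a coordinate with the worst pole: all ratios to it have residues, and its inverse has
   residue 0. *)
have [|j [t [omj tj Gt]]] := place_scale hGr place (x := om);
  first by exists i0.
have Gomj : Gr ((om j)^-1, 0).
  have := subalgM sGr Gpole (Gt i0).
  by rewrite pairM mul0r mulrA mulVf // mul1r.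
pose y i g := (z *m rho g) 0 i.
have ry i : regular G (y i) by apply: regular_mulmx => // *;
  apply: regular_const_mx.
have zS g : S g -> Z (z *m rho g) by move=> Sg; apply: Zstab.
have [|||j' [s [xj' sj' Zs Gs]]] := generic_specialisation cR hGr place ry (Z
  := Z).
- by exists 1%g => //; have /rV0Pn[i zi] := z0; exists i; rewrite /y rI mulmx1.
- exact: cZ.
- move=> a g Sg; apply: Zscale; rewrite (_ : \row_i _ = z *m rho g);
    first exact: zS.
  by apply/rowP => i; rewrite mxE.
have ynz : exists2 g, S g & y j' g != 0.
  apply: contrapT => ny; move: xj'; rewrite tofrac_eq0 => /eqP; apply.
  by apply/rz => // g Sg; apply: contrapT => /eqP yg; apply: ny; exists g.
pose D : idomainType := {poly R}.
pose cD : {rmorphism k -> D} := (@polyC R : {rmorphism R -> D}) \o c.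
pose u i : D := 'X * (res (y i))%:P.
(* Proportional orbit points differ by an element of [T], which is covered by finitely many cosets
   of [H]; since [w] is invariant under [H], on the fibre of [g1] the function [wi j] takes only
   values at the [d i * g1]. *)
have [|Q [AQ Q0 QW]] := finite_fibres_algebraic cR cS ry (rw j) ynz.
  move=> g1 Sg1;
    exists [seq wi j (d i * g1)%g | i <- enum 'I_N] => g b Sg b0 Eg.
  have Sg1V := subgroupV sS Sg1.
  have Sgg : S (g * g1^-1)%g by apply: (subgroupM sS).
  have Tg : T (g * g1^-1)%g.
    split=> //; exists b;
      rewrite rM // mulmxA (_ : z *m rho g = b *: (z *m rho g1)).
      by rewrite -scalemxAl -mulmxA (rep_mulgV sS rrho) // mulmx1.
    by apply/rowP => i; rewrite [RHS]mxE; apply: Eg.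
  have [i Hi] := dP _ Tg.
  have Eg' : (g = g * g1^-1 * (d i)^-1 * (d i * g1))%g by rewrite !mulgA
    !mulgVK.
  have Sd : S (d i).
    rewrite (_ : d i = (g * g1^-1 * (d i)^-1)^-1 * (g * g1^-1))%g.
      by apply: (subgroupM sS) => //; apply: (subgroupV sS); apply: HS.
    by rewrite [in RHS]invgM invgK -mulgA mulVg mulg1.
  apply/mapP; exists i; first by rewrite mem_enum.
  rewrite -[LHS]/(wi j g) {1}Eg' /wi wH //.
  exact: (subgroupM sS).
have [i|e eE] := @choice _ _ (fun i e => peval cD u e = Q`_i).
  by have [e _ Ee] := AQ i; exists e.
pose dQ := (size Q).-1.
have szQ : size Q = dQ.+1 by rewrite prednK // size_poly_gt0.
(* The relation is translated by every [x] in [S], so that the residues give vanishing along the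
   whole orbit of [s] and not only at [s]. *)
have relk x g a : S x -> S g ->
    \sum_(i < dQ.+1) peval id (fun i => a * y i (g * x)%g) (e i) * wi j (g *
      x)%g ^+ i = 0.
  move=> Sx Sg; have Sgx := subgroupM sS Sg Sx.
  have [ev [evC evX evf]] := evaluation_poly cR a Sgx.
  have := congr1 ev QW; rewrite horner_coef szQ rmorph_sum rmorph0 => E.
  rewrite -[RHS]E; apply: eq_bigr => i _.
  rewrite rmorphM rmorphXn /= evf //; congr (_ * _).
  rewrite -eE peval_rmorph.
  rewrite (_ : ev \o cD = id); last by apply/funext => a'; apply: evC.
  by apply: eq_peval => i' /=; rewrite rmorphM evX evf.
have rT x f0 : regular G f0 -> regular G (fun g => f0 (g * x)%g).
  exact: (regmapM (@regmap_id _ G) (regmap_cst x)).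
have relK x : S x -> forall a,
    \sum_(i < dQ.+1) peval cK (fun i => cK a * iota (res (fun g => y i (g *
      x)%g))) (e i)
      * iota (res (fun g => wi j (g * x)%g)) ^+ i = 0.
  move=> Sx a.
  have E : \sum_(i < dQ.+1) peval c (fun i => c a * res (fun g => y i (g *
    x)%g)) (e i)
      * res (fun g => wi j (g * x)%g) ^+ i = 0.
    apply: (coord_ring_eq0 cR) => g ev Sg evE;
      rewrite rmorph_sum -[RHS](relk x g a Sx Sg).
    apply: eq_bigr => i _; rewrite rmorphM rmorphXn /= evE;
      last exact: rT (rw j).
    congr (_ * _); rewrite peval_rmorph (_ : ev \o c = id); last first.
      by apply/funext => a'; rewrite /= -rC evE //; apply: regular_cst.
    by apply: eq_peval => i' /=; rewrite rmorphM -rC !evE //;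
      do ?[exact: regular_cst|apply: rT].
  have /(congr1 iota) := E; rewrite rmorph0 rmorph_sum => {}E.
  rewrite -[RHS]E; apply: eq_bigr => i _; rewrite rmorphM rmorphXn;
    congr (_ * _).
  by rewrite peval_rmorph; apply: eq_peval => i' /=; rewrite rmorphM.
pose lead := e (@ord_max dQ).
pose tw x := \sum_i t i * sigma x i j.
have van a x : S x -> peval id (fun i => a * (s *m rho x) 0 i) lead * tw x ^+
  dQ = 0.
  move=> Sx; apply: (place_relation hGr omj _ _ Gomj (relK x Sx)) => [i|].
    rewrite mxE; apply: (linear_residue cR hGr ry (rT x _ (ry i))) => // g Sg.
    by rewrite /y rM // mulmxA mxE.
  apply: (linear_residue cR hGr rw (rT x _ (rw j))) => // g Sg.
  by rewrite /wi wM // mxE.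
have rs i : regular G (fun x => (s *m rho x) 0 i).
  by apply: regular_mulmx => // *; apply: regular_const_mx.
(* [tw] takes the value [t j = 1] at the identity, so the irreducibility of [S] removes its power
   from [van]. *)
have vans a x : S x -> peval id (fun i => a * (s *m rho x) 0 i) lead = 0.
  have rp : regular G (fun x => peval id (fun i => a * (s *m rho x) 0 i) lead).
    have rs' i : regular G (fun x => cst a x * (s *m rho x) 0 i).
      by apply: regularM => //; apply: regular_cst.
    by have [] := regular_peval cR lead rs'.
  have rtw : regular G tw.
    apply: regular_sum => i _; apply: regularM;
      first exact: (regular_cst G (t i)).
    by have [] := rsigma.
  have [x' Sx'||] := irrS rp rtw.
  - have /eqP := van a x' Sx';
      rewrite mulf_eq0 expf_eq0 => /orP[/eqP->|/andP[_ /eqP->]].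
      by rewrite mul0r.
    by rewrite mulr0.
  - by move=> + Sx; apply.
  - move/(_ _ S1); have [_ sI _] := rsigma;
      rewrite /tw sI (bigD1 j) //= mxE eqxx.
    rewrite tj mulr1 big1 ?addr0 => [/eqP|i ij]; first by rewrite oner_eq0.
    by rewrite mxE (negPf ij) mulr0.
(* Imposing the equation for all scalars [a] and all translates by [x] makes [W] a stable cone. It
   contains [s], so it is all of [Z] and contains [z], whose orbit does not satisfy the equation
   because [Q] is nonzero. *)
pose W := Z `&` [set v | forall f0, [set f0 | exists a x, S x /\
  f0 = fun v : 'rV_n => peval id (fun i => a * (v *m rho x) 0 i) lead] f0 -> f0
    v = 0].
have ZW : Z `<=` W.
  apply: minZ; [split|by move=> v0 []|].
  - apply: zclosedI => //; apply: zclosed_zeros => _ [a [x [Sx ->]]].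
    have [e' e'E] : polyfun (fun v : 'rV_n => peval id ((v *m (a *: rho x)) 0)
      lead).
      by apply: (polyfun_mulmx (a *: rho x) (f := fun v : 'rV_n => peval id (v
        0) lead)); exists lead.
    by exists e' => v0; rewrite -e'E; apply: eq_peval => i;
      rewrite -scalemxAr [RHS]mxE.
  - move=> b v0 [Zv0 v0P]; split=> [|_ [a [x [Sx ->]]]]; first exact: Zscale.
    rewrite -[RHS](v0P _ (ex_intro _ (a * b) (ex_intro _ x (conj Sx erefl)))).
    by apply: eq_peval => i; rewrite -scalemxAl [in LHS]mxE mulrA.
  - move=> h v0 Sh [Zv0 v0P]; split=> [|_ [a [x [Sx ->]]]]; first exact: Zstab.
    have Shx := subgroupM sS Sh Sx.
    rewrite -[RHS](v0P _ (ex_intro _ a (ex_intro _ (h * x)%g (conj Shx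
      erefl)))).
    by apply: eq_peval => i; rewrite -mulmxA rM.
  - exists s; first by split=> // _ [a [x [Sx ->]]]; apply: vans.
    by apply/eqP => /rowP/(_ j'); rewrite sj' mxE => /eqP; rewrite oner_eq0.
have lQ : peval cD u lead != 0.
  by rewrite eE -lead_coefE lead_coef_eq0.
have [g [a [ev [Sg evC evX evf /eqP[]]]]] := evaluation_poly_neq0 cR lQ.
have [_ zP] := ZW _ Zz.
rewrite -[RHS](zP _ (ex_intro _ a (ex_intro _ g (conj Sg erefl)))) peval_rmorph.
rewrite (_ : ev \o cD = id); last by apply/funext => a'; apply: evC.
by apply: eq_peval => i' /=; rewrite rmorphM evX evf.
Qed.

End Contradiction.

(* Induction on S: the identity component of the stabilizer of a line is a
   smaller group of the same kind. *)
Theorem borel_invariant (B : set (zariski G)) (f : G -> k) : borel B ->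
  connected [set: zariski G] -> regular G f ->
  (forall b x, B b -> f (b * x)%g = f x) -> forall x, f x = f 1%g.
Proof.
move=> [[[sB0 cB] conB sB] maxB] conG rf fB.
have irrB := connected_irreducible sB0 (proj1 (closed_zariski B) cB) conB.
pose good S := [/\ subgroup S, zcl S, irr S & B `<=` S].
(* The function is quantified inside [bad], since the descent replaces the given invariant by its
   right translates. *)
pose bad S := good S /\ exists h, [/\ regular G h,
  forall b x, B b -> S x -> h (b * x)%g = h x & ~ forall x, S x -> h x = h 1%g].
suff nbad S : ~ bad S.
  have sG : subgroup [set: G] by [].
  have cG : zcl [set: G] by [].
  move=> x; apply: contrapT => fx; apply: (nbad setT); split.
    by split=> //; apply: connected_irreducible.
  by exists f; split=> // [b y|fc]; [move=> Bb _; apply: fB|apply: fx;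
    apply: fc].
move=> bS.
have [||{bS}S [[sS cS irrS BS] [h [rh hB hn]]] minS] :=
  zclosed_minimal (F := bad) 1%g (regular_finitely_generated G).
- by move=> S' [[]].
- by exists S.
apply: (hn); apply: (invariant_constant sS cS irrS BS sB irrB _ _ rh hB).
  move=> solS; apply: hn => x Sx.
  have ES : S = B.
    apply: maxB => //; split=> //; last exact: irreducible_connected.
    by split=> //; apply/closed_zariski.
  rewrite -[x]mulg1 hB //; first by rewrite -ES.
  by case: sS.
move=> H sH cH irrH BH HS nSH h' rh' h'B; apply: contrapT => hn'.
by apply: nSH; apply: minS HS; split=> //; exists h'.
Qed.

End Invariants.

(** * Morphisms of modules *)

Section VectorValued.
Variables (k : closedFieldType) (G : algGroupType k) (V : lmodType k).
Implicit Types (F : G -> V).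

Definition expansion F n (f : 'I_n -> G -> k) (u : 'I_n -> V) : Prop :=
  (forall i, regular G (f i)) /\ forall g, F g = \sum_(i < n) f i g *: u i.

(** These are the elements of the tensor product of k[G] and [V], seen as functions. *)
Definition regular_vector F : Prop := exists n f u, @expansion F n f u.

Lemma regular_vectorD F1 F2 : regular_vector F1 -> regular_vector F2 ->
  regular_vector (fun g => F1 g + F2 g).
Proof.
move=> [n1 [f1 [u1 [r1 E1]]]] [n2 [f2 [u2 [r2 E2]]]].
exists (n1 + n2)%N,
  (fun i => match fintype.split i with inl j => f1 j | inr j => f2 j end),
  (fun i => match fintype.split i with inl j => u1 j | inr j => u2 j end).
split=> [i|g]; first by case: (fintype.split i).
rewrite E1 E2 big_split_ord /=; congr (_ + _); apply: eq_bigr => i _.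
  by rewrite (unsplitK (inl i)).
by rewrite (unsplitK (inr i)).
Qed.

Lemma regular_vectorZ F f : regular G f -> regular_vector F ->
  regular_vector (fun g => f g *: F g).
Proof.
move=> rf [n [f1 [u [r1 E1]]]]; exists n, (fun i g => f g * f1 i g), u.
split=> [i|g]; first exact: regularM.
by rewrite E1 scaler_sumr; apply: eq_bigr => i _; rewrite scalerA.
Qed.

Lemma regular_vector_sum n (F : 'I_n -> G -> V) :
  (forall i, regular_vector (F i)) -> regular_vector (fun g => \sum_(i < n) F i
    g).
Proof.
elim: n F => [|n IHn] F rF.
  exists 0%N, (fun i _ => 0), (fun=> 0); split=> [[]//|g].
  by rewrite !big_ord0.
have [m [f [u [rf E]]]] := regular_vectorD (IHn _ (fun i => rF (widen_ord
  (leqnSn n) i)))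
  (rF ord_max).
by exists m, f, u; split=> // g; rewrite big_ord_recr -E.
Qed.

Lemma expansion_dependent F n (f : 'I_n.+1 -> G -> k) (u : 'I_n.+1 -> V) c i :
  expansion F f u -> \sum_j c j *: u j = 0 -> c i != 0 ->
  exists f' u', @expansion F n f' u'.
Proof.
move=> [rf EF] cu ci.
exists (fun j g => f (lift i j) g + f i g * (- (c (lift i j) / c i))),
  (fun j => u (lift i j)).
split=> [j|g]; first by apply: regularD => //; apply: regularM => //;
  apply: regular_cst.
have Eu : u i = \sum_j - (c (lift i j) / c i) *: u (lift i j).
  apply: (scalerI ci); rewrite scaler_sumr; move/eqP: cu.
  rewrite (bigD1_ord i) //= addr_eq0 => /eqP->; rewrite -sumrN.
  by apply: eq_bigr => j _; rewrite scalerA mulrN mulrC divfK // scaleNr.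
rewrite EF (bigD1_ord i) //= Eu scaler_sumr -big_split /=.
by apply: eq_bigr => j _; rewrite scalerA scalerDl addrC.
Qed.

(* An expansion with a minimal number of terms is over a linearly independent
   family. *)
Lemma invariant_vector (B : set (zariski G)) F : borel B ->
  connected [set: zariski G] -> regular_vector F ->
  (forall b x, B b -> F (b * x)%g = F x) -> forall x, F x = F 1%g.
Proof.
move=> bB conG rF FB.
pose P n := `[< exists f u, @expansion F n f u >].
have exP : exists n, P n.
  by have [n [f [u fu]]] := rF; exists n; apply/asboolP; exists f, u.
case: (ex_minnP exP) => n /asboolP[f [u fu]] minn.
have free (c : 'I_n -> k) : \sum_i c i *: u i = 0 -> forall i, c i = 0.
  case: n f u fu minn c => [|n] f u fu minn c cu i; first by case: i.
  apply: contrapT => /eqP ci; suff : P n by move/minn; rewrite ltnn.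
  by apply/asboolP; apply: expansion_dependent fu cu ci.
have [rf EF] := fu.
move=> x; rewrite !EF; apply: eq_bigr => i _; congr (_ *: _).
apply: (borel_invariant bB conG (rf i)) => b y Bb.
apply/eqP; rewrite -subr_eq0; apply/eqP; move: i.
apply: free; rewrite -[RHS](subrr (F y)) -{1}(FB b y Bb) !EF -sumrB.
by apply: eq_bigr => i _; rewrite scalerBl.
Qed.

End VectorValued.

Section Modules.
Variables (k : closedFieldType) (G : algGroupType k).

Lemma rat_actVK (M : ratModule G) g v : rat_act M (g^-1)%g (rat_act M g v) = v.
Proof. by rewrite -rat_actM mulVg rat_act1. Qed.

Theorem parabolic_hom_ghom (B P : set (zariski G)) (M N : ratModule G)
    (phi : {linear M -> N}) : borel B -> B `<=` P ->
  connected [set: zariski G] -> hom_over P phi -> ghom phi.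
Proof.
move=> bB BP conG phiP g _ m.
pose F x := rat_act N (x^-1)%g (phi (rat_act M x m)).
have FB b x : B b -> F (b * x)%g = F x.
  move=> /BP Pb; rewrite /F rat_actM (phiP b) // invgM rat_actM.
  by rewrite rat_actVK.
(* The vector [m] is expanded first, then each [phi (w i)], on which the inverse of [x] acts; both
   expansions come from rationality. *)
have rF : regular_vector F.
  have [n [f [w [rf Ew]]]] := rat_rational m.
  have E x : F x = \sum_(i < n) f i x *: rat_act N (x^-1)%g (phi (w i)).
    rewrite /F Ew !raddf_sum; apply: eq_bigr => i _.
    by rewrite /= !linearZ_LR.
  rewrite (_ : F = fun x => \sum_(i < n) f i x *: rat_act N (x^-1)%g (phi (w
    i))).
    apply: regular_vector_sum => i; apply: regular_vectorZ => //.
    have [l [h [u [rh Eu]]]] := rat_rational (phi (w i)).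
    exists l, (fun j x => h j (x^-1)%g), u; split=> [j|x]; last exact: Eu.
    exact: (regmapV (@regmap_id _ G) (rh j)).
  exact/funext.
have := invariant_vector bB conG rF FB g.
rewrite /F rat_act1 invg1 rat_act1 => <-.
by rewrite -rat_actM mulgV rat_act1.
Qed.

End Modules.

(** * Vanishing of the relative Ext groups *)

Theorem theorem7p10p1 (k : closedFieldType) (G : algGroupType k)
  (B P : set (zariski G)) (M N : ratModule G) (i : nat) :
  reductive G -> borel B -> parabolic P -> B `<=` P ->
  (0 < i)%N -> rel_Ext_zero P i M N.
Proof.
move=> [conG _] bB _ BP; case: i => // i _ R f [fG df].
have [[_ _ _] [C [C0 CD CP] [KC MKC]]] := res_summand R i.
(* The differential is injective on the complement [C] of its kernel, so a value of [f] has only one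
   lift inside [C]; the linearity and the [P]-equivariance of [s] both follow from this
   uniqueness. *)
have C_inj u v : C u -> C v -> res_diff R i u = res_diff R i v -> u = v.
  move=> Cu Cv duv; apply/eqP; rewrite -subr_eq0; apply/eqP.
  have : (kernel (res_diff R i) `&` C) (u - v).
    split; first by rewrite /kernel /= linearB /= duv subrr.
    by rewrite addrC -scaleN1r; apply: CD.
  by rewrite KC.
have ex m : exists u, C u /\ res_diff R i u = f m.
  have : kernel (res_diff R i.+1) (f m) by apply: df.
  rewrite -res_exactS => -[w _ <-]; have [u [v [Ku Cv ->]]] := MKC w.
  by exists v; rewrite linearD /= Ku add0r.
have [s sP] := choice ex.
have s_linear : linear s.
  move=> a u v; have [Cu du] := sP u; have [Cv dv] := sP v.
  have [Cw dw] := sP (a *: u + v); apply: C_inj => //; first exact: CD.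
  by rewrite dw !linearP du dv.
pose h : {linear M -> R i} := HB.pack s (GRing.isLinear.Build k M (R i) _ s
  s_linear).
exists h; last by move=> m; have [_ <-] := sP m.
apply: (parabolic_hom_ghom bB BP conG) => g Pg m.
have [Cm dm] := sP m; have [Cgm dgm] := sP (rat_act M g m).
apply: C_inj => //=; first exact: CP.
by rewrite dgm fG // res_diff_ghom // dm.
Qed.
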